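(* Let $V$ denote the closure of $C^\infty_{\mathrm o}(\Omega)$ in the space $\{v\in L^{(m+1)/m}(\Omega):\partial_jv\in L^{p_j}(\Omega),\ j=1,\dots,N\}$. Let $u\in V^{\mathbf p,\mathbf m}$ be a weak solution to $\partial_tu-\sum_{j=1}^N\partial_j(a_j(x,t,u)|\partial_ju^{m_j}|^{p_j-2}\partial_ju^{m_j})=f$ in $\Omega_T$. Then $u$ has a representative in $C([0,T],V')$. Especially, there is a constant $C$ such that for all $\tau_1,\tau_2\in[0,T]$, $$\|u(\tau_1)-u(\tau_2)\|_{V'}\le C|\tau_1-\tau_2|^\gamma,$$ where $\gamma=\big(\max\{\max_ip_i,(m+1)/m\}\big)^{-1}$. Here $u(t)$ is regarded as an element of the dual $V'$ of $V$ by the standard embedding $\langle u(t),v\rangle:=\int_\Omega u(t)v\,dx$.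
   Context: Setting. $\Omega\subset\mathbb{R}^N$ is open and bounded, $T>0$, $\Omega_T=\Omega\times(0,T)$, $p_j\in(1,\infty)$, $m_j\ge1$ ($j=1,\dots,N$), $m=\min_jm_j$. The coefficients $a_j:\Omega_T\times\mathbb{R}\to\mathbb{R}$ are measurable in $(x,t)$ and satisfy, for constants $\Lambda,c>0$, $\Lambda^{-1}\le a_j(x,t,u)\le\Lambda$ and $|a_j(x,t,u)-a_j(x,t,v)|\le c|u-v|$ for all $(x,t)\in\Omega_T$, $u,v\in\mathbb{R}$. $f\in L^{\sigma\bar p'}(\Omega_T;[0,\infty))$ where $\bar p=\big(\frac1N\sum_j\frac1{p_j}\big)^{-1}$, $\bar p'=\bar p/(\bar p-1)$, $\sigma>1+\frac N{\bar p}$. $\partial_ju^{m_j}:=\partial_j(u^{m_j})$ (weak derivative); for real $s$ and $\alpha>0$, $s^\alpha:=|s|^{\alpha-1}s$. The norm on $V$ is $\|v\|_V=\|v\|_{L^{(m+1)/m}(\Omega)}+\sum_j\|\partial_jv\|_{L^{p_j}(\Omega)}$. With $q_*=\max(\{m+1\}\cup\{m_j:1\le j\le N\})$, $V^{\mathbf p,\mathbf m}=\{u\in L^{q_*}(\Omega_T):\partial_ju^{m_j}\in L^{p_j}(\Omega_T)\ \forall j\}$. Weak solution: $u\in V^{\mathbf p,\mathbf m}$ with $\iint_{\Omega_T}\sum_ja_j(x,t,u)|\partial_ju^{m_j}|^{p_j-2}\partial_ju^{m_j}\partial_j\varphi-u\,\partial_t\varphi\,dx\,dt=\iint_{\Omega_T}f\varphi\,dx\,dt$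 for all $\varphi\in C^\infty_{\mathrm o}(\Omega_T)$ (smooth, compactly supported). *)

(* Defs.v *)
From HB Require Import structures.
From mathcomp Require Import all_boot all_order all_algebra.
From mathcomp Require Import all_classical all_reals all_analysis.

Set Implicit Arguments.
Unset Strict Implicit.
Unset Printing Implicit Defensive.
Import Order.TTheory GRing.Theory Num.Theory.
Import numFieldNormedType.Exports.
Local Open Scope classical_set_scope.
Local Open Scope ring_scope.

(* The sigma-algebra on R^n generated by the coordinates (the Borel sets), as
   the library does for n.-tuple. *)
Section measurable_rV.
Context (R : realType) (n : nat).

Let coord (i : 'I_n) (x : 'rV[R]_n) : R := x ord0 i.

Let rV_set0 : g_sigma_preimage coord set0.
Proof. exact: sigma_algebra0. Qed.

Let rV_setC A : g_sigma_preimage coord A -> g_sigma_preimage coord (~` A).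
Proof. exact: sigma_algebraC. Qed.

Let rV_bigcup (F : _^nat) : (forall i, g_sigma_preimage coord (F i)) ->
  g_sigma_preimage coord (\bigcup_i (F i)).
Proof. exact: sigma_algebra_bigcup. Qed.

HB.instance Definition _ :=
  @isMeasurable.Build (measure_tuple_display default_measure_display)
    'rV[R]_n (g_sigma_preimage coord) rV_set0 rV_setC rV_bigcup.

End measurable_rV.

Lemma measurable_coord (R : realType) n (i : 'I_n) :
  measurable_fun [set: 'rV[R]_n] (fun x : 'rV[R]_n => x ord0 i).
Proof.
move=> _ Y mY; rewrite setTI; apply: sub_sigma_algebra => /=.
rewrite -bigcup_seq/=; exists i => /=; first by rewrite mem_index_enum.
by exists Y => //; rewrite setTI.
Qed.

Lemma measurable_fun_rVP d (T : measurableType d) (R : realType) n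
    (f : T -> 'rV[R]_n) :
  (forall i, measurable_fun [set: T] (fun x => f x ord0 i)) ->
  measurable_fun [set: T] f.
Proof.
move=> mf _ A mA; rewrite setTI.
suff : [set B : set 'rV[R]_n | measurable (f @^-1` B)] A by [].
move: A mA; apply: smallest_sub.
  split => /=; first by rewrite preimage_set0.
    by move=> B mB; rewrite setTD preimage_setC; exact: measurableC.
  by move=> F mF; rewrite preimage_bigcup; exact: bigcupT_measurable.
rewrite -bigcup_seq => B [i _ [Y mY <-]] /=.
have := mf i measurableT Y mY; rewrite setTI; congr measurable.
by apply/seteqP; split => x /=; tauto.
Qed.

Definition cons_rV (R : realType) n (z : R * 'rV[R]_n) : 'rV[R]_n.+1 :=
  \row_i (if unlift ord0 i is Some j then z.2 ord0 j else z.1).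

Definition uncons_rV (R : realType) n (x : 'rV[R]_n.+1) : R * 'rV[R]_n :=
  (x ord0 ord0, \row_j x ord0 (lift ord0 j)).

Lemma cons_rVK (R : realType) n : cancel (@cons_rV R n) (@uncons_rV R n).
Proof.
move=> [a x]; rewrite /uncons_rV /cons_rV mxE unlift_none; congr pair.
by apply/rowP => j; rewrite !mxE liftK.
Qed.

Lemma uncons_rVK (R : realType) n : cancel (@uncons_rV R n) (@cons_rV R n).
Proof.
by move=> x; apply/rowP => i; rewrite mxE; case: unliftP => [j|] -> //=; rewrite mxE.
Qed.

Lemma measurable_cons_rV (R : realType) n :
  measurable_fun [set: R * 'rV[R]_n] (@cons_rV R n).
Proof.
apply: measurable_fun_rVP => i; rewrite /cons_rV.
under eq_fun do rewrite mxE.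
case: unliftP => [j _|_]; last exact: measurable_fst.
exact: (measurableT_comp (measurable_coord j) measurable_snd).
Qed.

Lemma measurable_uncons_rV (R : realType) n :
  measurable_fun [set: 'rV[R]_n.+1] (@uncons_rV R n).
Proof.
apply/measurable_fun_pairP; split; first exact: measurable_coord.
apply: measurable_fun_rVP => i.
rewrite /uncons_rV /=; under eq_fun do rewrite mxE.
exact: measurable_coord.
Qed.

Section lebesgue_rVS.
Local Open Scope ereal_scope.
Context (R : realType) (n : nat).
Variable mu : {sigma_finite_measure set 'rV[R]_n -> \bar R}.

Definition lebesgue_rVS : set 'rV[R]_n.+1 -> \bar R :=
  pushforward (lebesgue_measure \x mu) (@cons_rV R n).

Let preim_cons (A : set 'rV[R]_n.+1) : measurable A ->
  measurable (@cons_rV R n @^-1` A).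
Proof. by move=> mA; rewrite -[X in measurable X]setTI; exact: measurable_cons_rV. Qed.

Let rVS0 : lebesgue_rVS set0 = 0.
Proof. by rewrite /lebesgue_rVS /pushforward preimage_set0 measure0. Qed.

Let rVS_ge0 A : 0 <= lebesgue_rVS A.
Proof. by rewrite /lebesgue_rVS /pushforward measure_ge0. Qed.

Let rVS_sigma_additive : semi_sigma_additive lebesgue_rVS.
Proof.
move=> F mF tF mUF; rewrite /lebesgue_rVS /pushforward preimage_bigcup.
apply: measure_semi_sigma_additive.
- by move=> k; exact: preim_cons.
- apply/trivIsetP => i j _ _ ij; rewrite -preimage_setI.
  by move/trivIsetP : tF => /(_ _ _ I I ij) ->; rewrite preimage_set0.
- by rewrite -preimage_bigcup; exact: preim_cons.
Qed.

HB.instance Definition _ :=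
  isMeasure.Build _ _ _ lebesgue_rVS rVS0 rVS_ge0 rVS_sigma_additive.

Let rVS_sigma_finite : sigma_finite setT lebesgue_rVS.
Proof.
have /sigma_finiteP[F [TF ndF Foo]] := sigma_finiteT (@lebesgue_measure R).
have /sigma_finiteP[G [TG ndG Goo]] := sigma_finiteT mu.
exists (fun k => @uncons_rV R n @^-1` (F k `*` G k)).
  rewrite -preimage_bigcup -(preimage_setT (@uncons_rV R n)); congr preimage.
  apply/seteqP; split => -[x y] // _.
  have [i _ Fix] : (\bigcup_k F k) x by rewrite -TF.
  have [j _ Gjy] : (\bigcup_k G k) y by rewrite -TG.
  exists (maxn i j) => //; split => /=.
    by move: x Fix; exact/subsetPset/ndF/leq_maxl.
  by move: y Gjy; exact/subsetPset/ndG/leq_maxr.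
move=> k; have [mF Fk] := Foo k; have [mG Gk] := Goo k; split.
  rewrite -[X in measurable X]setTI.
  by apply: measurable_uncons_rV => //; exact: measurableX.
rewrite /lebesgue_rVS /pushforward -comp_preimage.
rewrite (_ : _ \o _ = id); last by apply/funext => z; exact: cons_rVK.
by rewrite preimage_id product_measure1E// lte_mul_pinfty// ge0_fin_numE.
Qed.

HB.instance Definition _ :=
  Measure_isSigmaFinite.Build _ _ _ lebesgue_rVS rVS_sigma_finite.

End lebesgue_rVS.

Fixpoint lebesgue_rV (R : realType) (n : nat) :
    {sigma_finite_measure set 'rV[R]_n -> \bar R} :=
  if n is k.+1 then lebesgue_rVS (lebesgue_rV R k) else dirac (0 : 'rV[R]_0).

Lemma lebesgue_rV_box (R : realType) n (A : 'I_n -> set R) :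
  (forall i, measurable (A i)) ->
  lebesgue_rV R n [set x | forall i, A i (x ord0 i)] =
  (\prod_(i < n) lebesgue_measure (A i))%E.
Proof.
elim: n A => [|n IHn] A mA.
  by rewrite big_ord0 /= /dirac indicE mem_set// => -[].
have mB : measurable
    [set x : 'rV[R]_n | forall i, A (lift ord0 i) (x ord0 i)].
  rewrite (_ : mkset _ = \big[setI/setT]_(i < n)
      ((fun x : 'rV[R]_n => x ord0 i) @^-1` A (lift ord0 i))).
    apply: bigsetI_measurable => i _; rewrite -[X in measurable X]setTI.
    exact: measurable_coord.
  rewrite -bigcap_seq; apply/seteqP; split => x /= xA i.
    by move=> _; exact: xA.
  by apply: (xA i); rewrite /= mem_index_enum.
rewrite big_ord_recl -IHn//=.
have := product_measure1E lebesgue_measure (lebesgue_rV R n) (mA ord0) mB.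
move=> /= <-.
rewrite /lebesgue_rVS /pushforward.
congr (_ _); apply/seteqP; split => -[a x] /=.
  move=> H; split.
    by have := H ord0; rewrite mxE unlift_none.
  by move=> i; have := H (lift ord0 i); rewrite mxE liftK.
by move=> [Aa H] i; rewrite mxE; case: unliftP => [j ->|->].
Qed.

#[short(type="measurableNormedModType")]
HB.structure Definition MeasurableNormedMod (K : numFieldType)
  (d : measure_display) := {T of NormedModule K T & Measurable d T}.

HB.instance Definition _ (R : realType) n := Measurable.on 'rV[R]_n.
HB.instance Definition _ (R : realType) := Measurable.on R.
HB.instance Definition _ (K : numFieldType) d1 d2
  (T1 : measurableNormedModType K d1) (T2 : measurableNormedModType K d2) :=
  Measurable.on (T1 * T2)%type.

(* lebesgue_measure lives on measurableTypeR R, an alias of R that carries no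
   topology. *)
Definition lebesgue_R (R : realType) : set R -> \bar R := @lebesgue_measure R.

Section lebesgue_R.
Context (R : realType).

Let lebesgue_R_sigma_finite : sigma_finite setT (@lebesgue_R R).
Proof. exact: (sigma_finiteT (@lebesgue_measure R)). Qed.

HB.instance Definition _ := isMeasure.Build _ _ _ (@lebesgue_R R)
  (measure0 (@lebesgue_measure R))
  (measure_ge0 (@lebesgue_measure R))
  (@measure_semi_sigma_additive _ _ _ (@lebesgue_measure R)).

HB.instance Definition _ := Measure_isSigmaFinite.Build _ _ _ (@lebesgue_R R)
  lebesgue_R_sigma_finite.

End lebesgue_R.

Definition lebesgue_rVT (R : realType) n :
    {measure set ('rV[R]_n * R) -> \bar R} :=
  (lebesgue_rV R n \x @lebesgue_R R)%E.

(* C^oo: all iterated directional derivatives exist and are differentiable. *)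
Definition smooth (R : realType) (T : normedModType R) (phi : T -> R) :=
  forall (vs : seq T) (x : T),
    differentiable (foldr (fun v (g : T -> R) => 'D_v g) phi vs) x.

(* C^oo_o(D) *)
Definition test_function (R : realType) (T : normedModType R) (D : set T) :
    set (T -> R) :=
  [set phi | let supp := closure [set x | phi x != 0] in
    [/\ smooth phi, compact supp & supp `<=` D]].

Section function_spaces.
Context (R : realType) (d : measure_display) (T : measurableNormedModType R d).
Variables (mu : {measure set T -> \bar R}) (D : set T).
Implicit Types f g phi : T -> R.

(* Measurability for the mu-completion of the sigma-algebra. *)
Definition lebesgue_measurable f :=
  exists2 g, measurable_fun D g & ae_eq mu D f g.

(* Elements of L^q(D) are represented by Borel functions on the whole space, of
   which only the values on D matter. *)
Definition Lp (q : R) : set (T -> R) :=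
  [set f | f \_ D \in Lfun mu q%:E].

Definition Lp_norm (q : R) f : \bar R := 'N[mu]_(q%:E)[EFin \o (f \_ D)].

Definition L1_loc : set (T -> R) :=
  [set f | measurable_fun D f /\
    forall K, compact K -> K `<=` D -> mu.-integrable K (EFin \o f)].

Definition weak_derivative (e : T) f g :=
  [/\ L1_loc f, L1_loc g & forall phi, test_function D phi ->
    (\int[mu]_(x in D) (f x * 'D_e phi x)%:E =
     - \int[mu]_(x in D) (g x * phi x)%:E)%E].

(* Weak derivatives are unique up to a null set; cst 0 when there is none. *)
Definition wderive (e : T) f : T -> R :=
  xget (cst 0) [set g | weak_derivative e f g].

Definition wderive_Lp (q : R) (e : T) f :=
  exists2 g, weak_derivative e f g & Lp q g.

End function_spaces.

Definition spow (R : realType) (s a : R) : R := `|s| `^ (a - 1) * s.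

(* The space dimension is n.+1, so that minima and maxima over j make sense. *)
Section parameters.
Context (R : realType) (n : nat).
Implicit Types x p m : 'I_n.+1 -> R.

Definition max_index x : R := \big[Num.max/x ord0]_j x j.
Definition min_index x : R := \big[Num.min/x ord0]_j x j.

Definition hmean_exp p : R := (n.+1%:R^-1 * \sum_j (p j)^-1)^-1.

Definition q_star m : R := Num.max (min_index m + 1) (max_index m).

(* (m + 1) / m with m = min_j m_j *)
Definition r_exp m : R := (min_index m + 1) / min_index m.

Definition dx (j : 'I_n.+1) : 'rV[R]_n.+1 := delta_mx ord0 j.
Definition dx_T (j : 'I_n.+1) : 'rV[R]_n.+1 * R := (delta_mx ord0 j, 0).
Definition dt_T : 'rV[R]_n.+1 * R := (0, 1).

End parameters.

Section space_V.
Context (R : realType) (n : nat).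
Variables (Om : set 'rV[R]_n.+1) (p m : 'I_n.+1 -> R).
Local Notation leb := (lebesgue_rV R n.+1).
Implicit Types v w : 'rV[R]_n.+1 -> R.

Definition W_space : set ('rV[R]_n.+1 -> R) :=
  [set v | Lp leb Om (r_exp m) v /\
    forall j, wderive_Lp leb Om (p j) (dx R j) v].

Definition V_norm v : \bar R :=
  (Lp_norm leb Om (r_exp m) v +
   \sum_(j < n.+1) Lp_norm leb Om (p j) (wderive leb Om (dx R j) v))%E.

Definition V_space : set ('rV[R]_n.+1 -> R) :=
  [set v | W_space v /\ forall e : R, 0 < e ->
    exists2 phi, test_function Om phi & (V_norm (v \- phi)%R < e%:E)%E].

(* V' : a functional is only looked at on V_space. Boundedness makes it
   invariant under changes of its argument on a null set. *)
Definition V_dual : set (('rV[R]_n.+1 -> R) -> R) :=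
  [set L |
    (forall (c : R) v w, V_space v -> V_space w ->
       L (fun x => c * v x + w x) = c * L v + L w) /\
    exists K : R, forall v, V_space v -> (`|L v|%:E <= K%:E * V_norm v)%E].

Definition V_dual_norm (L : ('rV[R]_n.+1 -> R) -> R) : \bar R :=
  ereal_sup [set `|L v|%:E | v in [set v | V_space v /\ (V_norm v <= 1)%E]].

(* L is the image of w under the standard embedding into V' *)
Definition V_embed w (L : ('rV[R]_n.+1 -> R) -> R) :=
  forall v, V_space v ->
    leb.-integrable Om (fun x => (w x * v x)%:E) /\
    L v = \int[leb]_(x in Om) (w x * v x).

Definition C0T_V_dual (T : R) : set (R -> ('rV[R]_n.+1 -> R) -> R) :=
  [set U | (forall t, t \in `[0, T] -> V_dual (U t)) /\
    forall t, t \in `[0, T] ->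
      V_dual_norm (U s \- U t) @[s --> within [set` `[0, T]] (nbhs t)] --> 0%E].

End space_V.

Section weak_solutions.
Context (R : realType) (n : nat).
Variables (Om : set 'rV[R]_n.+1) (T : R) (p m : 'I_n.+1 -> R).
Local Notation leb := (lebesgue_rVT R n.+1).

Definition cylinder : set ('rV[R]_n.+1 * R) := Om `*` [set` `]0, T[].

Definition dpow (u : 'rV[R]_n.+1 * R -> R) (j : 'I_n.+1) :=
  wderive leb cylinder (dx_T R j) (fun z => spow (u z) (m j)).

Definition V_pm : set ('rV[R]_n.+1 * R -> R) :=
  [set u | Lp leb cylinder (q_star m) u /\ forall j,
    wderive_Lp leb cylinder (p j) (dx_T R j) (fun z => spow (u z) (m j))].

Definition weak_solution (a : 'I_n.+1 -> 'rV[R]_n.+1 * R -> R -> R)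
    (f u : 'rV[R]_n.+1 * R -> R) :=
  V_pm u /\ forall phi, test_function cylinder phi ->
    (\int[leb]_(z in cylinder)
       ((\sum_j a j z (u z) * (`|dpow u j z| `^ (p j - 2) * dpow u j z) *
                'D_(dx_T R j) phi z)
        - u z * 'D_(dt_T R n) phi z)%:E =
     \int[leb]_(z in cylinder) (f z * phi z)%:E)%E.

End weak_solutions.

(* Main.v *)
From HB Require Import structures.
Require Import Defs.
From mathcomp Require Import all_boot all_order all_algebra.
From mathcomp Require Import all_classical all_reals all_analysis.
From mathcomp Require Import measurable_realfun.
From mathcomp Require Import ring lra.
(** For a test function [phi] on [Om] let [F phi t] be the integral of
    [u (x, t) * phi x] over [Om]. Testing the equation with products
    [phi x * chi t] shows that [F phi] has an integrable weak derivative in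
    time, so by the lemma of du Bois-Reymond the increment of [F phi] between
    almost all times [t1 < t2] is the integral over [Om] times [(t1, t2)] of the
    source against [phi] minus the flux against the gradient of [phi]. The
    exceptional times depend on [phi], but test functions admit a countable
    family that is dense for the uniform norm of values and first derivatives,
    so one set [G] of full measure serves all of them ([pairing_increment]).

    Hoelder's inequality bounds the [j]-th flux term by the norm of the flux in
    the dual exponent of [p j], times the power [1 / p j] of the length of the
    time interval, times the norm of the [j]-th derivative of [phi]. The source
    is paired with [phi] itself. Some [p j] is at least the harmonic mean of the
    exponents, so the source lies in the dual space for this [p j], and
    Poincare's inequality in direction [j] replaces [phi] by its derivative.
    Since every [1 / p j] is at least the exponent [gam] of the theorem,
    [|F phi t1 - F phi t2| <= C * |t1 - t2| ^ gam * V_norm phi] for all times of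
    [G] ([increment_estimate], [solution_increment]).

    At almost every time [u] belongs to [L^(m + 1)], the dual of
    [L^((m + 1) / m)], so both sides of the estimate are continuous on [V] and
    the estimate passes from test functions to their closure
    ([V_space_extend_estimate]). The set [G] is dense in [[0, T]]; the required
    representative [U t v] is the limit of [F v] along a sequence of [G] that
    converges to [t]. Linearity, boundedness and the Hoelder estimate are
    inherited by the limit, and [U] agrees with [u] on [G].

    Weak derivatives enter the norm of [V] and the equation through a choice, so
    their uniqueness is needed, that is, the fundamental lemma of the calculus
    of variations ([ae_eq0_of_box_bumps]), for which smooth bumps are built from
    [exp (- 1 / x)]. The coefficients are measurable only up to null sets: the
    flux is replaced by a Borel representative
    ([caratheodory_ae_measurable]) and integrals of almost everywhere equal
    functions are compared without measurability
    ([integral_ae_eq_nonmeasurable]). *)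

Import Order.TTheory GRing.Theory Num.Theory.
Import numFieldNormedType.Exports.
Local Open Scope classical_set_scope.
Local Open Scope ring_scope.
Set Implicit Arguments.
Unset Strict Implicit.
Unset Printing Implicit Defensive.

(** * Smooth functions *)

Section smooth_functions.
Context (R : realType).
Implicit Types T U : normedModType R.

(** Smooth functions form the largest class of differentiable functions that is
    stable under directional derivatives; to prove smoothness it is enough to
    exhibit one such class. *)
Lemma smooth_coind T (P : (T -> R) -> Prop) :
  (forall f, P f -> (forall x, differentiable f x) /\ forall v, P ('D_v f)) ->
  forall f, P f -> smooth f.
Proof.
move=> H f Pf vs x; suff /H[] : P (foldr (fun v g => 'D_v g) f vs) by [].
by elim: vs => //= v vs /H[_ ]; exact.
Qed.

Lemma smooth_differentiable T (f : T -> R) x : smooth f -> differentiable f x.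
Proof. by move=> /(_ [::] x). Qed.

Lemma smooth_derivable T (f : T -> R) x v : smooth f -> derivable f x v.
Proof. by move=> sf; exact/diff_derivable/smooth_differentiable. Qed.

Lemma smooth_continuous T (f : T -> R) : smooth f -> continuous f.
Proof. by move=> sf x; exact/differentiable_continuous/smooth_differentiable. Qed.

Lemma smooth_derive T (f : T -> R) v : smooth f -> smooth ('D_v f).
Proof.
move=> sf vs x; have := sf (rcons vs v) x.
by rewrite -cats1 foldr_cat.
Qed.

(** Products alone are not stable under derivatives because of the product rule;
    the algebra generated by the smooth functions is. *)
Inductive smooth_alg T : (T -> R) -> Prop :=
| Smooth_alg_gen f : smooth f -> smooth_alg f
| Smooth_alg_cst c : smooth_alg (cst c)
| Smooth_algD f g : smooth_alg f -> smooth_alg g -> smooth_alg (f \+ g)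
| Smooth_algM f g : smooth_alg f -> smooth_alg g -> smooth_alg (f \* g).

Lemma smooth_alg_smooth T (f : T -> R) : smooth_alg f -> smooth f.
Proof.
apply: smooth_coind f => f; elim => {f}.
- move=> f sf; split; first by move=> x; exact: smooth_differentiable.
  by move=> v; exact/Smooth_alg_gen/smooth_derive.
- move=> c; split; first by move=> x; exact: differentiable_cst.
  move=> v; rewrite (_ : 'D_v _ = cst 0); first exact: Smooth_alg_cst.
  by apply/funext => x; rewrite derive_cst.
- move=> f g sf [df Df] sg [dg Dg]; split.
    by move=> x; exact: differentiableD.
  move=> v; rewrite (_ : 'D_v _ = 'D_v f \+ 'D_v g); first exact: Smooth_algD.
  by apply/funext => x; rewrite deriveD//; exact/diff_derivable.
- move=> f g sf [df Df] sg [dg Dg]; split.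
    by move=> x; exact: differentiableM.
  move=> v; rewrite (_ : 'D_v _ = (f \* 'D_v g) \+ (g \* 'D_v f)).
    by apply: Smooth_algD; exact: Smooth_algM.
  by apply/funext => x; rewrite deriveM//; exact/diff_derivable.
Qed.

Lemma smooth_cst T (c : R) : smooth (cst c : T -> R).
Proof. exact/smooth_alg_smooth/Smooth_alg_cst. Qed.

Lemma smoothD T (f g : T -> R) : smooth f -> smooth g -> smooth (f \+ g).
Proof.
by move=> sf sg; apply/smooth_alg_smooth/Smooth_algD; exact: Smooth_alg_gen.
Qed.

Lemma smoothM T (f g : T -> R) : smooth f -> smooth g -> smooth (f \* g).
Proof.
by move=> sf sg; apply/smooth_alg_smooth/Smooth_algM; exact: Smooth_alg_gen.
Qed.

Lemma smoothZ T (c : R) (f : T -> R) : smooth f -> smooth (fun x => c * f x).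
Proof. by move=> sf; apply: (@smoothM _ (cst c)) => //; exact: smooth_cst. Qed.

Lemma smoothB T (f g : T -> R) : smooth f -> smooth g -> smooth (f \- g).
Proof.
move=> sf sg.
rewrite (_ : _ \- _ = f \+ (fun x => -1 * g x)); last first.
  by apply/funext => x /=; rewrite mulN1r.
by apply: smoothD => //; exact: smoothZ.
Qed.

Lemma smooth_prod T (I : Type) (s : seq I) (f : I -> T -> R) :
  (forall i, smooth (f i)) -> smooth (fun x => \prod_(i <- s) f i x).
Proof.
move=> sf; elim: s => [|i s IH].
  by under eq_fun do rewrite big_nil; exact: smooth_cst.
by under eq_fun do rewrite big_cons; exact: smoothM.
Qed.

(** No differentiability is involved: the difference quotients agree. *)
Lemma derive_comp_affine T U (f : U -> R) (l : {linear T -> U}) (c : U) x v :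
  'D_v (fun y => f (l y + c)) x = 'D_(l v) f (l x + c).
Proof.
rewrite /derive.
suff -> : (fun h : R => h^-1 *: (((fun y => f (l y + c)) \o shift x) (h *: v) -
    f (l x + c))) =
  (fun h => h^-1 *: ((f \o shift (l x + c)) (h *: l v) - f (l x + c))) by [].
by apply/funext => h /=; rewrite (linearD l) (linearZ_LR l) addrA.
Qed.

Lemma smooth_comp_affine T U (f : U -> R) (l : {linear T -> U}) (c : U) :
  continuous l -> smooth f -> smooth (fun x => f (l x + c)).
Proof.
move=> cl sf.
pose P (h : T -> R) := exists2 g : U -> R, smooth g & h = fun x => g (l x + c).
apply: (@smooth_coind _ P); last by exists f.
move=> _ [g sg ->]; split => [x|v].
  apply: (@differentiable_comp _ _ _ _ (fun x => l x + c) g); last first.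
    exact: smooth_differentiable.
  apply: differentiableD; last exact: differentiable_cst.
  exact: linear_differentiable.
exists ('D_(l v) g); first exact: smooth_derive.
by apply/funext => x; rewrite derive_comp_affine.
Qed.

Lemma derive_real (f : R -> R) (x v : R) : differentiable f x ->
  'D_v f x = v * 'D_1 f x.
Proof.
move=> df; rewrite !deriveE// -{1}(mulr1 v).
by rewrite -[v * 1]/(v *: 1) linearZ.
Qed.

Lemma smooth_antiderivative (F f : R -> R) :
  (forall x : R, is_derive x (1 : R) F (f x)) -> smooth f -> smooth F.
Proof.
move=> Ff sf; pose P (g : R -> R) := smooth g \/ g = F.
apply: (@smooth_coind _ P); last by right.
move=> g [sg|->].
  split; first by move=> x; exact: smooth_differentiable.
  by move=> v; left; exact: smooth_derive.
have dF x : differentiable F x by apply/derivable1_diffP; have [] := Ff x.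
split => // v; left; rewrite (_ : 'D_v F = fun x => v * f x); first exact: smoothZ.
by apply/funext => x; rewrite derive_real// (@derive_val _ _ _ _ _ _ _ (Ff x)).
Qed.

End smooth_functions.

(** * Smooth cut-off functions *)

Section bumps.
Context (R : realType).

(** One term of the exponential series. *)
Lemma expr_le_fact_expR (y : R) i : 0 <= y -> y ^+ i <= i`!%:R * expR y.
Proof.
move=> y0; case: i => [|i].
  by rewrite expr0 fact0 mul1r -expR0 ler_expR.
rewrite mulrC -ler_pdivrMr ?ltr0n ?fact_gt0//.
by apply: le_trans (expR_ge1Dxn i y0); rewrite lerDr.
Qed.

Lemma horner_expRN_bounded (q : {poly R}) :
  exists C, forall y : R, 0 <= y -> `|q.[y]| * expR (- y) <= C.
Proof.
exists (\sum_(i < size q) `|q`_i| * i`!%:R) => y y0.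
rewrite expRN ler_pdivrMr ?expR_gt0// horner_coef mulr_suml.
apply: le_trans (ler_norm_sum _ _ _) _; apply: ler_sum => i _.
rewrite normrM -mulrA ler_wpM2l// ger0_norm ?exprn_ge0//.
exact: expr_le_fact_expR.
Qed.

(** Every derivative of [exp(-1/x)] is a polynomial in [1/x] times
    [exp(-1/x)]; carrying the polynomial along makes the class stable. *)
Definition flat_poly (p : {poly R}) (x : R) : R :=
  if 0 < x then p.[x^-1] * expR (- x^-1) else 0.

Lemma is_derive_flat_poly p (x : R) :
  is_derive x (1 : R) (flat_poly p) (flat_poly ('X^2 * (p - p^`())) x).
Proof.
have [x0|x0|->] := ltgtP x 0.
- rewrite {2}/flat_poly ltNge (ltW x0)/=.
  apply: (@near_eq_is_derive _ _ _ (cst 0)).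
  near=> y; have y0 : y < 0 by near: y; exact: lt_nbhsl.
  by rewrite /flat_poly ltNge (ltW y0).
- have dV : is_derive x (1 : R) (fun y : R => y^-1) (- x ^- 2).
    have dV := is_deriveV (lt0r_neq0 x0 : id x != 0) (is_derive_id x (1 : R)).
    by apply: is_derive_eq; rewrite /GRing.scale /= mulr1.
  have dp := @is_derive1_comp R (horner p) (fun y : R => y^-1) x _ _ (is_derive_poly p x^-1) dV.
  have de := @is_derive1_comp R (@expR R) (fun y : R => - y^-1) x _ _
    (is_derive_expR _) (is_deriveN dV).
  have := is_deriveM dp de.
  move=> {dp de} dH.
  have : is_derive x (1 : R) (fun y => p.[y^-1] * expR (- y^-1))
      (flat_poly ('X^2 * (p - p^`())) x).
    apply: is_derive_eq; rewrite /flat_poly x0 /GRing.scale/=.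
    rewrite hornerM hornerXn hornerD hornerN.
    rewrite -exprVn; ring.
  apply: near_eq_is_derive; near=> y.
  have y0 : 0 < y by near: y; exact: lt_nbhsr.
  by rewrite /flat_poly y0.
- rewrite {2}/flat_poly ltxx.
  have [C CP] := horner_expRN_bounded (p * 'X^2).
  have C0 : 0 <= C.
    by apply: le_trans (CP 0 (lexx _)); rewrite mulr_ge0 ?expR_ge0.
  have cv : h^-1 *: ((flat_poly p \o shift 0) (h *: (1:R)) - flat_poly p 0)
      @[h --> 0^'] --> (0 : R).
    apply/cvgr0Pnorm_lt => e e0; near=> h.
    have h0 : h != 0 by near: h; exact: nbhs_dnbhs_neq.
    rewrite /= addr0 {2}/flat_poly ltxx subr0 /flat_poly [h *: 1]mulr1.
    case: ifPn => hp; last by rewrite scaler0 normr0.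
    apply: (@le_lt_trans _ _ (C * h)).
      have hi : 0 <= h^-1 by rewrite invr_ge0 ltW.
      rewrite normrM ger0_norm// normrM [`|expR _|]ger0_norm ?expR_ge0//.
      have := CP _ hi; rewrite hornerM hornerXn normrM [`|_ ^+ 2|]ger0_norm ?sqr_ge0//.
      rewrite -ler_pdivrMr//; apply: le_trans.
      by rewrite le_eqVlt; apply/orP; left; apply/eqP; rewrite expr2; ring.
    have : `|h| < e / (C + 1).
      by near: h; apply: dnbhs0_lt; rewrite divr_gt0// ltr_wpDl.
    rewrite gtr0_norm// ltr_pdivlMr ?ltr_wpDl// => /(le_lt_trans _); apply.
    by rewrite mulrDr mulr1 mulrC lerDl ltW.
  apply: DeriveDef; first by apply/cvg_ex; exists 0.
  exact: cvg_lim cv.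
Unshelve. all: by end_near. Qed.

Lemma smooth_flat_poly p : smooth (flat_poly p : R -> R).
Proof.
apply: (@smooth_coind _ _ (fun h => exists q, h = flat_poly q)); last by exists p.
move=> _ [q ->].
have dq x : differentiable (flat_poly q) x.
  by apply/derivable1_diffP; have [] := is_derive_flat_poly q x.
split => // v; exists (v *: ('X^2 * (q - q^`()))); apply/funext => x.
rewrite derive_real// (@derive_val _ _ _ _ _ _ _ (is_derive_flat_poly q x)).
by rewrite /flat_poly; case: ifPn; rewrite ?mulr0// hornerZ mulrA.
Qed.

(** [exp(-1/x)], extended by 0 to the left. *)
Definition flat : R -> R := flat_poly 1.

Lemma flat_ge0 x : 0 <= flat x.
Proof.
by rewrite /flat /flat_poly hornerC mul1r; case: ifPn; rewrite // expR_ge0.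
Qed.

Lemma flat_le1 x : flat x <= 1.
Proof.
rewrite /flat /flat_poly hornerC mul1r; case: ifPn => // x0.
by rewrite -expR0 ler_expR oppr_le0 invr_ge0 ltW.
Qed.

Lemma flat_gt0 x : (0 < flat x) = (0 < x).
Proof.
rewrite /flat /flat_poly hornerC mul1r; case: ifPn; rewrite ?ltxx// => _.
exact: expR_gt0.
Qed.

Lemma flat_eq0 x : x <= 0 -> flat x = 0.
Proof. by rewrite /flat /flat_poly ltNge => ->. Qed.

Lemma smooth_flat : smooth (flat : R -> R).
Proof. exact: smooth_flat_poly. Qed.

Lemma cvg_flat (c : R) : 0 < c -> flat (n.+1%:R * c) @[n --> \oo] --> (1 : R).
Proof.
move=> c0; rewrite /flat /flat_poly.
rewrite (_ : (fun n => _) = (fun n : nat => expR (- (n.+1%:R^-1 * c^-1)))).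
  have : expR (- (n.+1%:R^-1 * c^-1)) @[n --> \oo] --> expR (- (0 * c^-1)).
    apply: continuous_cvg; first exact: continuous_expR.
    by apply: cvgN; apply: cvgMr_tmp; exact: cvg_harmonic.
  by rewrite mul0r oppr0 expR0.
by apply/funext => n; rewrite mulr_gt0// hornerC mul1r invfM.
Qed.

(** Smooth on the line, positive exactly on [`]a, b[], and increasing with [n]
    to the indicator function of that interval. *)
Definition cutoff (n : nat) (a b x : R) : R :=
  flat (n.+1%:R * (x - a)) * flat (n.+1%:R * (b - x)).

Lemma smooth_cutoff n a b : smooth (cutoff n a b : R -> R).
Proof.
apply: smoothM.
  rewrite (_ : (fun x => _) = (fun x => flat (n.+1%:R *: x + (- (n.+1%:R * a))))).
    apply: smooth_comp_affine; last exact: smooth_flat.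
    exact: scaler_continuous.
  by apply/funext => x; rewrite mulrBr.
rewrite (_ : (fun x => _) = (fun x => flat (- n.+1%:R *: x + n.+1%:R * b))).
  apply: smooth_comp_affine; last exact: smooth_flat.
  exact: scaler_continuous.
by apply/funext => x; rewrite mulrBr addrC scaleNr.
Qed.

Lemma cutoff_ge0 n a b x : 0 <= cutoff n a b x.
Proof. by rewrite mulr_ge0// flat_ge0. Qed.

Lemma cutoff_le1 n a b x : cutoff n a b x <= 1.
Proof. by rewrite mulr_ile1// ?flat_ge0// flat_le1. Qed.

Lemma cutoff_gt0 n a b x : a < x < b -> 0 < cutoff n a b x.
Proof. by move=> /andP[ax xb]; rewrite mulr_gt0// flat_gt0 mulr_gt0// subr_gt0. Qed.

Lemma cutoff_neq0 n a b x : cutoff n a b x != 0 -> a < x < b.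
Proof.
rewrite /cutoff mulf_eq0 negb_or => /andP[fa fb]; apply/andP; split.
  rewrite ltNge; apply: contra fa => xa; apply/eqP/flat_eq0.
  by rewrite pmulr_rle0// subr_le0.
rewrite ltNge; apply: contra fb => xa; apply/eqP/flat_eq0.
by rewrite pmulr_rle0// subr_le0.
Qed.

Lemma cvg_cutoff a b x : a < x < b -> cutoff n a b x @[n --> \oo] --> (1 : R).
Proof.
move=> /andP[ax xb]; rewrite -[X in _ --> X](mulr1 1).
by apply: cvgM; apply: cvg_flat; rewrite subr_gt0.
Qed.

End bumps.

(** * Coordinate systems and boxes *)

(** The fundamental lemma is used on the line, in space and in space-time. This
    record isolates what its proof needs: finitely many continuous linear
    coordinates that control the norm and generate the sigma-algebra, and whose
    boxes are compact. *)
Record coordinates (R : realType) d (T : measurableNormedModType R d) (k : nat)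
    : Type := Coordinates {
  crd :> 'I_k -> {linear T -> R};
  crd_continuous : forall i, continuous (crd i);
  crd_norm : forall x e, 0 < e -> (forall i, `|crd i x| < e) -> `|x| < e;
  crd_compact : forall a b : 'I_k -> R,
    compact [set x | forall i, a i <= crd i x <= b i];
  crd_measurable : forall i, measurable_fun [set: T] (crd i);
  crd_measurableP : forall d' (X : measurableType d') (f : X -> T),
    (forall i, measurable_fun [set: X] (fun x => crd i (f x))) ->
    measurable_fun [set: X] f
}.

Lemma ae_forall_countType d (T : measurableType d) (R : realType)
    (mu : {measure set T -> \bar R}) (I : countType) (Q : I -> T -> Prop) :
  (forall i, {ae mu, forall x, Q i x}) -> {ae mu, forall x, forall i, Q i x}.
Proof.
move=> aQ; pose P n x := if unpickle n is Some i then Q i x else True.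
have : {ae mu, forall x, forall n, P n x}.
  apply: ae_foralln => n; rewrite /P; case: (unpickle n) => [i|]; first exact: aQ.
  exact: aeW.
by apply: filterS => x Px i; have := Px (pickle i); rewrite /P pickleK.
Qed.

Section boxes.
Context (R : realType) (d : measure_display) (T : measurableNormedModType R d).
Context (k : nat) (l : coordinates T k).

Definition obox (a b : 'I_k -> R) : set T := [set x | forall i, a i < l i x < b i].
Definition cbox (a b : 'I_k -> R) : set T := [set x | forall i, a i <= l i x <= b i].

Lemma obox_cbox a b : obox a b `<=` cbox a b.
Proof. by move=> x h i; have /andP[/ltW -> /ltW ->] := h i. Qed.

Lemma oboxI a b a' b' : obox a b `&` obox a' b' =
  obox (fun i => Num.max (a i) (a' i)) (fun i => Num.min (b i) (b' i)).
Proof.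
apply/seteqP; split => x /=.
  move=> [h h'] i; have /andP[h1 h2] := h i; have /andP[h3 h4] := h' i.
  by rewrite gt_max lt_min h1 h2 h3 h4.
move=> h; split => i; have := h i; rewrite gt_max lt_min;
  by move=> /andP[/andP[h1 h2] /andP[h3 h4]]; apply/andP.
Qed.

Lemma measurable_obox a b : measurable (obox a b).
Proof.
rewrite (_ : obox a b = \big[setI/setT]_(i < k) (l i @^-1` `]a i, b i[%classic)).
  apply: bigsetI_measurable => i _; rewrite -[X in measurable X]setTI.
  exact: crd_measurable.
rewrite -bigcap_seq; apply/seteqP; split => x /= h i.
  by move=> _; rewrite /= in_itv/=; exact: h.
by have := h i; rewrite /= in_itv/= mem_index_enum; exact.
Qed.

(** Boxes are stable under intersection, so this opens the way to Dynkin's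
    theorem and to the uniqueness of measures. *)
Lemma measurable_obox_generated :
  @measurable d T = <<s [set B | exists a b, B = obox a b] >>.
Proof.
apply/seteqP; split => [A mA|]; last first.
  by apply: smallest_sub; [exact: sigma_algebra_measurable|move=> _ [a [b ->]];
    exact: measurable_obox].
set G := (X in <<s X>> A); pose X := g_sigma_algebraType G.
suff : measurable_fun [set: X] (id : X -> T) by move=> /(_ measurableT A mA); rewrite setTI.
apply: (@crd_measurableP R d T k l _ X id) => i.
apply: (measurability _ (RGenOInfty.measurableE R)) => _ [_ [x ->] <-].
rewrite setTI (_ : _ @^-1` _ = \bigcup_n (obox
  (fun j => if j == i then x else - n%:R) (fun _ => n%:R))).
  by apply: bigcupT_measurable => n; apply: sub_sigma_algebra;
    eexists; eexists.
apply/seteqP; split => y /=; last first.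
  by move=> [n _ /(_ i)]; rewrite eqxx in_itv/= => /andP[->].
rewrite in_itv/= andbT => xy.
pose M := \sum_j `|l j y|; exists (Num.truncn M).+1 => // j.
have yM : `|l j y| < (Num.truncn M).+1%:R.
  apply: le_lt_trans (truncnS_gt _); rewrite /M (bigD1 j)//= lerDl sumr_ge0//.
move: yM; rewrite ltr_norml => /andP[y1 y2]; rewrite y2 andbT.
by case: eqP => [->|_].
Qed.

Lemma cbox_ball (x y : T) e : 0 < e ->
  (forall i, `|l i x - l i y| < e) -> `|x - y| < e.
Proof.
by move=> e0 h; apply: (crd_norm (c := l)) => // i; rewrite linearB.
Qed.

Lemma open_rational_box (A : set T) x : open A -> A x ->
  exists ab : {ffun 'I_k -> rat} * {ffun 'I_k -> rat},
    obox (ratr \o ab.1) (ratr \o ab.2) x /\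
    cbox (ratr \o ab.1) (ratr \o ab.2) `<=` A.
Proof.
move=> oA Ax; have /nbhs_ballP[e/= e0 eA] : nbhs x A by exact: open_nbhs_nbhs.
have e2 : 0 < e / 2 by rewrite divr_gt0.
have ha i : exists q : rat, l i x - e / 2 < ratr q < l i x.
  have /rat_in_itvoo[q] : l i x - e / 2 < l i x by rewrite ltrBlDr ltrDl.
  by rewrite in_itv; exists q.
have hb i : exists q : rat, l i x < ratr q < l i x + e / 2.
  have /rat_in_itvoo[q] : l i x < l i x + e / 2 by rewrite ltrDl.
  by rewrite in_itv; exists q.
exists ([ffun i => projT1 (cid (ha i))], [ffun i => projT1 (cid (hb i))]).
split => [i /=|y /= h].
  rewrite !ffunE; case: cid => p /= /andP[_ ->].
  by case: cid => q /= /andP[->].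
apply: eA; rewrite -ball_normE/=; apply: cbox_ball => // i.
have := h i; rewrite /= !ffunE; case: cid => p /= /andP[p1 p2].
case: cid => q /= /andP[q1 q2] /andP[h1 h2].
by rewrite ltr_norml; apply/andP; split; lra.
Qed.

Lemma open_bigcup_obox (A : set T) : open A ->
  A = \bigcup_(ab : {ffun 'I_k -> rat} * {ffun 'I_k -> rat})
    (if `[< cbox (ratr \o ab.1) (ratr \o ab.2) `<=` A >]
     then obox (ratr \o ab.1) (ratr \o ab.2) else set0).
Proof.
move=> oA; apply/seteqP; split => x /=.
  move=> Ax; have [ab [xab abA]] := open_rational_box oA Ax.
  by exists ab => //; case: asboolP.
by move=> [ab _]; case: asboolP => // abA /obox_cbox; exact: abA.
Qed.

Lemma open_measurable_crd (A : set T) : open A -> measurable A.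
Proof.
move=> /open_bigcup_obox ->; apply: countable_bigcupT_measurable => // ab.
by case: ifP => // _; exact: measurable_obox.
Qed.

Lemma compact_measurable_crd (A : set T) : compact A -> measurable A.
Proof.
move=> cA; rewrite -[A]setCK; apply/measurableC/open_measurable_crd/closed_openC.
by apply: compact_closed => //; exact: norm_hausdorff.
Qed.

Lemma continuous_measurable_crd (f : T -> R) (D : set T) :
  continuous f -> measurable_fun D f.
Proof.
move=> /continuousP cf; apply: measurable_funTS.
apply: (measurability _ (RGenOpens.measurableE R)) => _ [_ [x [y ->]] <-].
by rewrite setTI; apply/open_measurable_crd/cf.
Qed.

Definition box_bump (a b : 'I_k -> R) (n : nat) (x : T) : R :=
  \prod_i cutoff n (a i) (b i) (l i x).

Lemma box_bump_ge0 a b n x : 0 <= box_bump a b n x.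
Proof. by apply: prodr_ge0 => i _; exact: cutoff_ge0. Qed.

Lemma box_bump_le1 a b n x : box_bump a b n x <= 1.
Proof.
by apply: prodr_ile1 => i _; rewrite cutoff_ge0 cutoff_le1.
Qed.

Lemma box_bump_neq0 a b n x : box_bump a b n x != 0 -> obox a b x.
Proof.
by move=> /prodf_neq0 h i; apply: (@cutoff_neq0 _ n); exact: h.
Qed.

Lemma smooth_box_bump a b n : smooth (box_bump a b n).
Proof.
apply: smooth_prod => i.
rewrite (_ : (fun x => _) = (fun x => cutoff n (a i) (b i) (l i x + 0))).
  by apply: smooth_comp_affine; [exact: crd_continuous|exact: smooth_cutoff].
by apply/funext => x; rewrite addr0.
Qed.

Lemma cvg_box_bump a b x : obox a b x -> box_bump a b n x @[n --> \oo] --> (1 : R).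
Proof.
move=> h; rewrite /box_bump; elim: (index_enum _) => [|i s IH].
  rewrite (_ : (fun n => _) = cst 1); first exact: cvg_cst.
  by apply/funext => n; rewrite big_nil.
rewrite (_ : (fun n => _) = (fun n => cutoff n (a i) (b i) (l i x) *
  \prod_(j <- s) cutoff n (a j) (b j) (l j x))); last first.
  by apply/funext => n; rewrite big_cons.
rewrite -[X in _ --> X](mulr1 1).
by apply: cvgM => //; exact: cvg_cutoff.
Qed.

Lemma test_function_box_bump (D : set T) a b n : cbox a b `<=` D ->
  test_function D (box_bump a b n).
Proof.
move=> abD; have ccl : closed (cbox a b).
  by apply: compact_closed; [exact: norm_hausdorff|exact: crd_compact].
have sub : closure [set x | box_bump a b n x != 0] `<=` cbox a b.
  rewrite closureE; apply: smallest_sub => // x /= /box_bump_neq0.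
  exact: obox_cbox.
split; first exact: smooth_box_bump.
  apply: subclosed_compact sub; first exact: closed_closure.
  exact: crd_compact.
exact: subset_trans abD.
Qed.

End boxes.

Section coordinate_instances.
Context (R : realType) (n : nat).

Definition crd_rV (i : 'I_n.+1) (x : 'rV[R]_n.+1) : R := x ord0 i.

Let crd_rV_linear i : linear (crd_rV i).
Proof. by move=> c x y; rewrite /crd_rV !mxE. Qed.

HB.instance Definition _ i :=
  GRing.isLinear.Build R 'rV[R]_n.+1 R *:%R (crd_rV i) (crd_rV_linear i).

Definition crd_rVR (i : 'I_n.+2) (z : 'rV[R]_n.+1 * R) : R :=
  if unlift ord0 i is Some j then z.1 ord0 j else z.2.

Let crd_rVR_linear i : linear (crd_rVR i).
Proof. by move=> c x y; rewrite /crd_rVR; case: unlift => //= j; rewrite !mxE. Qed.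

HB.instance Definition _ i :=
  GRing.isLinear.Build R ('rV[R]_n.+1 * R)%type R *:%R (crd_rVR i) (crd_rVR_linear i).

Definition crd_R (i : 'I_1) (x : R) : R := x.

Let crd_R_linear i : linear (crd_R i).
Proof. by []. Qed.

HB.instance Definition _ i :=
  GRing.isLinear.Build R R R *:%R (crd_R i) (crd_R_linear i).

Lemma rV_norm_lt (x : 'rV[R]_n.+1) e : 0 < e -> (forall i, `|x ord0 i| < e) -> `|x| < e.
Proof.
move=> e0 h; rewrite [`|x|]mx_normrE; apply/bigmax_ltP.
by split => // -[i j] _ /=; rewrite (ord1 i).
Qed.

Definition coordinates_rV : coordinates 'rV[R]_n.+1 n.+1.
Proof.
apply: (@Coordinates _ _ _ _ (fun i => crd_rV i : {linear _ -> _})) => /=.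
- by move=> i; exact: coord_continuous.
- exact: rV_norm_lt.
- move=> a b; exact: (@rV_compact R n.+1 (fun i => `[a i, b i]%classic)
    (fun i => @segment_compact _ _ _)).
- exact: measurable_coord.
- by move=> d' X f mf; exact: measurable_fun_rVP.
Defined.

Definition coordinates_R : coordinates R 1.
Proof.
apply: (@Coordinates _ _ _ _ (fun i => crd_R i : {linear _ -> _})) => /=.
- by move=> i x; exact: cvg_id.
- by move=> x e _ /(_ ord0).
- move=> a b.
  have := @segment_compact R (a ord0) (b ord0).
  congr (compact _); apply/seteqP; split => x /=; rewrite in_itv/=.
    by move=> h i; rewrite (ord1 i).
  by move=> /(_ ord0).
- by move=> i; exact: measurable_id.
- by move=> d' X f /(_ ord0).
Defined.

Definition coordinates_rVR : coordinates ('rV[R]_n.+1 * R)%type n.+2.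
Proof.
apply: (@Coordinates _ _ _ _ (fun i => crd_rVR i : {linear _ -> _})) => /=.
- move=> i; rewrite /crd_rVR; case: unliftP => [j _|_].
    move=> z; apply: (@continuous_comp _ _ _ fst (fun x : 'rV[R]_n.+1 => x ord0 j)).
      exact: cvg_fst.
    exact: coord_continuous.
  by move=> z; exact: cvg_snd.
- move=> [x t] e e0 h; rewrite [`|_|]/(Num.max _ _) gt_max; apply/andP; split.
    by apply: rV_norm_lt => // i; have := h (lift ord0 i); rewrite /crd_rVR liftK.
  by have := h ord0; rewrite /crd_rVR unlift_none.
- move=> a b.
  have := compact_setX
    (@rV_compact R n.+1 (fun i => `[a (lift ord0 i), b (lift ord0 i)]%classic)
      (fun i => @segment_compact _ _ _))
    (@segment_compact R (a ord0) (b ord0)).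
  congr (compact _); apply/seteqP; split => -[x t]/=; rewrite in_itv/=.
    move=> [hx ht] i; rewrite /crd_rVR; case: unliftP => [j ->|-> //].
    by have := hx j; rewrite in_itv.
  move=> h; split; last by have := h ord0; rewrite /crd_rVR unlift_none.
  by move=> i; rewrite in_itv; have := h (lift ord0 i); rewrite /crd_rVR liftK.
- move=> i; rewrite /crd_rVR; case: unliftP => [j _|_]; last exact: measurable_snd.
  exact: (measurableT_comp (measurable_coord j) measurable_fst).
- move=> d' X f mf; apply/measurable_fun_pairP; split.
    apply: measurable_fun_rVP => i; have := mf (lift ord0 i).
    by rewrite /crd_rVR liftK.
  by have := mf ord0; rewrite /crd_rVR unlift_none.
Defined.

End coordinate_instances.

(** * Test functions and the fundamental lemma *)

Section test_functions.
Context (R : realType) (T : normedModType R).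

Lemma test_function_smooth (D : set T) (phi : T -> R) :
  test_function D phi -> smooth phi.
Proof. by case. Qed.

Lemma test_function_outside (D : set T) (phi : T -> R) x :
  test_function D phi -> ~ D x -> phi x = 0.
Proof.
move=> [_ _ sD] Dx; apply/eqP; apply: contrapT => /negP phix; apply: Dx.
by apply: sD; exact: subset_closure.
Qed.

Lemma test_function_bounded (D : set T) (phi : T -> R) :
  test_function D phi -> exists2 M, 0 <= M & forall x, `|phi x| <= M.
Proof.
move=> [sp cp _]; set K := closure _ in cp.
have /compact_bounded[M [Mr HM]] : compact (phi @` K).
  by apply: continuous_compact => //; exact/continuous_subspaceT/smooth_continuous.
exists (`|M| + 1); first by rewrite addr_ge0.
move=> x; have [->|px] := eqVneq (phi x) 0; first by rewrite normr0 addr_ge0.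
apply: HM; first by rewrite (le_lt_trans (ler_norm _))// ltrDl.
by exists x => //; exact: subset_closure.
Qed.

(** A derivative vanishes wherever the function vanishes nearby, so supports
    do not grow under differentiation. *)
Lemma test_function_derive (D : set T) (phi : T -> R) v :
  test_function D phi -> test_function D ('D_v phi).
Proof.
move=> [sp cp sD]; set K := closure _ in cp sD.
have sub : closure [set x | 'D_v phi x != 0] `<=` K.
  rewrite closureE; apply: smallest_sub; first exact: closed_closure.
  move=> x /= dx; apply: contrapT => Kx.
  move/negP : dx; apply; apply/eqP.
  rewrite (@near_eq_derive _ _ _ phi (cst 0) x v) ?derive_cst//.
  have : nbhs x (~` K).
    by apply: open_nbhs_nbhs; split => //; exact/closed_openC/closed_closure.
  apply: filterS => y Ky; apply: contrapT => /eqP py; apply: Ky.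
  exact: subset_closure.
split; first exact: smooth_derive.
  by apply: subclosed_compact sub => //; exact: closed_closure.
exact: subset_trans sD.
Qed.

(** The support of [psi] lies in that of [phi]. *)
Lemma test_function_pred (D : set T) (phi psi : T -> R) :
  smooth psi -> test_function D phi -> (forall x, phi x = 0 -> psi x = 0) ->
  test_function D psi.
Proof.
move=> spsi [sp cp sD] h; set K := closure _ in cp sD.
have sub : closure [set x | psi x != 0] `<=` K.
  apply: closure_subset => x /=; apply: contra => /eqP/h ->; exact/eqP.
split => //; last exact: subset_trans sD.
by apply: subclosed_compact sub => //; exact: closed_closure.
Qed.

Lemma test_function0 (D : set T) : test_function D (cst 0 : T -> R).
Proof.
have e : [set x : T | (cst 0 : T -> R) x != 0] = set0.
  by apply/seteqP; split => x //=; rewrite eqxx.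
rewrite /test_function /= e closure0.
by split => //; [exact: smooth_cst|exact: compact0].
Qed.

End test_functions.

Section fundamental_lemma.
Context (R : realType) (d : measure_display) (T : measurableNormedModType R d).
Context (k : nat) (l : coordinates T k).
Variable mu : {measure set T -> \bar R}.
Variable D : set T.
Hypothesis openD : open D.
Implicit Types f g h phi : T -> R.

Let mD : measurable D.
Proof. exact: (open_measurable_crd l). Qed.

Lemma measurable_test_function phi A : test_function D phi -> measurable_fun A phi.
Proof.
by move=> tp; apply: (continuous_measurable_crd l); apply: smooth_continuous; case: tp.
Qed.

Lemma L1_loc_mul_integrable g phi : L1_loc mu D g -> test_function D phi ->
  mu.-integrable D (fun x => (g x * phi x)%:E).
Proof.
move=> [mg ig] tp; have [M M0 phiM] := test_function_bounded tp.
have [sp cK KD] := tp; set K := closure _ in cK KD.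
have mK : measurable K := compact_measurable_crd l cK.
have iK : mu.-integrable K (fun x => (g x * phi x)%:E).
  apply: (@le_integrable _ _ _ _ _ mK _ (fun x => M%:E * (EFin \o g) x)%E).
  - apply/measurable_EFinP/measurable_funM; last exact: measurable_test_function.
    exact: measurable_funS mg.
  - move=> x Kx; rewrite /= lee_fin !normrM mulrC (ger0_norm M0).
    by rewrite ler_wpM2r.
  - by apply: integrableZl => //; exact: ig.
apply/(integrable_mkcond _ mD); have := (integrable_mkcond _ mK).1 iK.
apply: eq_integrable => // x _.
rewrite !patchE; case: ifPn => xK; case: ifPn => xD //.
- by rewrite notin_setE in xD; case: xD; apply: KD; exact: set_mem.
- rewrite notin_setE in xK; have [->|px] := eqVneq (phi x) 0; first by rewrite mulr0.
  by case: xK; exact: subset_closure.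
Qed.

Section vanishing.
Variable h : T -> R.
Hypothesis L1h : L1_loc mu D h.
Hypothesis h0 : forall a b n, cbox l a b `<=` D ->
  (\int[mu]_(x in D) (h x * box_bump l a b n x)%:E = 0)%E.

Lemma integrable_box a b : cbox l a b `<=` D ->
  mu.-integrable (obox l a b) (EFin \o h).
Proof.
move=> abD; apply: (@integrableS _ _ _ mu (cbox l a b)).
- exact/(compact_measurable_crd l)/crd_compact.
- exact: measurable_obox.
- exact: obox_cbox.
- by apply: L1h.2 => //; exact: crd_compact.
Qed.

(** The bumps increase to the indicator function of the box, so the integral
    over the box is a limit of integrals against test functions. *)
Lemma integral_box0 a b : cbox l a b `<=` D ->
  (\int[mu]_(x in obox l a b) (h x)%:E = 0)%E.
Proof.
move=> abD; have mB := measurable_obox l a b; have ih := integrable_box abD.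
have mh := measurable_int _ ih.
have e n : (\int[mu]_(x in obox l a b) (h x * box_bump l a b n x)%:E = 0)%E.
  rewrite -(h0 n abD) integral_mkcond [RHS]integral_mkcond.
  apply: eq_integral => x _; rewrite !patchE.
  case: ifPn => xB; case: ifPn => xD //.
    rewrite notin_setE in xD; case: xD; apply: abD; apply: obox_cbox.
    exact: set_mem.
  rewrite notin_setE in xB; have [->|px] := eqVneq (box_bump l a b n x) 0.
    by rewrite mulr0.
  by case: xB; exact: (box_bump_neq0 px).
have : ((\int[mu]_(x in obox l a b) (h x * box_bump l a b n x)%:E) @[n --> \oo]
    --> \int[mu]_(x in obox l a b) (h x)%:E)%E.
  apply: (@dominated_cvg _ _ _ mu _ mB _ _ (fun x => `|h x|%:E)).
  - move=> n; apply/measurable_EFinP/measurable_funM; first exact/measurable_EFinP.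
    apply: (continuous_measurable_crd l); apply: smooth_continuous.
    exact: smooth_box_bump.
  - move=> x xB; apply: cvg_EFin; first exact: nearW.
    rewrite -[X in _ --> X]mulr1; apply: cvgM; first exact: cvg_cst.
    exact: cvg_box_bump.
  - by [].
  - exact: integrable_abse ih.
  - move=> n x _; rewrite lee_fin normrM (ger0_norm (box_bump_ge0 _ _ _ _ _)) ler_piMr//.
    exact: box_bump_le1.
under eq_fun do rewrite e.
by move=> /cvg_unique; apply => //; exact: cvg_cst.
Qed.

(** Dynkin's theorem: the sets [S] with this property form a lambda-system that
    contains the boxes, which generate the sigma-algebra. *)
Lemma integral_trace0 a b : cbox l a b `<=` D ->
  forall S, measurable S -> (\int[mu]_(x in S `&` obox l a b) (h x)%:E = 0)%E.
Proof.
move=> abD; set Q := obox l a b.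
have mQ : measurable Q := measurable_obox l a b.
have ih : mu.-integrable Q (EFin \o h) := integrable_box abD.
rewrite (measurable_obox_generated l).
apply: dynkin_induction; first exact: (measurable_obox_generated l).
- by move=> _ _ [a1 [b1 ->]] [a2 [b2 ->]]; rewrite oboxI; eexists; eexists.
- by rewrite setTI; exact: integral_box0.
- move=> _ [a1 [b1 ->]]; rewrite /Q oboxI; apply: integral_box0 => x hx.
  apply: abD => i; have := hx i; rewrite ge_max le_min.
  by move=> /andP[/andP[_ h1] /andP[_ h2]]; apply/andP.
- move=> S mS S0; have := integral_box0 abD; rewrite -/Q.
  have QE : Q = (S `&` Q) `|` (~` S `&` Q) by rewrite -setIUl setUCr setTI.
  rewrite {1}QE integral_setU//.
  + by rewrite S0 add0e.
  + exact: measurableI.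
  + by apply: measurableI => //; exact: measurableC.
  + by rewrite -QE; exact: measurable_int ih.
  + by apply/disj_set2P; rewrite setIACA setICr set0I.
- move=> F mF tF F0; rewrite setI_bigcupl integral_bigcup.
  + by rewrite eseries0.
  + exact: trivIset_setIr.
  + by move=> i; exact: measurableI.
  + apply: integrableS ih => //; first by apply: bigcup_measurable => i _; exact: measurableI.
    by move=> x [i _ []].
Qed.

(** Fundamental lemma of the calculus of variations. Countably many rational
    boxes cover [D], so it is enough that [h] vanishes almost everywhere on each
    of them. Only bumps of boxes serve as test functions: on the line these are
    the ones whose antiderivatives are under control. *)
Lemma ae_eq0_of_box_bumps : ae_eq mu D h (cst 0).
Proof.
pose a (q : {ffun 'I_k -> rat} * {ffun 'I_k -> rat}) (i : 'I_k) : R := ratr (q.1 i).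
pose b (q : {ffun 'I_k -> rat} * {ffun 'I_k -> rat}) (i : 'I_k) : R := ratr (q.2 i).
suff : {ae mu, forall x, forall q, cbox l (a q) (b q) `<=` D ->
    obox l (a q) (b q) x -> h x = 0}.
  apply: filterS => x hx Dx.
  by have [q [xq qD]] := open_rational_box l openD Dx; apply: (hx q).
apply: ae_forall_countType => q.
have [qD|nqD] := pselect (cbox l (a q) (b q) `<=` D); last exact: aeW.
have : ae_eq mu (obox l (a q) (b q)) (EFin \o h) (cst 0%E).
  apply: integral_ae_eq => //.
  - exact: measurable_obox.
  - exact: integrable_box.
  - move=> E EQ mE; rewrite integral0.
    by rewrite -(integral_trace0 qD mE) (setIidl EQ).
by apply: filterS => x hx _ /hx[].
Qed.

End vanishing.

Lemma weak_derivative_unique e f g1 g2 :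
  weak_derivative mu D e f g1 -> weak_derivative mu D e f g2 -> ae_eq mu D g1 g2.
Proof.
move=> [L1f L1g1 H1] [_ L1g2 H2].
suff : ae_eq mu D (g1 \- g2) (cst 0).
  by apply: filterS => x h Dx; apply/eqP; rewrite -subr_eq0; apply/eqP; exact: h.
apply: ae_eq0_of_box_bumps.
  split; first by apply: measurable_funB; [case: L1g1|case: L1g2].
  move=> K cK KD; have mK := compact_measurable_crd l cK.
  rewrite (_ : _ \o _ = (EFin \o g1) \- (EFin \o g2))%E//.
  by apply: integrableB => //; [exact: L1g1.2|exact: L1g2.2].
move=> a b n abD; have := test_function_box_bump n abD.
set phi := box_bump l a b n => tp.
under eq_integral do rewrite /= mulrBl EFinB.
rewrite integralB//; try exact: L1_loc_mul_integrable.
have -> : (\int[mu]_(x in D) (g1 x * phi x)%:E = \int[mu]_(x in D) (g2 x * phi x)%:E)%E.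
  by apply: oppe_inj; rewrite -H1// -H2.
rewrite subee//; apply: integrable_fin_num => //.
exact: L1_loc_mul_integrable.
Qed.

Lemma weak_derivativeB e f1 f2 g1 g2 :
  weak_derivative mu D e f1 g1 -> weak_derivative mu D e f2 g2 ->
  weak_derivative mu D e (f1 \- f2) (g1 \- g2).
Proof.
have L1B u v : L1_loc mu D u -> L1_loc mu D v -> L1_loc mu D (u \- v).
  move=> [mu1 iu] [mv iv]; split; first exact: measurable_funB.
  move=> K cK KD; have mK := compact_measurable_crd l cK.
  rewrite (_ : _ \o _ = (EFin \o u) \- (EFin \o v))%E//.
  by apply: integrableB => //; [exact: iu|exact: iv].
move=> [L1f1 L1g1 H1] [L1f2 L1g2 H2]; split; [exact: L1B|exact: L1B|].
move=> phi tp; have tdp := test_function_derive e tp.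
under eq_integral do rewrite /= mulrBl EFinB.
rewrite integralB//; try exact: L1_loc_mul_integrable.
under [in RHS]eq_integral do rewrite /= mulrBl EFinB.
rewrite [in RHS]integralB//; try exact: L1_loc_mul_integrable.
rewrite H1// H2// oppeK fin_num_oppeB//; apply: integrable_fin_num => //.
exact: L1_loc_mul_integrable.
Qed.

Lemma wderive_weak_derivative e f g : weak_derivative mu D e f g ->
  weak_derivative mu D e f (wderive mu D e f).
Proof. by move=> fg; rewrite /wderive; apply: (xgetPex (cst 0)); exists g. Qed.

Lemma wderive_ae_eq e f g : weak_derivative mu D e f g ->
  ae_eq mu D (wderive mu D e f) g.
Proof.
move=> fg; apply: (@weak_derivative_unique e f) => //.
exact: wderive_weak_derivative fg.
Qed.

End fundamental_lemma.

(** * Translation invariance of the Lebesgue measure *)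

Section lebesgue_translation.
Context (R : realType) (n : nat).
Local Notation leb := (lebesgue_rV R n.+1).
Local Notation obox := (obox (coordinates_rV R n)).
Local Notation cbox := (cbox (coordinates_rV R n)).

Lemma lebesgue_rV_obox (a b : 'I_n.+1 -> R) :
  leb (obox a b) = (\prod_(i < n.+1) lebesgue_measure `]a i, b i[%classic)%E.
Proof.
rewrite -(@lebesgue_rV_box R n.+1 (fun i => `]a i, b i[%classic))//.
Qed.

Lemma lebesgue_rV_obox_lty (a b : 'I_n.+1 -> R) : (leb (obox a b) < +oo)%E.
Proof.
rewrite lebesgue_rV_obox ltey_eq; apply/orP; left.
apply: (@big_ind _ (fun x => x \is a fin_num)%E) => //.
  by move=> x y; exact: fin_numM.
by move=> i _; rewrite lebesgue_measure_itv/=; case: ifP.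
Qed.

Lemma bounded_sub_obox (A : set 'rV[R]_n.+1) : bounded_set A ->
  exists2 M : R, 0 < M & A `<=` obox (fun=> - M) (fun=> M).
Proof.
move=> [M [Mr HM]]; exists (`|M| + 2); first by rewrite ltr_wpDl.
move=> x Ax i.
have : `|x| <= `|M| + 1.
  by apply: HM => //; rewrite (le_lt_trans (ler_norm _))// ltrDl.
move=> xM; have : `|x ord0 i| <= `|M| + 1.
  apply: le_trans xM; rewrite [leRHS]mx_normrE.
  by apply/bigmax_geP; right; exists (ord0, i).
rewrite ler_norml => /andP[h1 h2]; rewrite /= /crd_rV.
by apply/andP; split; lra.
Qed.

Lemma bounded_lebesgue_lty (A : set 'rV[R]_n.+1) :
  measurable A -> bounded_set A -> (leb A < +oo)%E.
Proof.
move=> mA /bounded_sub_obox[M _ AM].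
apply: le_lt_trans (lebesgue_rV_obox_lty (fun=> - M) (fun=> M)).
by apply: le_measure => //; rewrite inE//; exact: measurable_obox.
Qed.

Lemma measurable_shift (e : 'rV[R]_n.+1) :
  measurable_fun setT (fun x : 'rV[R]_n.+1 => x + e).
Proof.
apply: measurable_fun_rVP => i; under eq_fun do rewrite mxE.
by apply: measurable_funD => //; exact: measurable_coord.
Qed.

Definition shift_rV (e x : 'rV[R]_n.+1) : 'rV[R]_n.+1 := x + e.

HB.instance Definition _ e := isMeasurableFun.Build _ _ _ _
  (shift_rV e) (measurable_shift e).

(** Both measures agree on boxes, which are stable under intersection, generate
    the sigma-algebra and exhaust the space with finite measure. *)
Lemma lebesgue_rV_shift (e : 'rV[R]_n.+1) (A : set 'rV[R]_n.+1) :
  measurable A -> pushforward leb (shift_rV e) A = leb A.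
Proof.
move=> mA.
have oE a b : shift_rV e @^-1` obox a b =
    obox (fun i => a i - e ord0 i) (fun i => b i - e ord0 i).
  apply/seteqP; split => x /= h i; have := h i; rewrite /= /crd_rV /shift_rV mxE => /andP[h1 h2];
  by apply/andP; split; lra.
apply: (@measure_unique _ R _ [set B | exists a b, B = obox a b]
  (fun k => obox (fun=> - k%:R) (fun=> k%:R))) => //.
- exact: (measurable_obox_generated (coordinates_rV R n)).
- by move=> _ _ [a1 [b1 ->]] [a2 [b2 ->]]; rewrite oboxI; eexists; eexists.
- by move=> k; eexists; eexists.
- apply/seteqP; split => // x _.
  have [|M _ xM] := @bounded_sub_obox [set x].
    by exists `|x|; split => // M /ltW xM y ->.
  exists (Num.truncn M).+1 => // i; have := xM x erefl i.
  move=> /andP[h1 h2]; have h3 := truncnS_gt M.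
  by apply/andP; split; lra.
- move=> _ [a [b ->]].
  transitivity (leb (shift_rV e @^-1` obox a b)) => //.
  rewrite oE lebesgue_rV_obox; apply: etrans (esym (lebesgue_rV_obox a b)).
  apply: eq_bigr => i _; rewrite !lebesgue_measure_itv/= !lte_fin ltrD2r.
  by case: ifP => // _; rewrite -!EFinD; congr EFin; lra.
- move=> k; change (leb (shift_rV e @^-1` obox (fun=> (- k%:R)%R) (fun=> k%:R%R)) < +oo)%E.
  by rewrite oE; exact: lebesgue_rV_obox_lty.
Qed.

End lebesgue_translation.

(** * Integration along rays *)

Section lebesgue_R_integral.
Context (R : realType).

(* [lebesgue_R] and [lebesgue_measure] are the same set function on types
   whose measurable structures have different displays. *)
Let idR : measurableTypeR R -> R := id.
Let midR : measurable_fun setT idR.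
Proof. by move=> _ A mA; rewrite setTI. Qed.

Lemma ge0_integral_lebesgue_R (D : set R) (f : R -> \bar R) :
  measurable D -> measurable_fun D f -> (forall x, D x -> 0 <= f x)%E ->
 (\int[@lebesgue_R R]_(x in D) f x = \int[@lebesgue_measure R]_(x in D) f x)%E.
Proof.
move=> mD mf f0.
transitivity (\int[pushforward (@lebesgue_measure R) idR]_(x in D) f x)%E.
  exact: eq_measure_integral.
rewrite (ge0_integral_pushforward midR)//.
by move=> x /set_mem; exact: f0.
Qed.

Lemma integral_lebesgue_R (D : set R) (f : R -> \bar R) :
  measurable D -> measurable_fun D f ->
 (\int[@lebesgue_R R]_(x in D) f x = \int[@lebesgue_measure R]_(x in D) f x)%E.
Proof.
move=> mD mf; rewrite integralE [RHS]integralE; congr (_ - _)%E.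
  by apply: ge0_integral_lebesgue_R => //; exact: measurable_funepos.
by apply: ge0_integral_lebesgue_R => //; exact: measurable_funeneg.
Qed.

Lemma smooth_FTC (g : R -> R) (a b : R) : a < b -> smooth g ->
  (\int[@lebesgue_R R]_(s in `[a, b]) ('D_1 g s)%:E = (g b - g a)%:E)%E.
Proof.
move=> ab sg.
have cdg : continuous ('D_1 g) by apply/smooth_continuous/smooth_derive.
rewrite integral_lebesgue_R//; last first.
  by apply/measurable_EFinP; exact: (continuous_measurable_crd (coordinates_R R)).
rewrite (@continuous_FTC2 _ _ g)//.
- exact: continuous_subspaceT.
- split.
  + by move=> s _; exact: smooth_derivable.
  + by apply: cvg_at_right_filter; exact: smooth_continuous.
  + by apply: cvg_at_left_filter; exact: smooth_continuous.
- by move=> s _; rewrite derive1E.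
Qed.

End lebesgue_R_integral.

Section rays.
Context (R : realType) (n : nat).
Local Notation leb := (lebesgue_rV R n.+1).
Implicit Types (e x : 'rV[R]_n.+1) (h : 'rV[R]_n.+1 -> R).

Lemma ge0_integral_shift e (f : 'rV[R]_n.+1 -> \bar R) :
  measurable_fun setT f -> (forall x, (0 <= f x)%E) ->
  (\int[leb]_x f (x + e)%R = \int[leb]_x f x)%E.
Proof.
move=> mf f0.
transitivity (\int[pushforward leb (shift_rV e)]_x f x)%E.
  by rewrite [RHS](ge0_integral_pushforward (measurable_shift e)).
by apply: eq_measure_integral => A mA _; exact: (lebesgue_rV_shift e mA).
Qed.

Lemma integral_shift e (f : 'rV[R]_n.+1 -> \bar R) :
  measurable_fun setT f -> (\int[leb]_x f (x + e)%R = \int[leb]_x f x)%E.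
Proof.
move=> mf; rewrite integralE [RHS]integralE.
congr (_ - _)%E.
  rewrite -[RHS](ge0_integral_shift e (measurable_funepos mf))//.
  by apply: eq_integral => x _; rewrite !funeposE.
rewrite -[RHS](ge0_integral_shift e (measurable_funeneg mf))//.
by apply: eq_integral => x _; rewrite !funenegE.
Qed.

(** The linear map [s |-> s *: e], named so that it can carry its linear
    structure. *)
Definition ray e (s : R) : 'rV[R]_n.+1 := s *: e.

Let ray_linear e : linear (ray e).
Proof. by move=> c x y; rewrite /ray scalerDl scalerA. Qed.

HB.instance Definition _ e := GRing.isLinear.Build R R 'rV[R]_n.+1 *:%R
  (ray e) (ray_linear e).

Lemma continuous_ray e : continuous (ray e).
Proof. by move=> s; apply: cvgZr_tmp; exact: cvg_id. Qed.

Lemma measurable_ray e :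
  measurable_fun setT (fun z : 'rV[R]_n.+1 * R => z.1 + ray e z.2).
Proof.
apply: measurable_fun_rVP => i; rewrite /ray.
under eq_fun do rewrite !mxE.
apply: measurable_funD.
  exact: (measurableT_comp (measurable_coord i) measurable_fst).
by apply: measurable_funM => //; exact: measurable_snd.
Qed.

Lemma lebesgue_R_itv (a b : R) : a <= b -> lebesgue_R `[a, b]%classic = (b - a)%:E.
Proof.
move=> ab; rewrite /lebesgue_R lebesgue_measure_itv/= lte_fin.
by case: ltgtP ab => // ->; rewrite subrr.
Qed.

Lemma FTC_ray e x h (L : R) : 0 < L -> smooth h ->
  (\int[@lebesgue_R R]_(s in `[0%R, L]) ('D_e h (x + ray e s)%R)%:E =
   (h (x + ray e L) - h x)%:E)%E.
Proof.
move=> L0 sh.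
pose g (s : R) := h (ray e s + x).
have sg : smooth g by apply: smooth_comp_affine => //; exact: continuous_ray.
have dg s : 'D_1 g s = 'D_e h (x + ray e s).
  have e1 : ray e 1 = e by rewrite /ray scale1r.
  by rewrite /g derive_comp_affine /= e1 addrC.
under eq_integral do rewrite -dg.
rewrite smooth_FTC//; have -> : g 0 = h x by rewrite /g /ray scale0r add0r.
by rewrite /g (addrC (ray e L)).
Qed.

Let on_ray e (L : R) (f : 'rV[R]_n.+1 -> \bar R) (z : 'rV[R]_n.+1 * R) : \bar R :=
  ((fun s => f (z.1 + ray e s)) \_ `[0%R, L]) z.2.

Let measurable_on_ray e L f : measurable_fun setT f ->
  measurable_fun setT (on_ray e L f).
Proof.
move=> mf; rewrite (_ : on_ray e L f =
    (fun z => f (z.1 + ray e z.2)) \_ (setT `*` `[0%R, L])).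
  have mC : measurable ([set: 'rV[R]_n.+1] `*` `[0%R, L]%classic).
    by apply: measurableX => //; exact: (@measurable_itv R).
  apply: (measurable_restrictT _ mC).1.
  apply: measurable_funTS; apply: measurableT_comp => //; exact: measurable_ray.
apply/funext => -[x s]; rewrite /on_ray !patchE /=.
by congr (if _ then _ else _); apply/idP/idP; rewrite !inE/=; tauto.
Qed.

Let integral_on_ray e L f : measurable_fun setT f -> 0 <= L ->
  (forall x, (0 <= f x)%E) ->
  (\int[@lebesgue_R R]_s \int[leb]_x on_ray e L f (x, s) = L%:E * \int[leb]_x f x)%E.
Proof.
move=> mf L0 f0.
transitivity (\int[@lebesgue_R R]_(s in `[0%R, L]) (\int[leb]_x f x))%E.
  rewrite [RHS]integral_mkcond; apply: eq_integral => s _.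
  rewrite /on_ray patchE; case: ifPn => sL.
    rewrite -(ge0_integral_shift (ray e s) mf)//.
    by apply: eq_integral => x _; rewrite patchE sL.
  by rewrite integral0_eq// => x _; rewrite patchE (negbTE sL).
rewrite integral_cst// [LHS]muleC; congr (_ * _)%E.
by apply: etrans (lebesgue_R_itv L0) _; rewrite subr0.
Qed.

(** Each translate has the same integral; integrate over [s] and exchange the
    order of integration. *)
Lemma ge0_integral_ray e L f : measurable_fun setT f -> 0 <= L ->
  (forall x, (0 <= f x)%E) ->
  (\int[leb]_x \int[@lebesgue_R R]_(s in `[0%R, L]) f (x + ray e s)%R
    = L%:E * \int[leb]_x f x)%E.
Proof.
move=> mf L0 f0; rewrite -(integral_on_ray e)// -fubini_tonelli.
- by apply: eq_integral => x _; rewrite integral_mkcond.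
- exact: measurable_on_ray.
- by move=> z; rewrite /on_ray patchE; case: ifP.
Qed.

Lemma measurable_integral_ray e L f : measurable_fun setT f ->
  (forall x, (0 <= f x)%E) ->
  measurable_fun setT
    (fun x => \int[@lebesgue_R R]_(s in `[0%R, L]) f (x + ray e s)%R)%E.
Proof.
move=> mf f0; rewrite (_ : (fun x => _) =
    fubini_F (@lebesgue_R R) (on_ray e L f)); last first.
  by apply/funext => x; rewrite integral_mkcond.
apply: measurable_fun_fubini_tonelli_F; first exact: measurable_on_ray.
by move=> z; rewrite /on_ray patchE; case: ifP.
Qed.

Lemma compact_lebesgue_lty (K : set 'rV[R]_n.+1) : compact K -> (leb K < +oo)%E.
Proof.
move=> cK; apply: bounded_lebesgue_lty; last exact: compact_bounded.
exact: (compact_measurable_crd (coordinates_rV R n)).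
Qed.

Lemma L1_loc_continuous (D : set 'rV[R]_n.+1) h : continuous h -> L1_loc leb D h.
Proof.
move=> ch; split; first exact: (continuous_measurable_crd (coordinates_rV R n)).
move=> K cK _; apply: measurable_bounded_integrable.
- exact: (compact_measurable_crd (coordinates_rV R n)).
- exact: compact_lebesgue_lty.
- exact: (continuous_measurable_crd (coordinates_rV R n)).
- have /compact_bounded : compact (h @` K).
    by apply: continuous_compact => //; exact: continuous_subspaceT.
  move=> [M [Mr HM]]; exists M; split => // x Mx y Ky; apply: (HM x Mx).
  by exists y.
Qed.

Lemma test_function_integrable (D : set 'rV[R]_n.+1) h : test_function D h ->
  leb.-integrable setT (EFin \o h).
Proof.
move=> [sh ch _].
have th : test_function setT h by split.
have L1 : L1_loc leb setT (cst 1 : 'rV[R]_n.+1 -> R).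
  by apply: L1_loc_continuous; exact: cst_continuous.
have := L1_loc_mul_integrable (coordinates_rV R n) openT L1 th.
by apply: eq_integrable => // x _; rewrite /= mul1r.
Qed.

(** The integral of [h (x + e) - h x] vanishes by translation invariance; it is
    also the integral over [s] in [0, 1] of those of ['D_e h] translated by
    [s e], which are all equal to the integral of ['D_e h]. *)
Lemma integral_derive0 e h (K : set 'rV[R]_n.+1) : test_function K h ->
  (\int[leb]_x ('D_e h x)%:E = 0)%E.
Proof.
move=> th; have sh := test_function_smooth th.
have ih := test_function_integrable th.
have idh := test_function_integrable (test_function_derive e th).
have mdh := measurable_int _ idh.
pose f := EFin \o 'D_e h.
have if_ : (leb \x @lebesgue_R R)%E.-integrable setT (on_ray e 1 f).
  apply/integrable21ltyP; first exact: measurable_on_ray.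
  rewrite (_ : (\int[_]_y _)%E = (\int[leb]_x `|f x|)%E); last first.
    rewrite -[RHS]mul1e -(integral_on_ray e _ _ (fun x => abse_ge0 (f x)))//.
    - apply: eq_integral => s _; apply: eq_integral => x _.
      by rewrite /on_ray !patchE; case: ifP => // _; rewrite abse0.
    - exact: measurableT_comp mdh.
  by have /integrableP[] := idh.
transitivity (\int[@lebesgue_R R]_s \int[leb]_x on_ray e 1 f (x, s))%E.
  transitivity (\int[@lebesgue_R R]_(s in `[0%R, 1%R]) (\int[leb]_x f x))%E.
    rewrite integral_cst//; apply/esym; rewrite -[RHS]mule1; congr (_ * _)%E.
    by apply: etrans (lebesgue_R_itv ler01) _; rewrite subr0.
  rewrite integral_mkcond; apply: eq_integral => s _.
  rewrite /on_ray patchE; case: ifPn => sL.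
    rewrite -(integral_shift (ray e s) mdh)//.
    by apply: eq_integral => x _; rewrite patchE sL.
  by rewrite integral0_eq// => x _; rewrite patchE (negbTE sL).
have -> := integral21_prod_meas1 if_; rewrite -(integral12_prod_meas1 if_).
transitivity (\int[leb]_x ((h (x + e)%R)%:E - (h x)%:E))%E.
  apply: eq_integral => x _.
  rewrite /fubini_F /on_ray/= -integral_mkcond FTC_ray// EFinB.
  by rewrite /ray scale1r.
rewrite integralB//=.
- rewrite (integral_shift e (measurable_int _ ih)) subee//.
  exact: integrable_fin_num.
- apply/integrableP; split.
    by apply: measurableT_comp (measurable_int _ ih) (measurable_shift e).
  rewrite (ge0_integral_shift e (f := abse \o (EFin \o h)))//.
    by have /integrableP[] := ih.
  exact: measurableT_comp (measurable_int _ ih).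
  by move=> x; exact: abse_ge0.
Qed.

End rays.

(** * Test functions in Lebesgue spaces and the inequality of Poincare *)

Section power_mean.
Context (R : realType) (d : measure_display) (T : measurableType d).
Variable mu : {measure set T -> \bar R}.

Lemma Lnorm_restrict (q : R) (D : set T) (f : T -> R) : q != 0 ->
  ('N[mu]_(q%:E)[EFin \o (f \_ D)] =
   (\int[mu]_(x in D) (`|f x| `^ q)%:E) `^ q^-1)%E.
Proof.
move=> q0; rewrite Lnorm.unlock [in RHS]integral_mkcond; congr (_ `^ _)%E.
apply: eq_integral => x _; rewrite /= !patchE; case: ifPn => // _.
by rewrite normr0 powR0.
Qed.

Lemma le_poweR (x y : \bar R) (r : R) : 0 <= r -> (0 <= x)%E -> (x <= y)%E ->
  (x `^ r <= y `^ r)%E.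
Proof.
move=> r0 x0 xy; apply: gt0_ler_poweR => //; rewrite in_itv/= leey andbT//.
exact: le_trans xy.
Qed.

(** Power mean inequality on a set of finite measure: Hoelder's inequality
    against the constant 1. *)
Lemma poweR_integral_le (D : set T) (L p : R) (g : T -> R) :
  measurable D -> mu D = L%:E -> 1 < p -> measurable_fun D g ->
  ((\int[mu]_(x in D) `|g x|%:E) `^ p <=
    (L `^ (p - 1))%:E * \int[mu]_(x in D) (`|g x| `^ p)%:E)%E.
Proof.
move=> mD DL p1 mg.
have p0 : 0 < p by rewrite (lt_trans ltr01).
have q0 : 0 < p / (p - 1) by rewrite divr_gt0// subr_gt0.
have L0 : 0 <= L by rewrite -lee_fin -DL.
have pq : p^-1 + (p / (p - 1))^-1 = 1.
  by field; rewrite subr_eq0 !gt_eqF.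
have mgD := (measurable_restrictT g mD).1 mg.
have m1 : measurable_fun setT (\1_D : T -> R) by exact: measurable_indic.
have := hoelder mu mgD m1 p0 q0 pq.
rewrite Lnorm_restrict ?gt_eqF// Lnorm1.
rewrite (_ : (\int[mu]_x _)%E = (\int[mu]_(x in D) `|g x|%:E)%E); last first.
  rewrite [RHS]integral_mkcond; apply: eq_integral => x _.
  rewrite /= !patchE indicE; case: ifPn => _; first by rewrite mulr1.
  by rewrite mul0r normr0.
rewrite (_ : 'N[mu]_ _[EFin \o \1_D] = (L `^ ((p - 1) / p))%:E)%E; last first.
  rewrite (_ : \1_D = (cst 1 : T -> R) \_ D); last first.
    by apply/funext => x; rewrite indicE patchE; case: ifP.
  rewrite Lnorm_restrict ?gt_eqF//.
  under eq_integral do rewrite normr1 powR1.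
  by rewrite integral_cst// mul1e DL invf_div.
move=> h; have I0 : (0 <= \int[mu]_(x in D) `|g x|%:E)%E by apply: integral_ge0.
have J0 : (0 <= \int[mu]_(x in D) (`|g x| `^ p)%:E)%E.
  by apply: integral_ge0 => x _; rewrite lee_fin powR_ge0.
have := le_poweR (ltW p0) I0 h.
move/le_trans; apply; rewrite poweRM ?poweR_ge0 ?lee_fin ?powR_ge0//.
rewrite -poweRrM mulVf ?gt_eqF// poweRe1// muleC poweR_EFin -powRrM.
by rewrite divfK ?gt_eqF.
Qed.
End power_mean.

Section test_function_lebesgue.
Context (R : realType) (n : nat).
Local Notation leb := (lebesgue_rV R n.+1).
Local Notation l := (coordinates_rV R n).
Variable Om : set 'rV[R]_n.+1.
Hypothesis openOm : open Om.

Lemma test_functionMl (T : normedModType R) (D : set T) (g phi : T -> R) :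
  smooth g -> test_function D phi -> test_function D (g \* phi).
Proof.
move=> sg tp; apply: test_function_pred (tp) _.
  by apply: smoothM => //; case: tp.
by move=> x /= ->; rewrite mulr0.
Qed.

Lemma integral_test_function (phi : 'rV[R]_n.+1 -> R) :
  (forall x, ~ Om x -> phi x = 0) ->
  (\int[leb]_(x in Om) (phi x)%:E = \int[leb]_x (phi x)%:E)%E.
Proof.
move=> h; rewrite integral_mkcond; apply: eq_integral => x _; rewrite patchE.
by case: ifPn => //; rewrite notin_setE => /h ->.
Qed.

(** The derivative of [phi * psi] integrates to zero; expand it by the product
    rule. *)
Lemma test_function_weak_derivative e phi : test_function Om phi ->
  weak_derivative leb Om e phi ('D_e phi).
Proof.
move=> tp; have sp := test_function_smooth tp.
split.
- exact/L1_loc_continuous/smooth_continuous.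
- exact/L1_loc_continuous/smooth_continuous/smooth_derive.
move=> psi tpsi; have spsi := test_function_smooth tpsi.
have t1 := test_functionMl sp (test_function_derive e tpsi).
have t2 := test_functionMl (smooth_derive e sp) tpsi.
have o1 x : ~ Om x -> phi x * 'D_e psi x = 0 by exact: (test_function_outside t1).
have o2 x : ~ Om x -> 'D_e phi x * psi x = 0 by exact: (test_function_outside t2).
rewrite !integral_test_function//.
have i1 := test_function_integrable t1; have i2 := test_function_integrable t2.
have := integral_derive0 e (test_functionMl sp tpsi).
under eq_integral => x _.
  rewrite deriveM; try exact: smooth_derivable.
  rewrite [psi x *: _]mulrC EFinD; over.
rewrite integralD//= => e0.
pose X := (\int[leb]_x (phi x * 'D_e psi x)%:E)%E.
pose Y := (\int[leb]_x ('D_e phi x * psi x)%:E)%E.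
have Yfin : Y \is a fin_num by exact: integrable_fin_num i2.
have {}e0 : (X + Y = 0)%E := e0.
by rewrite -[LHS]/X -[X](addeK _ Yfin) e0 add0e.
Qed.

(** [Om] lies in a box of width [L], so the ray of length [L] that starts at [x]
    in direction [j] ends outside of [Om], where [phi] vanishes. Hence [phi x]
    is minus the integral of the derivative along the ray. The power mean
    inequality on the ray, integrated over [x], gives the constant [L] because
    all translates of the derivative have the same norm. *)
Lemma bounded_poincare : bounded_set Om ->
  exists2 C : R, 0 <= C & forall j (p : R) phi, 1 < p -> test_function Om phi ->
  (Lp_norm leb Om p phi <= C%:E * Lp_norm leb Om p ('D_(dx R j) phi))%E.
Proof.
move=> /bounded_sub_obox[M M0 OmM]; pose L := 2 * M.
have L0 : 0 < L by rewrite mulr_gt0.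
exists L; first exact: ltW.
move=> j p phi p1 tp; set e := dx R j.
have p0 : 0 < p by rewrite (lt_trans ltr01).
have sp := test_function_smooth tp.
have tdp := test_function_derive e tp.
have mphi : measurable_fun setT phi.
  exact: (continuous_measurable_crd l (smooth_continuous sp)).
have cdphi : continuous ('D_e phi) by exact/smooth_continuous/smooth_derive.
have mdphi : measurable_fun setT ('D_e phi) by exact: (continuous_measurable_crd l).
pose F x := (`|'D_e phi x| `^ p)%:E.
have mF : measurable_fun setT F.
  apply/measurable_EFinP; apply: (measurableT_comp (measurable_powR p)).
  exact: measurableT_comp.
have F0 x : (0 <= F x)%E by rewrite lee_fin powR_ge0.
have mline x : measurable_fun setT (fun s : R => 'D_e phi (x + ray e s)).
  apply: (continuous_measurable_crd (coordinates_R R)) => s.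
  apply: (@continuous_comp _ _ _ (fun s => x + ray e s) ('D_e phi)).
    by apply: cvgD; [exact: cvg_cst|exact: continuous_ray].
  exact: cdphi.
have leave x : Om x -> phi (x + ray e L) = 0.
  move=> Omx; apply: (test_function_outside tp) => /OmM/(_ j).
  have /andP[h1 h2] := OmM _ Omx j.
  rewrite /= /crd_rV /ray !mxE !eqxx mulr1 => /andP[_]; rewrite /L.
  rewrite /= /crd_rV in h1 h2; lra.
have bound x : (`|phi x|%:E <=
    \int[@lebesgue_R R]_(s in `[0%R, L]) `|'D_e phi (x + ray e s)%R|%:E)%E.
  have [Omx|Omx] := pselect (Om x); last first.
    by rewrite (test_function_outside tp Omx) normr0 integral_ge0.
  have := FTC_ray e x L0 sp; rewrite leave// sub0r => h.
  rewrite -normrN -abse_EFin -h; apply: le_abse_integral => //.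
  apply: measurable_funTS; apply/measurable_EFinP; exact: mline.
have powphi0 x : ~ Om x -> `|phi x| `^ p = 0.
  by move=> /(test_function_outside tp) ->; rewrite normr0 powR0// gt_eqF.
have powdphi0 x : ~ Om x -> `|'D_e phi x| `^ p = 0.
  by move=> /(test_function_outside tdp) ->; rewrite normr0 powR0// gt_eqF.
rewrite /Lp_norm !Lnorm_restrict ?gt_eqF// !integral_test_function//.
have mLp : (0 <= L `^ (p - 1))%R by exact: powR_ge0.
have powLL : L `^ (p - 1) * L = L `^ p.
  have := @powRD _ L (p - 1) 1; rewrite powRr1 ?ltW// => <-; rewrite subrK//.
  by rewrite (gt_eqF L0) implybT.
have key : (\int[leb]_x (`|phi x| `^ p)%:E <= (L `^ p)%:E * \int[leb]_x F x)%E.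
  apply: (@le_trans _ _ (\int[leb]_x ((L `^ (p - 1))%:E *
      \int[@lebesgue_R R]_(s in `[0%R, L]) F (x + ray e s)%R))%E).
    apply: ge0_le_integral => //.
    - apply/measurable_EFinP; apply: (measurableT_comp (measurable_powR p)).
      exact: measurableT_comp.
    - by apply: measurable_funeM; exact: measurable_integral_ray.
    move=> x _; rewrite -poweR_EFin.
    apply: (@le_trans _ _ ((\int[@lebesgue_R R]_(s in `[0%R, L])
        `|'D_e phi (x + ray e s)%R|%:E) `^ p)%E).
      by apply: le_poweR; rewrite ?lee_fin// ltW.
    apply: poweR_integral_le => //; last exact: measurable_funTS.
    by apply: etrans (lebesgue_R_itv (ltW L0)) _; rewrite subr0.
  rewrite ge0_integralZl//; last 2 first.
  - exact: measurable_integral_ray.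
  - by move=> x _; rewrite integral_ge0.
  rewrite ge0_integral_ray ?(ltW L0)// muleA -EFinM.
  by rewrite powLL.
have IF0 : (0 <= \int[leb]_x F x)%E by apply: integral_ge0.
apply: (@le_trans _ _ (((L `^ p)%:E * \int[leb]_x F x) `^ p^-1)%E).
  apply: le_poweR; [by rewrite invr_ge0 ltW| |exact: key].
  by apply: integral_ge0 => x _; rewrite lee_fin powR_ge0.
rewrite poweRM ?lee_fin ?powR_ge0// poweR_EFin -powRrM mulfV ?gt_eqF//.
by rewrite powRr1// ltW.
Qed.

End test_function_lebesgue.

(** * Integrals and null sets, Caratheodory functions *)

Section integral_null_sets.
Context (R : realType) (d : measure_display) (T : measurableType d).
Variable mu : {measure set T -> \bar R}.
Local Open Scope ereal_scope.
Import HBNNSimple.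

(** The integral of a nonnegative function is a supremum over simple functions
    below it; cutting a simple function off on a null set changes nothing, so
    no measurability is needed to compare. *)
Lemma ge0_integral_ae_le (f g : T -> \bar R) :
  (forall x, 0 <= f x) -> (forall x, 0 <= g x) ->
  {ae mu, forall x, f x <= g x} -> \int[mu]_x f x <= \int[mu]_x g x.
Proof.
move=> f0 g0 [N [mN N0 fgN]]; rewrite !ge0_integralTE//.
apply: ub_ereal_sup => _ [h hf <-].
pose h' := mul_nnsfun h (indic_nnsfun R (measurableC mN)).
apply: ereal_sup_ubound; exists h'.
  move=> x /=; rewrite /mindic indicE; have [Nx|Nx] := pselect (N x).
    by rewrite memNset ?mulr0//=; apply.
  rewrite mem_set//= mulr1 (le_trans (hf x))//.
  by apply: contrapT => fg; apply: Nx; exact: fgN.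
rewrite -!integralT_nnsfun; apply: ae_eq_integral => //.
- exact/measurable_EFinP.
- exact/measurable_EFinP.
exists N; split => // x /= h1; apply: contrapT => Nx; apply: h1 => _.
by rewrite /= /mindic indicE mem_set//= mulr1.
Qed.

Lemma integral_ae_eq_nonmeasurable (D : set T) (f g : T -> \bar R) :
  ae_eq mu D f g -> \int[mu]_(x in D) f x = \int[mu]_(x in D) g x.
Proof.
move=> fg; rewrite integral_mkcond [RHS]integral_mkcond.
have {}fg : {ae mu, forall x, (f \_ D) x = (g \_ D) x}.
  by apply: filterS fg => x; rewrite !patchE; case: ifP => // /set_mem Dx; exact.
rewrite integralE [RHS]integralE; congr (_ - _);
  apply/eqP; rewrite eq_le; apply/andP; split; apply: ge0_integral_ae_le => //;
  by apply: filterS fg => x e; rewrite ?funeposE ?funenegE e.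
Qed.

End integral_null_sets.

Section caratheodory.
Context (R : realType) (d : measure_display) (T : measurableType d).
Variables (mu : {measure set T -> \bar R}) (D : set T).
Hypothesis mD : measurable D.

Lemma measurable_fun_countable_glue (I : countType) (idx : T -> I)
    (g : I -> T -> R) :
  (forall i, measurable (D `&` [set z | idx z = i])) ->
  (forall i, measurable_fun D (g i)) -> measurable_fun D (fun z => g (idx z) z).
Proof.
move=> midx mg _ Y mY.
rewrite (_ : _ `&` _ = \bigcup_i
    ((D `&` [set z | idx z = i]) `&` (D `&` g i @^-1` Y))).
  by apply: countable_bigcupT_measurable => // i; apply: measurableI => //; exact: mg.
apply/seteqP; split => [z [Dz Yz]|z [i _ [[Dz <-] [_ ?]]]]; last by split.
by exists (idx z).
Qed.

(** Replacing [u z] by [floor (k u z) / k] leaves countably many values of the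
    second argument, hence countably many exceptional null sets; the Lipschitz
    bound makes the error tend to 0. *)
Lemma caratheodory_ae_measurable (a : T -> R -> R) (u : T -> R) (c : R) :
  (forall s, exists2 g, measurable_fun D g & ae_eq mu D (a^~ s) g) ->
  (forall z s1 s2, D z -> `|a z s1 - a z s2| <= c * `|s1 - s2|) ->
  measurable_fun D u ->
  exists2 g, measurable_fun D g & ae_eq mu D (fun z => a z (u z)) g.
Proof.
move=> am alip mu_.
have [g gP] : {g : R -> T -> R & forall s, measurable_fun D (g s) /\
    ae_eq mu D (a^~ s) (g s)}.
  apply: (@choice _ _ (fun s gs => measurable_fun D gs /\ ae_eq mu D (a^~ s) gs)).
  by move=> s; have [gs ? ?] := am s; exists gs.
pose node (k : nat) (m : int) : R := m%:~R / k.+1%:R.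
have [N [mN N0 HN]] : {ae mu, forall z, forall km : nat * int, D z ->
    a z (node km.1 km.2) = g (node km.1 km.2) z}.
  apply: ae_forall_countType => -[k m] /=; have [_ h] := gP (node k m).
  exact: h.
have good z (km : nat * int) : ~ N z -> D z ->
    a z (node km.1 km.2) = g (node km.1 km.2) z.
  move=> Nz Dz; have : ~ ~ (forall km : nat * int, D z ->
    a z (node km.1 km.2) = g (node km.1 km.2) z) by move=> h; apply: Nz; exact: HN.
  by move=> /contrapT; apply.
pose idx k z : int := Num.floor (u z * k.+1%:R).
pose G k z := g (node k (idx k z)) z.
have mG k : measurable_fun D (G k).
  apply: (@measurable_fun_countable_glue _ (idx k) (fun m => g (node k m))).
    move=> m; rewrite (_ : _ `&` _ = D `&` u @^-1` `[node k m, node k (m + 1)[%classic).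
      by apply: mu_ => //; exact: (@measurable_itv R).
    apply/seteqP; split => z [Dz] /=; rewrite in_itv/=.
      move=> <-; split => //; have := floor_itv (u z * k.+1%:R).
      by rewrite /node ler_pdivrMr// ltr_pdivlMr.
    rewrite /node ler_pdivrMr// ltr_pdivlMr// => h; split => //.
    exact: floor_def.
  by move=> m; have [] := gP (node k m).
exists ((fun z => a z (u z)) \_ (~` N)); last first.
  exists N; split => // z /= h; apply: contrapT => Nz; apply: h => _.
  by rewrite patchE mem_set.
apply: (@measurable_fun_cvg _ _ _ _ (fun k => G k \_ (~` N))).
  move=> k; apply: (measurable_restrict _ (measurableC mN) mD).1.
  by apply: measurable_funS (mG k) => // z [].
move=> z Dz; have [Nz|Nz] := pselect (N z).
  have nNz : ~ (~` N) z by move=> /(_ Nz).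
  rewrite patchE memNset//; apply: cvg_near_cst; apply: nearW => k.
  by rewrite patchE memNset.
rewrite patchE mem_set//.
rewrite (_ : (fun k => _) = (fun k => a z (node k (idx k z)))); last first.
  by apply/funext => k; rewrite patchE mem_set// /G -(good z (k, idx k z)).
apply/cvgrPdist_le => e e0.
have : (`|c| * k.+1%:R^-1 @[k --> \oo] --> `|c| * 0).
  by apply: cvgMl_tmp; exact: cvg_harmonic.
rewrite mulr0 => /cvgrPdist_le/(_ _ e0); apply: filterS => k.
rewrite sub0r normrN ger0_norm ?mulr_ge0// => /(le_trans _); apply.
apply: le_trans (alip _ _ _ Dz) _.
apply: (@le_trans _ _ (`|c| * `|u z - node k (idx k z)|)).
  by rewrite ler_wpM2r// ler_norm.
rewrite ler_wpM2l//.
have := floor_itv (u z * k.+1%:R); rewrite -/(idx k z) => /andP[h1 h2].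
rewrite ger0_norm; last by rewrite subr_ge0 /node ler_pdivrMr.
rewrite lerBlDr -[X in X + _]mul1r /node -mulrDl ler_pdivlMr//.
by rewrite ltW// addrC; move: h2; rewrite intrD.
Qed.

End caratheodory.

(** * The lemma of du Bois-Reymond *)

Lemma integrable_tensor d1 d2 (T1 : measurableType d1) (T2 : measurableType d2)
    (R : realType) (m1 : {sigma_finite_measure set T1 -> \bar R})
    (m2 : {sigma_finite_measure set T2 -> \bar R}) (f : T1 -> R) (g : T2 -> R) :
  m1.-integrable setT (EFin \o f) -> m2.-integrable setT (EFin \o g) ->
  (m1 \x m2)%E.-integrable setT (fun z => (f z.1 * g z.2)%:E).
Proof.
move=> /integrableP[mf If] /integrableP[mg Ig].
have {}mf : measurable_fun setT f by exact/measurable_EFinP.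
have {}mg : measurable_fun setT g by exact/measurable_EFinP.
apply/integrable12ltyP.
  apply/measurable_EFinP; apply: measurable_funM.
    exact: (measurableT_comp mf measurable_fst).
  exact: (measurableT_comp mg measurable_snd).
pose J := (\int[m2]_y `|(g y)%:E|)%E.
have J0 : (0 <= J)%E by exact: integral_ge0.
have Jfin : J \is a fin_num by rewrite ge0_fin_numE.
rewrite (_ : (\int[m1]_x _)%E = (\int[m1]_x (J * `|(f x)%:E|))%E); last first.
  apply: eq_integral => x _; rewrite muleC /J -ge0_integralZl//.
    by apply: eq_integral => y _; rewrite EFinM abseM.
  by apply/measurable_EFinP; exact: measurableT_comp.
rewrite ge0_integralZl//; last first.
  by apply/measurable_EFinP; exact: measurableT_comp.
by rewrite lte_mul_pinfty.
Qed.

Section integration_by_parts_in_time.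
Context (R : realType) (T0 : R).
Hypothesis T0_gt0 : 0 < T0.
Local Notation leb := (@lebesgue_R R).
Let I : set R := `]0, T0[%classic.
Variable G : R -> R.
Hypothesis iG : leb.-integrable I (EFin \o G).

Let mI : measurable I. Proof. exact: (@measurable_itv R). Qed.

Let leI : (leb I < +oo)%E.
Proof. by rewrite /lebesgue_R lebesgue_measure_itv/=; case: ifP; rewrite ltry. Qed.

Definition primitive (t : R) : R := \int[leb]_(s in `]0, t]) G s.

Lemma primitive_increment t1 t2 : I t1 -> I t2 -> t1 <= t2 ->
  primitive t2 = primitive t1 + \int[leb]_(s in `]t1, t2]) G s.
Proof.
rewrite /I/= !in_itv/= => /andP[t10 t1T] /andP[t20 t2T] t12.
have e : `]0, t2]%classic = `]0, t1]%classic `|` `]t1, t2]%classic.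
  apply/seteqP; split => s /=; rewrite !in_itv/=.
    by move=> /andP[-> ->]; rewrite !andbT; case: leP => _; [left|right].
  move=> [/andP[-> st]|/andP[ts ->]]; first exact: le_trans t12.
  by rewrite (lt_trans t10).
rewrite /primitive e Rintegral_setU//.
- rewrite -e; apply: integrableS iG => // s /=; rewrite /I /= !in_itv/=.
  by move=> /andP[-> st]; exact: le_lt_trans t2T.
- apply/disj_set2P/seteqP; split => s //= []; rewrite !in_itv/=.
  by move=> /andP[_ st] /andP[ts _]; have := lt_le_trans ts st; rewrite ltxx.
Qed.

Let below : set (R * R) := [set z | z.2 <= z.1].

Let mbelow : measurable below.
Proof.
rewrite (_ : below = setT `&` (fun z : R * R => z.2 <= z.1) @^-1` [set true]).
  exact: measurable_fun_ler.
by rewrite setTI; apply/seteqP; split.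
Qed.

(* [z.1] is the time and [z.2 <= z.1] the integration variable. *)
Let ker (z : R * R) : R := \1_I z.1 * (G \_ I) z.2 * \1_below z.

Let iGI : leb.-integrable setT (EFin \o (G \_ I)).
Proof. by have := (integrable_mkcond _ mI).1 iG; rewrite restrict_EFin. Qed.

Let mGI : measurable_fun setT (G \_ I).
Proof. by apply/measurable_EFinP; case/integrableP: iGI. Qed.

Let mker : measurable_fun setT ker.
Proof.
apply: measurable_funM; last exact: measurable_indic.
apply: measurable_funM; last exact: (measurableT_comp mGI measurable_snd).
exact: (measurableT_comp (measurable_indic mI) measurable_fst).
Qed.

Let int_ker (h : R -> R) M : measurable_fun setT h -> (forall t, `|h t| <= M) ->
  (leb \x leb)%E.-integrable setT (fun z => (ker z * h z.1)%:E).
Proof.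
move=> mh hM.
have mkh : measurable_fun setT (fun z : R * R => ker z * h z.1).
  by apply: measurable_funM => //; exact: (measurableT_comp mh measurable_fst).
have M0 : 0 <= M by apply: le_trans (hM 0).
have i1 : leb.-integrable setT (EFin \o (fun t => M * \1_I t)).
  rewrite (_ : _ \o _ = (fun t => M%:E * (\1_I t)%:E)%E)//.
  apply: integrableZl => //; apply/integrableP; split.
    by apply/measurable_EFinP; exact: measurable_indic.
  under eq_integral do rewrite gee0_abs ?lee_fin//.
  by rewrite integral_indic// setIT.
apply: le_integrable (integrable_tensor i1 iGI) => //.
  exact/measurable_EFinP.
move=> z _; rewrite /= lee_fin /ker !normrM (ger0_norm M0).
rewrite -!mulrA [leRHS]mulrCA ler_wpM2l// [leRHS]mulrC ler_wpM2l// mulrC.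
have b1 : `|\1_below z : R| <= 1.
  by rewrite indicE; case: (_ \in _); rewrite ?normr1 ?normr0.
by rewrite -[leRHS]mulr1 ler_pM.
Qed.

Let int_ker1 : (leb \x leb)%E.-integrable setT (EFin \o ker).
Proof.
have n1 (t : R) : `|(cst 1 : R -> R) t| <= 1 by rewrite normr1.
have := int_ker (measurable_cst _) n1.
by apply: eq_integrable => // z _; rewrite /= mulr1.
Qed.

Lemma integrable_sub_itv t : I t -> leb.-integrable `]0, t] (EFin \o G).
Proof.
rewrite /I/= in_itv/= => /andP[t0 tT]; apply: integrableS iG => //.
move=> s; rewrite /I /= !in_itv/= => /andP[-> st]; exact: le_lt_trans tT.
Qed.

Let kerE t s : I t -> ker (t, s) = (G \_ `]0, t]) s.
Proof.
move=> It; rewrite /ker/= !indicE mem_set// mul1r !patchE; move: It.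
rewrite /I /= in_itv/= => /andP[t0 tT].
have -> : (s \in `]0, t]%classic) = (s \in I) && ((t, s) \in below).
  rewrite /I /below; apply/idP/andP; rewrite !inE /= !in_itv/=.
    by move=> /andP[s0 st]; split => //; rewrite s0 (le_lt_trans st).
  by move=> [/andP[s0 _] st]; rewrite s0.
by case: (s \in I); case: (_ \in below); rewrite /= ?mulr1 ?mulr0 ?mul0r.
Qed.

Let integrable_ker t : I t -> leb.-integrable setT (fun s => (ker (t, s))%:E).
Proof.
move=> It; have mt : measurable `]0, t]%classic by exact: (@measurable_itv R).
have := (integrable_mkcond _ mt).1 (integrable_sub_itv It).
by apply: eq_integrable => // s _; rewrite restrict_EFin /= kerE.
Qed.

Let ker_primitive t : I t -> (\int[leb]_s (ker (t, s))%:E)%E = (primitive t)%:E.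
Proof.
move=> It; rewrite /primitive fineK; last first.
  by apply: integrable_fin_num (integrable_sub_itv It); exact: (@measurable_itv R).
rewrite [RHS]integral_mkcond; apply: eq_integral => s _.
by rewrite restrict_EFin /= kerE.
Qed.

(** The triangle kernel is integrable on the square, and the primitive is its
    integral over sections. *)
Lemma integrable_primitive : leb.-integrable I (EFin \o primitive).
Proof.
have := integrable_fubini_F int_ker1.
move=> /(integrableS measurableT mI (subsetT I)).
by apply: eq_integrable => // t /set_mem It; rewrite /fubini_F ker_primitive.
Qed.

(** Exchanging the order of integration over the triangle [s <= t]. *)
Lemma integral_primitive_derive (chi : R -> R) : test_function I chi ->
  (\int[leb]_(t in I) (primitive t * 'D_1 chi t)%:E =
   \int[leb]_(s in I) (- (G s * chi s))%:E)%E.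
Proof.
move=> tchi; have sc := test_function_smooth tchi.
have tdchi := test_function_derive (1 : R) tchi.
have [M M0 hM] := test_function_bounded tdchi.
have mdchi : measurable_fun setT ('D_1 chi).
  by apply: (continuous_measurable_crd (coordinates_R R)); exact/smooth_continuous/smooth_derive.
have ik := int_ker mdchi hM.
transitivity (\int[leb]_t fubini_F leb (fun z => (ker z * 'D_1 chi z.1)%:E) t)%E.
  rewrite integral_mkcond; apply: eq_integral => t _; rewrite patchE /fubini_F.
  case: ifPn => [/set_mem It|]; last first.
    rewrite notin_setE => /(test_function_outside tdchi) /= ->.
    by under eq_integral do rewrite mulr0; rewrite integral0.
  by rewrite /= EFinM -ker_primitive// -integralZr//; exact: integrable_ker.
rewrite (integral12_prod_meas1 ik) -(integral21_prod_meas1 ik).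
rewrite [RHS]integral_mkcond; apply: eq_integral => s _.
rewrite patchE /fubini_G; case: ifPn => [/set_mem Is|]; last first.
  rewrite /ker /= patchE => /negbTE ->.
  by under eq_integral do rewrite mulr0 !mul0r; rewrite integral0.
have sT : s < T0 by move: Is; rewrite /I /= in_itv/= => /andP[].
transitivity (\int[leb]_(t in `[s, T0]) ('D_1 (fun t => G s * chi t) t)%:E)%E.
  rewrite [RHS]integral_mkcond; apply: eq_integral => t _.
  have dG : 'D_1 (fun r => G s * chi r) t = G s * 'D_1 chi t.
    by apply: (@deriveZ _ _ _ chi (G s)); exact: smooth_derivable.
  rewrite [RHS]patchE dG /=.
  have [It|It] := pselect (I t); last first.
    rewrite (test_function_outside tdchi It) mulr0.
    by case: ifP => //; rewrite mulr0.
  rewrite /ker /= !indicE patchE (mem_set It) (mem_set Is) mul1r.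
  have -> : (t \in `[s, T0]%classic) = ((t, s) \in below).
    move: It; rewrite /I/= in_itv/= => /andP[_ tT].
    apply/idP/idP; rewrite !inE /below/= in_itv/=; first by move=> /andP[].
    by move=> ->; rewrite ltW.
  by case: (_ \in below); rewrite /= ?mulr1 ?mulr0 ?mul0r.
rewrite smooth_FTC//; last exact: smoothZ.
rewrite (test_function_outside tchi (x := T0)) ?mulr0 ?sub0r//.
by rewrite /I/= in_itv/= ltxx andbF.
Qed.

End integration_by_parts_in_time.

Section compactly_supported_antiderivative.
Context (R : realType).
Local Notation leb := (@lebesgue_R R).

Lemma test_function_itv (a b T0 : R) (chi : R -> R) : smooth chi ->
  0 < a -> b < T0 -> (forall x, chi x != 0 -> a <= x <= b) ->
  test_function `]0, T0[%classic chi.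
Proof.
move=> sc a0 bT h.
have sub : closure [set x | chi x != 0] `<=` `[a, b]%classic.
  rewrite closureE; apply: smallest_sub; first exact: itv_closed.
  by move=> x /= /h; rewrite in_itv.
split => //.
  by apply: subclosed_compact sub; [exact: closed_closure|exact: segment_compact].
move=> x /sub /=; rewrite !in_itv/= => /andP[ax xb].
by rewrite (lt_le_trans a0)// (le_lt_trans xb).
Qed.

Lemma lebesgue_R_itvoo_lty (a b : R) : (leb `]a, b[%classic < +oo)%E.
Proof.
by rewrite /lebesgue_R lebesgue_measure_itv/=; case: ifP; rewrite ltry.
Qed.

Lemma compact_lebesgue_R_lty (K : set R) : compact K -> (leb K < +oo)%E.
Proof.
move=> cK; have mK := compact_measurable_crd (coordinates_R R) cK.
have [M [Mr HM]] := compact_bounded cK.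
apply: (@le_lt_trans _ _ (leb `[- (`|M| + 1), `|M| + 1]%classic)).
  apply: le_measure; rewrite ?inE//.
  move=> x Kx /=; rewrite in_itv/= -ler_norml; apply: HM => //.
  by rewrite (le_lt_trans (ler_norm _))// ltrDl.
by rewrite /lebesgue_R lebesgue_measure_itv/=; case: ifP; rewrite ltry.
Qed.

Lemma L1_loc_integrable d (T : measurableNormedModType R d) k
    (l : coordinates T k) (mu : {measure set T -> \bar R}) (D : set T) f :
  measurable D -> mu.-integrable D (EFin \o f) -> L1_loc mu D f.
Proof.
move=> mD if_; split; first by apply/measurable_EFinP; case/integrableP: if_.
move=> K cK KD; apply: integrableS if_ => //.
exact: (compact_measurable_crd l).
Qed.

Lemma test_function_R_integrable (D : set R) (h : R -> R) : test_function D h ->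
  leb.-integrable setT (EFin \o h).
Proof.
move=> [sh ch _].
have th : test_function setT h by split.
have L1 : L1_loc leb setT (cst 1 : R -> R).
  split => // K cK _; have mK := compact_measurable_crd (coordinates_R R) cK.
  apply/integrableP; split; first exact/measurable_EFinP.
  under eq_integral do rewrite /= normr1.
  by rewrite integral_cst// mul1e; exact: compact_lebesgue_R_lty.
have := L1_loc_mul_integrable (coordinates_R R) openT L1 th.
by apply: eq_integrable => // x _; rewrite /= mul1r.
Qed.

(** The integral of [theta] from [-oo] vanishes to the left of the support, and
    again to its right because the total integral is zero. *)
Lemma compact_support_antiderivative (a b T0 : R) (theta : R -> R) :
  smooth theta -> 0 < a -> b < T0 -> (forall x, theta x != 0 -> a <= x <= b) ->
  (\int[leb]_x (theta x)%:E = 0)%E ->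
  exists2 chi : R -> R, test_function `]0, T0[%classic chi &
    forall x, 'D_1 chi x = theta x.
Proof.
move=> st a0 bT ht it.
have tt := test_function_itv st a0 bT ht.
have ct := smooth_continuous st.
have mt (D : set R) : measurable_fun D (EFin \o theta).
  by apply/measurable_EFinP; exact: (continuous_measurable_crd (coordinates_R R)).
have i_t : (@lebesgue_measure R).-integrable setT (EFin \o theta).
  apply/integrableP; split; first exact: mt.
  have /integrableP[_] := test_function_R_integrable tt.
  rewrite ge0_integral_lebesgue_R//.
  exact: measurableT_comp (mt setT).
pose chi (x : R) : R := \int[@lebesgue_measure R]_(t in `]-oo, x]) theta t.
have dchi (x : R) : is_derive x (1 : R) chi (theta x).
  have [] := @continuous_FTC1 R theta -oo%O x (x + 1) _ _ _ (ct x).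
  - by rewrite ltrDl.
  - by apply: integrableS i_t.
  - exact: ltNyr.
  by move=> d1 d2; apply: DeriveDef; [exact: d1|rewrite -derive1E].
have d1 (x : R) : 'D_1 chi x = theta x by exact: derive_val.
exists chi => //.
apply: (test_function_itv (a := a) (b := b)) => //.
  exact: smooth_antiderivative dchi st.
move=> x; apply: contraNT; rewrite negb_and -!ltNge => xab; apply/eqP.
rewrite /chi.
have [xa|bx] := orP xab.
  rewrite (@eq_Rintegral _ _ _ _ _ (cst 0)) ?Rintegral_cst ?mul0r//.
  move=> y; rewrite inE/= in_itv/= => yx; apply/eqP; apply: contraT => /ht/andP[ay _].
  by have := le_lt_trans (le_trans ay yx) xa; rewrite ltxx.
rewrite Rintegral_mkcond (_ : _ \_ _ = theta); last first.
  apply/funext => y; rewrite patchE; case: ifPn => //.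
  rewrite notin_setE /= in_itv/= => /negP; rewrite -ltNge => xy.
  apply/esym/eqP; apply: contraT => /ht/andP[_ yb].
  by have := lt_le_trans (lt_trans bx xy) yb; rewrite ltxx.
by rewrite /Rintegral -integral_lebesgue_R// it.
Qed.

End compactly_supported_antiderivative.

Section du_bois_reymond.
Context (R : realType) (T0 : R).
Hypothesis T0_gt0 : 0 < T0.
Local Notation leb := (@lebesgue_R R).
Let I : set R := `]0, T0[%classic.
Variables F G : R -> R.
Hypothesis iF : leb.-integrable I (EFin \o F).
Hypothesis iG : leb.-integrable I (EFin \o G).
Hypothesis weak : forall chi, test_function I chi ->
  (\int[leb]_(t in I) (G t * chi t - F t * 'D_1 chi t)%:E = 0)%E.

Let mI : measurable I. Proof. exact: (@measurable_itv R). Qed.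
Let oI : open I. Proof. exact: itv_open. Qed.

Let W (t : R) : R := F t + primitive G t.

Let iW : leb.-integrable I (EFin \o W).
Proof.
rewrite (_ : EFin \o W = ((EFin \o F) \+ (EFin \o primitive G))%E)//.
have := integrableD mI iF (integrable_primitive iG); exact.
Qed.

Let mulI f psi : leb.-integrable I (EFin \o f) -> test_function I psi ->
  leb.-integrable I (fun x => (f x * psi x)%:E).
Proof.
move=> if_ tpsi; apply: (L1_loc_mul_integrable (coordinates_R R)) => //.
exact: (L1_loc_integrable (coordinates_R R)).
Qed.

Let W_derive0 chi : test_function I chi -> \int[leb]_(t in I) (W t * 'D_1 chi t) = 0.
Proof.
move=> tchi; have tdchi := test_function_derive (1 : R) tchi.
have iP : leb.-integrable I (EFin \o primitive G) by exact: (integrable_primitive iG).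
have iFd := mulI iF tdchi; have iPd := mulI iP tdchi.
have iGc := mulI iG tchi.
have e1 : \int[leb]_(t in I) (G t * chi t) = \int[leb]_(t in I) (F t * 'D_1 chi t).
  apply/eqP; rewrite -subr_eq0 -RintegralB//.
  by rewrite /Rintegral weak.
have e2 : \int[leb]_(t in I) (primitive G t * 'D_1 chi t) =
    - \int[leb]_(t in I) (G t * chi t).
  rewrite {1}/Rintegral (integral_primitive_derive iG tchi) -mulN1r -RintegralZl//.
  by congr fine; apply: eq_integral => t _; rewrite mulN1r.
rewrite (@eq_Rintegral _ _ _ _ _ (fun t => F t * 'D_1 chi t +
  primitive G t * 'D_1 chi t)); last by move=> t _; rewrite mulrDl.
by rewrite RintegralD// e2 e1 subrr.
Qed.

(* a fixed bump, used to correct the mean of the others *)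
Let eta : R -> R := cutoff 0 (T0 / 3) (2 * T0 / 3).

Let teta : test_function I eta.
Proof.
apply: (@test_function_itv _ (T0 / 3) (2 * T0 / 3)).
- exact: smooth_cutoff.
- by rewrite divr_gt0.
- have := T0_gt0; lra.
- by move=> x /cutoff_neq0/andP[h1 h2]; rewrite !ltW.
Qed.

Let eta_neq0 : \int[leb]_x eta x != 0.
Proof.
have ieta := test_function_R_integrable teta.
apply/eqP => e0.
have : (\int[leb]_x `|(eta x)%:E| = 0)%E.
  rewrite (eq_integral (EFin \o eta)); last first.
    by move=> x _; rewrite gee0_abs// lee_fin cutoff_ge0.
  by rewrite -(fineK (integrable_fin_num measurableT ieta))// -[fine _]/(Rintegral _ _ _) e0.
move=> /ae_eq_integral_abs => /(_ measurableT); case.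
  by case/integrableP: ieta.
move=> N [mN N0 etaN].
have : (leb (`](T0 / 3)%R, (2 * T0 / 3)%R[%classic) <= leb N)%E.
  apply: le_measure; rewrite ?inE//.
  move=> x /=; rewrite in_itv/= => xT; apply: etaN => /= /(_ Logic.I) [] h.
  by have := cutoff_gt0 0 xT; rewrite -/(eta x) h ltxx.
rewrite N0 /lebesgue_R lebesgue_measure_itv/= lte_fin.
have T3 : T0 / 3 < 2 * T0 / 3.
  have := T0_gt0; lra.
rewrite T3.
by rewrite -EFinB lee_fin; have := T0_gt0; lra.
Qed.

(** The function [W = F + primitive G] has zero weak derivative. A bump minus the
    multiple of [eta] with the same integral has mean zero, so it is the
    derivative of a test function and [W] is orthogonal to it. Therefore [W - C]
    is orthogonal to every bump, where [C] is the mean of [W] weighted by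
    [eta]. *)
Theorem du_bois_reymond :
  exists C, {ae leb, forall t, I t -> F t = C - primitive G t}.
Proof.
pose E := \int[leb]_x eta x.
pose C := \int[leb]_(t in I) (W t * eta t) / E; exists C.
suff : ae_eq leb I (W \- cst C) (cst 0).
  by apply: filterS => t h /h /= /eqP; rewrite subr_eq0 => /eqP <-; rewrite /W addrK.
have iWC : leb.-integrable I (EFin \o (W \- cst C)).
  rewrite (_ : _ \o _ = ((EFin \o W) \- (EFin \o cst C))%E)//.
  apply: integrableB => //; apply: measurable_bounded_integrable => //.
    exact: lebesgue_R_itvoo_lty.
  exists `|C|; split => // x Cx y _ /=; exact: ltW.
apply: (ae_eq0_of_box_bumps (l := coordinates_R R)) => //.
  exact: (L1_loc_integrable (coordinates_R R)).
move=> a b n abI; set psi := box_bump _ _ _ _.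
have tpsi : test_function I psi by exact: test_function_box_bump.
rewrite -(fineK (integrable_fin_num mI (mulI iWC tpsi))).
congr EFin; rewrite -[LHS]/(\int[leb]_(t in I) ((W t - C) * psi t)).
have psiE t : psi t != 0 -> a ord0 < t < b ord0.
  by move=> /box_bump_neq0/(_ ord0).
have [ab|ba] := leP (a ord0) (b ord0); last first.
  rewrite (@eq_Rintegral _ _ _ _ _ (cst 0)) ?Rintegral_cst ?mul0r// => t _.
  rewrite (_ : psi t = 0) ?mulr0//; apply/eqP; apply: contraT => /psiE/andP[h1 h2].
  by have := lt_trans (lt_trans h1 h2) ba; rewrite ltxx.
have aI : I (a ord0) by apply: abI => i; rewrite (ord1 i) /= /crd_R lexx ab.
have bI : I (b ord0) by apply: abI => i; rewrite (ord1 i) /= /crd_R lexx ab.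
move: aI bI; rewrite /I/= !in_itv/= => /andP[a0 _] /andP[_ bT].
pose kap := (\int[leb]_x psi x) / E.
pose theta := psi \- (fun x => kap * eta x).
have itpsi := test_function_R_integrable tpsi.
have iteta := test_function_R_integrable teta.
have [chi tchi dchi] : exists2 chi : R -> R, test_function I chi &
    forall x, 'D_1 chi x = theta x.
  apply: (@compact_support_antiderivative _ (Num.min (a ord0) (T0 / 3))
      (Num.max (b ord0) (2 * T0 / 3))).
  - apply: smoothB; first exact: test_function_smooth tpsi.
    exact/smoothZ/smooth_cutoff.
  - by rewrite lt_min a0 divr_gt0.
  - by rewrite gt_max bT/=; have := T0_gt0; lra.
  - move=> x; have [p0|p0] := eqVneq (psi x) 0.
      rewrite /theta /= p0 sub0r oppr_eq0 mulf_eq0 negb_or.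
      move=> /andP[_ /cutoff_neq0/andP[h1 h2]].
      by rewrite ge_min le_max (ltW h1) (ltW h2) !orbT.
    have /andP[h1 h2] := psiE _ p0.
    by rewrite ge_min le_max (ltW h1) (ltW h2).
  - have i2 : leb.-integrable setT (EFin \o (fun x => kap * eta x)).
      have := integrableZl measurableT kap iteta; exact.
    have i3 : leb.-integrable setT (EFin \o theta).
      have := integrableB measurableT itpsi i2; exact.
    rewrite -(fineK (integrable_fin_num measurableT i3)).
    rewrite -[fine _]/(\int[leb]_x (psi x - kap * eta x)) RintegralB//.
    by rewrite RintegralZl// /kap divfK ?subrr.
have iWpsi := mulI iW tpsi; have iWeta := mulI iW teta.
have ipsi : leb.-integrable I (EFin \o psi) by exact: integrableS itpsi.
have eW : \int[leb]_(t in I) (W t * psi t) = kap * \int[leb]_(t in I) (W t * eta t).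
  have iZ := integrableZl mI kap iWeta.
  apply/eqP; rewrite -subr_eq0 -RintegralZl// -RintegralB//.
  apply/eqP; rewrite -(W_derive0 tchi); apply: eq_Rintegral => t _.
  by rewrite dchi /theta /= mulrBr; congr (_ - _); rewrite mulrCA.
rewrite (@eq_Rintegral _ _ _ _ _ (fun t => W t * psi t - C * psi t)); last first.
  by move=> t _; rewrite mulrBl.
have iZ := integrableZl mI C ipsi.
rewrite RintegralB//.
rewrite eW RintegralZl// (_ : \int[leb]_(t in I) psi t = \int[leb]_x psi x).
  by rewrite /kap /C; field; exact: eta_neq0.
rewrite Rintegral_mkcond; apply: eq_Rintegral => t _; rewrite patchE.
by case: ifPn => //; rewrite notin_setE => /(test_function_outside tpsi) ->.
Qed.

End du_bois_reymond.

(** * Countable dense families of test functions *)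

Section countable_uniformly_dense.
Context (R : realType) (d : measure_display) (T : measurableNormedModType R d).
Context (k : nat) (l : coordinates T k).
Context (S : choiceType) (m : nat) (v : S -> 'I_m -> T -> R) (P : set S) (s0 : S).
Hypothesis Ps0 : P s0.
Hypothesis cv : forall s, P s -> forall j, continuous (v s j).
Variable K : set T.
Hypothesis cK : compact K.

Lemma open_obox (a b : 'I_k -> R) : open (obox l a b).
Proof.
rewrite openE => x h; apply: filter_forall => i; have /andP[h1 h2] := h i.
near=> y; apply/andP; split.
  near: y; apply: (@crd_continuous _ _ _ _ l i x [set z | a i < z]).
  exact: lt_nbhsr.
near: y; apply: (@crd_continuous _ _ _ _ l i x [set z | z < b i]).
exact: lt_nbhsl.
Unshelve. all: by end_near. Qed.

(* a rational box, and rational values for the components of [v] on it *)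
Let entry : Type :=
  ({ffun 'I_k -> rat} * {ffun 'I_k -> rat} * {ffun 'I_m -> rat})%type.
Let box (e : entry) : set T := obox l (fun i => ratr (e.1.1 i)) (fun i => ratr (e.1.2 i)).
Let fits (r : R) (e : entry) (s : S) : Prop :=
  forall x, box e x -> forall j, `|v s j x - ratr (e.2 j)| < r.

Let exists_entry s x (r : R) : P s -> 0 < r -> exists2 e : entry, box e x & fits r e s.
Proof.
move=> Ps r0.
have hq j : exists q : rat, `|v s j x - ratr q| < r.
  have /rat_in_itvoo[q] : v s j x - r < v s j x by rewrite ltrBlDr ltrDl.
  rewrite in_itv/= => /andP[h1 h2]; exists q.
  by rewrite gtr0_norm ?subr_gt0// ltrBlDl -ltrBlDr.
pose q : {ffun 'I_m -> rat} := [ffun j => projT1 (cid (hq j))].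
have qP j : `|v s j x - ratr (q j)| < r by rewrite ffunE; case: cid.
pose A := [set y | forall j, `|v s j y - ratr (q j)| < r].
have nA : nbhs x A.
  apply: filter_forall => j.
  have : (fun y => `|v s j y - ratr (q j)|) @ x --> `|v s j x - ratr (q j)|.
    by apply: cvg_norm; apply: cvgB; [exact: (cv Ps)|exact: cvg_cst].
  by move=> /cvgr_lt; apply.
have oA : open A^° by exact: open_interior.
have xA : A^° x by exact: nA.
have [ab [abx abA]] := open_rational_box l oA xA.
exists (ab, q) => // y ydab.
have : A^° y by apply: abA; exact: obox_cbox.
exact: (@interior_subset _ A).
Qed.

(** Step functions with rational data on finitely many rational boxes form a
    countable set; one member of [P] is selected close to each of them. *)
Lemma countable_uniformly_dense : exists (I : countType) (D : I -> S),
  (forall i, P (D i)) /\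
  forall s (eps : R), P s -> 0 < eps ->
    exists i, forall x, K x -> forall j, `|v s j x - v (D i) j x| < eps.
Proof.
pose data : countType := (seq entry * nat)%type.
pose Q (i : data) : set S := [set s | P s /\
  forall e, e \in i.1 -> fits (i.2.+1%:R^-1) e s].
exists data, (fun i => xget s0 (Q i)); split.
  by move=> i; case: xgetP => // s -> [].
move=> s eps Ps eps0.
have [N hN] : exists N : nat, N.+1%:R^-1 < eps / 2.
  exists (Num.truncn (2 / eps)); rewrite -[ltRHS]invf_div ltf_pV2 ?posrE ?divr_gt0//.
  exact: truncnS_gt.
have N0 : 0 < N.+1%:R^-1 :> R by [].
have cover : K `<=` \bigcup_(e in [set e | fits N.+1%:R^-1 e s]) box e.
  by move=> x _; have [e ex es] := exists_entry x Ps N0; exists e.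
have := cK; rewrite compact_cover.
move=> /(_ _ _ box (fun e _ => open_obox _ _) cover)[D' D's KD'].
pose sD := finmap.enum_fset D'.
exists (sD, N) => x Kx j; have [e /= eD' ex] := KD' x Kx.
have se := D's _ eD'; rewrite inE /= in se.
have : Q (sD, N) s by split => // e' /D's; rewrite inE.
move=> /(@xgetI _ s0)[_ /(_ e eD')/(_ x ex j)] h1.
have h2 := se x ex j.
rewrite (_ : v s j x - _ = (v s j x - ratr (e.2 j)) -
  (v (xget s0 (Q (sD, N))) j x - ratr (e.2 j))); last by ring.
apply: le_lt_trans (ler_normB _ _) _; rewrite (splitr eps).
by rewrite ltrD// (lt_trans _ hN).
Qed.

End countable_uniformly_dense.

Section countable_dense_test_functions.
Context (R : realType) (n : nat).
Variable Om : set 'rV[R]_n.+1.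
Hypothesis bOm : bounded_set Om.

(** Compactness of the closure of [Om] is enough for the functions together with
    their first derivatives, seen as one continuous map with [n + 2]
    components. *)
Lemma countable_dense_test_functions :
  exists (I : countType) (D : I -> 'rV[R]_n.+1 -> R),
  (forall i, test_function Om (D i)) /\
  forall phi (eps : R), test_function Om phi -> 0 < eps -> exists i,
    (forall x, Om x -> `|phi x - D i x| < eps) /\
    forall j x, Om x -> `|'D_(dx R j) phi x - 'D_(dx R j) (D i) x| < eps.
Proof.
pose v (phi : 'rV[R]_n.+1 -> R) (j : 'I_n.+2) :=
  if unlift ord0 j is Some j' then 'D_(dx R j') phi else phi.
have cv phi : test_function Om phi -> forall j, continuous (v phi j).
  move=> /test_function_smooth sp j; rewrite /v; case: unlift => [j'|].
    exact/smooth_continuous/smooth_derive.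
  exact: smooth_continuous.
have [M _ OmM] := bounded_sub_obox bOm.
have cK : compact (cbox (coordinates_rV R n) (fun=> - M) (fun=> M)).
  exact: crd_compact.
have [I [D [DP dense]]] := countable_uniformly_dense (coordinates_rV R n)
  (test_function0 Om) cv cK.
exists I, D; split => // phi eps tp eps0; have [i hi] := dense _ _ tp eps0.
exists i; split => [x /OmM/obox_cbox Kx|j x /OmM/obox_cbox Kx].
  by have := hi x Kx ord0; rewrite /v unlift_none.
by have := hi x Kx (lift ord0 j); rewrite /v liftK.
Qed.

End countable_dense_test_functions.

(** * Integrals over time slices *)

Section slices.
Context d1 d2 (T1 : measurableType d1) (T2 : measurableType d2) (R : realType).
Variables (m1 : {sigma_finite_measure set T1 -> \bar R})
  (m2 : {sigma_finite_measure set T2 -> \bar R}) (A : set T1).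
Hypothesis mA : measurable A.
Implicit Types (J : set T2) (h : T1 * T2 -> R).

Definition slice h (t : T2) : R := \int[m1]_(x in A) h (x, t).

Let restrictXE h J x t : ((EFin \o h) \_ (A `*` J)) (x, t) =
  if t \in J then ((fun x => (h (x, t))%:E) \_ A) x else 0%E.
Proof.
rewrite !patchE; have [tJ|tJ] := boolP (t \in J).
  congr (if _ then _ else _); apply/idP/idP; rewrite !inE/=.
    by move=> [].
  by split => //; exact: set_mem.
by rewrite memNset// => -[_ /= /mem_set]; exact/negP.
Qed.

Section fixed_set.
Variables (J : set T2) (h : T1 * T2 -> R).
Hypothesis mJ : measurable J.
Hypothesis ih : (m1 \x m2)%E.-integrable (A `*` J) (EFin \o h).

Let mAJ : measurable (A `*` J). Proof. exact: measurableX. Qed.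

Let ihJ : (m1 \x m2)%E.-integrable setT ((EFin \o h) \_ (A `*` J)).
Proof. exact: (integrable_mkcond _ mAJ).1. Qed.

Lemma ae_integrable_slice :
  {ae m2, forall t, J t -> m1.-integrable A (fun x => (h (x, t))%:E)}.
Proof.
apply: filterS (ae_integrable2 ihJ) => t it Jt.
apply/(integrable_mkcond _ mA); move: it; apply: eq_integrable => // x _.
by rewrite restrictXE mem_set.
Qed.

Let fubini_GE t : J t -> fubini_G m1 ((EFin \o h) \_ (A `*` J)) t =
  (\int[m1]_(x in A) (h (x, t))%:E)%E.
Proof.
move=> Jt; rewrite /fubini_G [RHS]integral_mkcond.
by apply: eq_integral => x _; rewrite restrictXE mem_set.
Qed.

Lemma ae_slice_fin : {ae m2, forall t, J t ->
  (slice h t)%:E = (\int[m1]_(x in A) (h (x, t))%:E)%E}.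
Proof.
apply: filterS ae_integrable_slice => t it Jt; rewrite /slice fineK//.
by apply: integrable_fin_num => //; exact: it.
Qed.

Lemma measurable_slice : measurable_fun J (slice h).
Proof.
apply: (@eq_measurable_fun _ _ _ _ _
    (fine \o fubini_G m1 ((EFin \o h) \_ (A `*` J)))).
  by move=> t /set_mem Jt; rewrite /= fubini_GE.
apply: measurable_funTS; apply: measurableT_comp; first exact: fine_measurable.
exact: (measurable_fubini_G ihJ).
Qed.

Lemma integrable_slice : m2.-integrable J (EFin \o slice h).
Proof.
pose hJ := (EFin \o h) \_ (A `*` J).
pose N t := (\int[m1]_x `|hJ (x, t)|)%E.
have mhJ : measurable_fun setT hJ by exact: measurable_int ihJ.
have mahJ : measurable_fun setT (abse \o hJ) by exact: measurableT_comp.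
have N0 t : (0 <= N t)%E by exact: integral_ge0.
have iN : m2.-integrable J N.
  apply: (@integrableS _ _ _ _ setT) => //; apply/integrableP; split.
    exact: (measurable_fun_fubini_tonelli_G (abse \o hJ) mahJ
      (fun z => abse_ge0 (hJ z))).
  under eq_integral do rewrite gee0_abs//.
  exact/(integrable21ltyP _ _ mhJ).
apply: (le_integrable mJ) iN; first exact/measurable_EFinP/measurable_slice.
move=> t Jt; rewrite [leRHS]gee0_abs//.
apply: (@le_trans _ _ `|\int[m1]_(x in A) (h (x, t))%:E|%E).
  rewrite /= /slice /Rintegral.
  by case: (\int[m1]_(x in A) _)%E => [r| |] //=; rewrite normr0 leey.
rewrite -fubini_GE//; apply: le_abse_integral => //.
exact: (measurableT_comp mhJ (pair2_measurable t)).
Qed.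

Lemma integral_slice :
  (\int[m2]_(t in J) (slice h t)%:E = \int[m1 \x m2]_(z in A `*` J) (h z)%:E)%E.
Proof.
rewrite [RHS]integral_mkcond -(integral21_prod_meas1 ihJ).
transitivity (\int[m2]_(t in J) fubini_G m1 ((EFin \o h) \_ (A `*` J)) t)%E.
  apply: ae_eq_integral => //.
  - exact/measurable_EFinP/measurable_slice.
  - by apply: measurable_funTS; exact: (measurable_fubini_G ihJ).
  - by apply: filterS ae_slice_fin => t e Jt; rewrite fubini_GE// e.
rewrite integral_mkcond; apply: eq_integral => t _; rewrite patchE.
case: ifPn => // tJ; rewrite /fubini_G integral0_eq// => x _.
by rewrite restrictXE (negbTE tJ).
Qed.

Lemma Rintegral_slice :
  \int[m2]_(t in J) slice h t = \int[(m1 \x m2)%E]_(z in A `*` J) h z.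
Proof. by rewrite /Rintegral integral_slice. Qed.

End fixed_set.

End slices.

Section Rintegral_complements.
Context d (T : measurableType d) (R : realType) (mu : {measure set T -> \bar R}).
Variables (D : set T) (mD : measurable D).
Implicit Types g h : T -> R.

Lemma integrable_mul_bounded g h M : mu.-integrable D (EFin \o g) ->
  measurable_fun D h -> (forall x, `|h x| <= M) ->
  mu.-integrable D (fun x => (g x * h x)%:E).
Proof.
move=> ig mh hM; have M0 : 0 <= M := le_trans (normr_ge0 _) (hM point).
have mg : measurable_fun D g by apply/measurable_EFinP; case/integrableP: ig.
apply: (le_integrable mD) (integrableZl mD M ig).
  by apply/measurable_EFinP; exact: measurable_funM.
by move=> x _; rewrite /= lee_fin !normrM (ger0_norm M0) mulrC ler_wpM2r.
Qed.

Lemma Rintegral_sum (I : Type) (s : seq I) (f : I -> T -> R) :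
  (forall i, mu.-integrable D (EFin \o f i)) ->
  \int[mu]_(x in D) (\sum_(i <- s) f i x) = \sum_(i <- s) \int[mu]_(x in D) f i x.
Proof.
move=> if_; elim: s => [|i s IH].
  rewrite big_nil (@eq_Rintegral _ _ _ _ _ (cst 0)) ?Rintegral_cst ?mul0r//.
  by move=> x _; rewrite big_nil.
rewrite big_cons -IH -RintegralD//.
  by apply: eq_Rintegral => x _; rewrite big_cons.
rewrite (_ : _ \o _ = (fun x => \sum_(j <- s) (f j x)%:E)%E).
  apply: integrable_sum => // i' _; exact: if_.
by apply/funext => x; rewrite /= sumEFin.
Qed.

Lemma dist_Rintegral_le g h1 h2 (e : R) : mu.-integrable D (EFin \o g) ->
  mu.-integrable D (fun x => (g x * h1 x)%:E) ->
  mu.-integrable D (fun x => (g x * h2 x)%:E) ->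
  (forall x, D x -> `|h1 x - h2 x| <= e) ->
  `|\int[mu]_(x in D) (g x * h1 x) - \int[mu]_(x in D) (g x * h2 x)| <=
    e * \int[mu]_(x in D) `|g x|.
Proof.
move=> ig i1 i2 h12; rewrite -RintegralB//.
have i12 := integrableB mD i1 i2.
apply: le_trans (le_normr_Rintegral mD i12) _.
have iag := integrable_norm ig.
rewrite -RintegralZl//; apply: le_Rintegral => //.
- exact: integrable_norm i12.
- by have := integrableZl mD e iag; exact.
- by move=> x Dx /=; rewrite -mulrBr normrM mulrC ler_wpM2r// h12.
Qed.

End Rintegral_complements.

Section tensor_test_functions.
Context (R : realType) (n : nat).
Local Notation X := 'rV[R]_n.+1.

(** The projections under names of their own, to carry linear structures. *)
Definition space_part (z : X * R) : X := z.1.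
Definition time_part (z : X * R) : R := z.2.

Let space_part_linear : linear space_part. Proof. by []. Qed.
Let time_part_linear : linear time_part. Proof. by []. Qed.

HB.instance Definition _ := GRing.isLinear.Build R (X * R)%type X *:%R
  space_part space_part_linear.
HB.instance Definition _ := GRing.isLinear.Build R (X * R)%type R *:%R
  time_part time_part_linear.

Lemma smooth_space_part (phi : X -> R) : smooth phi ->
  smooth (fun z : X * R => phi z.1).
Proof.
move=> sp; rewrite (_ : (fun z => _) = (fun z => phi (space_part z + 0))).
  by apply: smooth_comp_affine => // z; exact: cvg_fst.
by apply/funext => z; rewrite addr0.
Qed.

Lemma smooth_time_part (chi : R -> R) : smooth chi ->
  smooth (fun z : X * R => chi z.2).
Proof.
move=> sp; rewrite (_ : (fun z => _) = (fun z => chi (time_part z + 0))).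
  by apply: smooth_comp_affine => // z; exact: cvg_snd.
by apply/funext => z; rewrite addr0.
Qed.

Lemma derive_tensor (phi : X -> R) (chi : R -> R) (v z : X * R) :
  smooth phi -> smooth chi ->
  'D_v (fun z => phi z.1 * chi z.2) z =
  phi z.1 * 'D_(v.2) chi z.2 + chi z.2 * 'D_(v.1) phi z.1.
Proof.
move=> sp sc.
rewrite (@deriveM _ _ (fun z => phi z.1) (fun z => chi z.2)); last 2 first.
- exact/smooth_derivable/smooth_space_part.
- exact/smooth_derivable/smooth_time_part.
have -> : 'D_v (fun z : X * R => chi z.2) z = 'D_(v.2) chi z.2.
  rewrite (_ : (fun z => _) = (fun z => chi (time_part z + 0))).
    by rewrite derive_comp_affine addr0.
  by apply/funext => y; rewrite addr0.
have -> // : 'D_v (fun z : X * R => phi z.1) z = 'D_(v.1) phi z.1.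
rewrite (_ : (fun z => _) = (fun z => phi (space_part z + 0))).
  by rewrite derive_comp_affine addr0.
by apply/funext => y; rewrite addr0.
Qed.

Lemma test_function_tensor (Om : set X) (T : R) (phi : X -> R) (chi : R -> R) :
  test_function Om phi -> test_function `]0, T[%classic chi ->
  test_function (cylinder Om T) (fun z => phi z.1 * chi z.2).
Proof.
move=> [sp cp pO] [sc cc cI].
set K1 := closure _ in cp pO; set K2 := closure _ in cc cI.
have cK : compact (K1 `*` K2) by exact: compact_setX.
have sub : closure [set z : X * R | phi z.1 * chi z.2 != 0] `<=` K1 `*` K2.
  rewrite closureE; apply: smallest_sub.
    by apply: compact_closed => //; exact: norm_hausdorff.
  move=> z /=; rewrite mulf_eq0 negb_or => /andP[h1 h2].
  by split; exact: subset_closure.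
split.
- by apply: smoothM; [exact: smooth_space_part|exact: smooth_time_part].
- by apply: subclosed_compact sub => //; exact: closed_closure.
- by move=> z /sub[h1 h2]; split; [exact: pO|exact: cI].
Qed.

End tensor_test_functions.

(** * Time increments of a weak solution *)

Section weak_time_derivative.
Context (R : realType) (n : nat).
Local Notation X := 'rV[R]_n.+1.
Local Notation leb := (lebesgue_rV R n.+1).
Local Notation lebT := (@lebesgue_R R).
Local Notation lebXT := (lebesgue_rVT R n.+1).
Local Notation l := (coordinates_rV R n).
Variables (Om : set X) (T : R).
Hypothesis openOm : open Om.
Hypothesis bOm : bounded_set Om.
Hypothesis T_gt0 : 0 < T.
Let I : set R := `]0, T[%classic.
Variables (B : 'I_n.+1 -> X * R -> R) (f u : X * R -> R).
Hypothesis iB : forall j, lebXT.-integrable (cylinder Om T) (EFin \o B j).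
Hypothesis if_ : lebXT.-integrable (cylinder Om T) (EFin \o f).
Hypothesis iu : lebXT.-integrable (cylinder Om T) (EFin \o u).
Hypothesis weak : forall phi, test_function (cylinder Om T) phi ->
  (\int[lebXT]_(z in cylinder Om T)
     ((\sum_j B j z * 'D_(dx_T R j) phi z) - u z * 'D_(dt_T R n) phi z)%:E =
   \int[lebXT]_(z in cylinder Om T) (f z * phi z)%:E)%E.

Let mOm : measurable Om. Proof. exact: (open_measurable_crd l). Qed.
Let mI : measurable I. Proof. exact: (@measurable_itv R). Qed.
Let mC : measurable (Om `*` I). Proof. exact: measurableX. Qed.

Definition pairing (phi : X -> R) (t : R) : R :=
  \int[leb]_(x in Om) (u (x, t) * phi x).

Let flux (phi : X -> R) (z : X * R) : R :=
  \sum_j B j z * 'D_(dx R j) phi z.1 - f z * phi z.1.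

Lemma integrable_mul_space g phi J : measurable J -> J `<=` I ->
  lebXT.-integrable (Om `*` I) (EFin \o g) -> test_function Om phi ->
  lebXT.-integrable (Om `*` J) (fun z => (g z * phi z.1)%:E).
Proof.
move=> mJ JI ig tp; have [M M0 hM] := test_function_bounded tp.
have mphi : measurable_fun setT phi.
  by apply: (continuous_measurable_crd l); apply: smooth_continuous; case: tp.
have ig' : lebXT.-integrable (Om `*` J) (EFin \o g).
  apply: integrableS ig => //; first exact: measurableX.
  by move=> z [? /JI ?]; split.
have mOJ : measurable (Om `*` J) by exact: measurableX.
have mh : measurable_fun (Om `*` J) (fun z : X * R => phi z.1).
  by apply: measurable_funTS; exact: (measurableT_comp mphi measurable_fst).
exact: (integrable_mul_bounded mOJ ig' mh (fun z => hM z.1)).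
Qed.

Let int_flux phi J : measurable J -> J `<=` I -> test_function Om phi ->
  lebXT.-integrable (Om `*` J) (EFin \o flux phi).
Proof.
move=> mJ JI tp; have mOJ : measurable (Om `*` J) by exact: measurableX.
have i1 : lebXT.-integrable (Om `*` J)
    (fun z => \sum_(j <- index_enum 'I_n.+1) (B j z * 'D_(dx R j) phi z.1)%:E)%E.
  apply: integrable_sum => // j _.
  exact: (integrable_mul_space mJ JI (iB j) (test_function_derive _ tp)).
have i12 := integrableB mOJ i1 (integrable_mul_space mJ JI if_ tp).
by apply: eq_integrable i12 => // z _; rewrite /= sumEFin.
Qed.

Let mul_time g chi : lebXT.-integrable (Om `*` I) (EFin \o g) -> test_function I chi ->
  lebXT.-integrable (Om `*` I) (fun z => (g z * chi z.2)%:E).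
Proof.
move=> ig tc; have [M M0 hM] := test_function_bounded tc.
have mchi : measurable_fun setT chi.
  by apply: (continuous_measurable_crd (coordinates_R R));
    apply: smooth_continuous; case: tc.
have mh : measurable_fun (Om `*` I) (fun z : X * R => chi z.2).
  by apply: measurable_funTS; exact: (measurableT_comp mchi measurable_snd).
exact: (integrable_mul_bounded mC ig mh (fun z => hM z.2)).
Qed.

(* the weak equation tested with [phi x * chi t], sorted by [chi] and its
   derivative *)
Let weak_tensor phi chi : test_function Om phi -> test_function I chi ->
  (\int[lebXT]_(z in Om `*` I)
     (flux phi z * chi z.2 - u z * phi z.1 * 'D_1 chi z.2)%:E = 0)%E.
Proof.
move=> tp tc; have sp := test_function_smooth tp; have sc := test_function_smooth tc.
have := weak (test_function_tensor tp tc).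
have iK := mul_time (int_flux mI (@subset_refl _ I) tp) tc.
have iu1 := integrable_mul_space mI (@subset_refl _ I) iu tp.
have iu2 := mul_time iu1 (test_function_derive (1 : R) tc).
have if1 := mul_time (integrable_mul_space mI (@subset_refl _ I) if_ tp) tc.
have Dx j z : 'D_(dx_T R j) (fun z : X * R => phi z.1 * chi z.2) z =
    chi z.2 * 'D_(dx R j) phi z.1.
  by rewrite derive_tensor//= derive0 mulr0 add0r.
have Dt z : 'D_(dt_T R n) (fun z : X * R => phi z.1 * chi z.2) z =
    phi z.1 * 'D_1 chi z.2.
  by rewrite derive_tensor//= derive0 mulr0 addr0.
have e z : (\sum_j B j z * 'D_(dx_T R j) (fun z : X * R => phi z.1 * chi z.2) z) -
    u z * 'D_(dt_T R n) (fun z : X * R => phi z.1 * chi z.2) z =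
  (flux phi z * chi z.2 - u z * phi z.1 * 'D_1 chi z.2) + f z * phi z.1 * chi z.2.
  rewrite Dt /flux mulrBl mulr_suml.
  under eq_bigr do rewrite Dx mulrCA mulrC.
  by ring.
have i3 := integrableB mC iK iu2.
under eq_integral do rewrite e EFinD.
rewrite integralD//.
under [in RHS]eq_integral do rewrite mulrA.
move=> h; apply/eqP.
have := integrable_fin_num mC if1 => ffin.
by rewrite -(addeK (\int[lebXT]_(z in Om `*` I) _)%E ffin) h subee.
Qed.

(* the null set of times depends on [phi] *)
Let ae_pairing phi : test_function Om phi -> exists c,
  {ae lebT, forall t, I t -> pairing phi t = c - primitive (slice leb Om (flux phi)) t}.
Proof.
move=> tp.
have iF := int_flux mI (@subset_refl _ I) tp.
have iu1 := integrable_mul_space mI (@subset_refl _ I) iu tp.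
apply: (du_bois_reymond T_gt0).
- exact: (integrable_slice mOm mI iu1).
- exact: (integrable_slice mOm mI iF).
move=> chi tc.
have iK := mul_time iF tc.
have iu2 := mul_time iu1 (test_function_derive (1 : R) tc).
have i3 := integrableB mC iK iu2.
rewrite -(weak_tensor tp tc) -(integral_slice mOm mI i3).
apply: integral_ae_eq_nonmeasurable.
apply: filterS2 (ae_integrable_slice mOm mI iF) (ae_integrable_slice mOm mI iu1).
move=> t h1 h2 It; congr EFin.
have j1 := integrableZr mOm (chi t) (h1 It).
have j2 := integrableZr mOm ('D_1 chi t) (h2 It).
apply: esym; apply: etrans (RintegralB mOm j1 j2) _.
by congr (_ - _); apply: RintegralZr => //; [exact: h1|exact: h2].
Qed.

Let int_slice g t : I t ->
  leb.-integrable Om (fun x => (u (x, t))%:E) -> test_function Om g ->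
  leb.-integrable Om (fun x => (u (x, t) * g x)%:E).
Proof.
move=> It iut tg; have [M M0 hM] := test_function_bounded tg.
have mg : measurable_fun Om g.
  by apply: (continuous_measurable_crd l); apply: smooth_continuous; case: tg.
exact: (integrable_mul_bounded mOm iut mg hM).
Qed.

Definition increment_identity (G : set R) : Prop :=
  forall t1 t2 : R, G t1 -> G t2 -> t1 <= t2 ->
  forall phi, test_function Om phi ->
  pairing phi t2 - pairing phi t1 =
    \int[lebXT]_(z in Om `*` `]t1, t2]) (f z * phi z.1) -
    \sum_j \int[lebXT]_(z in Om `*` `]t1, t2]) (B j z * 'D_(dx R j) phi z.1).

(** The exceptional null sets of times are those of a countable family of test
    functions; both sides of the identity are continuous in the test function
    for the uniform norm of its values and first derivatives, so it extends
    from the family to all test functions at the remaining times. *)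
Lemma pairing_increment : exists G : set R,
  [/\ {ae lebT, forall t, I t -> G t},
    (forall t, G t -> I t /\ leb.-integrable Om (fun x => (u (x, t))%:E)) &
    increment_identity G].
Proof.
have [J [D [tD dense]]] := countable_dense_test_functions bOm.
pose c i := projT1 (cid (ae_pairing (tD i))).
pose G : set R := [set t | I t /\ leb.-integrable Om (fun x => (u (x, t))%:E) /\
  forall i, pairing (D i) t = c i - primitive (slice leb Om (flux (D i))) t].
exists G; split.
- have h1 : {ae lebT, forall t, forall i, I t ->
      pairing (D i) t = c i - primitive (slice leb Om (flux (D i))) t}.
    by apply: ae_forall_countType => i; rewrite /c; case: cid.
  apply: filterS2 h1 (ae_integrable_slice mOm mI iu) => t h1 h2 It.
  by split => //; split; [exact: h2|move=> i; exact: h1].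
- by move=> t [It [iut _]].
move=> t1 t2 [It1 [iu1 c1]] [It2 [iu2 c2]] t12 phi tphi.
have JI : `]t1, t2]%classic `<=` I.
  move: It1 It2; rewrite /I /= !in_itv/= => /andP[t10 _] /andP[_ t2T].
  move=> t /=; rewrite !in_itv/= => /andP[h1 h2].
  by rewrite (lt_trans t10)// (le_lt_trans h2).
have mJ : measurable `]t1, t2]%classic by exact: (@measurable_itv R).
set S := Om `*` `]t1, t2].
have mS : measurable S by exact: measurableX.
have SC : S `<=` Om `*` I by move=> z [? /JI].
have iBS j : lebXT.-integrable S (EFin \o B j) by exact: integrableS (iB j).
have ifS : lebXT.-integrable S (EFin \o f) by exact: integrableS if_.
pose defect psi := pairing psi t2 - pairing psi t1 -
  (\int[lebXT]_(z in S) (f z * psi z.1) -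
   \sum_j \int[lebXT]_(z in S) (B j z * 'D_(dx R j) psi z.1)).
have defectD i : defect (D i) = 0.
  rewrite /defect c1 c2.
  have iF := int_flux mI (@subset_refl _ I) (tD i).
  have is_ := integrable_slice mOm mI iF.
  have -> : primitive (slice leb Om (flux (D i))) t2 =
      primitive (slice leb Om (flux (D i))) t1 +
      \int[lebT]_(t in `]t1, t2]) slice leb Om (flux (D i)) t.
    exact: (primitive_increment is_).
  rewrite (Rintegral_slice mOm mJ (int_flux mJ JI (tD i))).
  rewrite /flux RintegralB//; last 2 first.
  - have : lebXT.-integrable S (fun z =>
        \sum_(j <- index_enum 'I_n.+1) (B j z * 'D_(dx R j) (D i) z.1)%:E)%E.
      apply: integrable_sum => // j _.
      exact: (integrable_mul_space mJ JI (iB j) (test_function_derive _ (tD i))).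
    by apply: eq_integrable => // z _; rewrite /= sumEFin.
  - exact: (integrable_mul_space mJ JI if_ (tD i)).
  rewrite Rintegral_sum//; last first.
    by move=> j; exact: (integrable_mul_space mJ JI (iB j) (test_function_derive _ (tD i))).
  by ring.
pose M := \int[leb]_(x in Om) `|u (x, t2)| + \int[leb]_(x in Om) `|u (x, t1)| +
  (\int[lebXT]_(z in S) `|f z| + \sum_j \int[lebXT]_(z in S) `|B j z|).
have M0 : 0 <= M.
  by rewrite !addr_ge0 ?sumr_ge0// => [|||j _]; exact: Rintegral_ge0.
have small eps : 0 < eps -> `|defect phi| <= eps * M.
  move=> eps0; have [i [hv hd]] := dense phi eps tphi eps0.
  have dp t : I t -> leb.-integrable Om (fun x => (u (x, t))%:E) ->
      `|pairing phi t - pairing (D i) t| <= eps * \int[leb]_(x in Om) `|u (x, t)|.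
    move=> It iut; apply: dist_Rintegral_le => //.
    - exact: int_slice.
    - exact: int_slice.
    - by move=> x Omx; rewrite ltW// hv.
  have df : `|\int[lebXT]_(z in S) (f z * phi z.1) -
      \int[lebXT]_(z in S) (f z * D i z.1)| <= eps * \int[lebXT]_(z in S) `|f z|.
    apply: dist_Rintegral_le => //.
    - exact: (integrable_mul_space mJ JI if_ tphi).
    - exact: (integrable_mul_space mJ JI if_ (tD i)).
    - by move=> z [Omz _]; rewrite ltW// hv.
  have dB j : `|\int[lebXT]_(z in S) (B j z * 'D_(dx R j) phi z.1) -
      \int[lebXT]_(z in S) (B j z * 'D_(dx R j) (D i) z.1)| <=
      eps * \int[lebXT]_(z in S) `|B j z|.
    apply: dist_Rintegral_le => //.
    - exact: (integrable_mul_space mJ JI (iB j) (test_function_derive _ tphi)).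
    - exact: (integrable_mul_space mJ JI (iB j) (test_function_derive _ (tD i))).
    - by move=> z [Omz _]; rewrite ltW// hd.
  pose f1 := \int[lebXT]_(z in S) (f z * phi z.1).
  pose f2 := \int[lebXT]_(z in S) (f z * D i z.1).
  pose b1 := \sum_j \int[lebXT]_(z in S) (B j z * 'D_(dx R j) phi z.1).
  pose b2 := \sum_j \int[lebXT]_(z in S) (B j z * 'D_(dx R j) (D i) z.1).
  rewrite -[defect phi]subr0 -(defectD i) /defect -/f1 -/f2 -/b1 -/b2.
  have db : `|b1 - b2| <= eps * \sum_j \int[lebXT]_(z in S) `|B j z|.
    rewrite /b1 /b2 -sumrB mulr_sumr; apply: le_trans (ler_norm_sum _ _ _) _.
    by apply: ler_sum => j _; exact: dB.
  have d1 := dp _ It1 iu1; have d2 := dp _ It2 iu2.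
  rewrite (_ : _ - _ = (pairing phi t2 - pairing (D i) t2) -
    (pairing phi t1 - pairing (D i) t1) - ((f1 - f2) - (b1 - b2))); last by ring.
  rewrite /M !mulrDr; apply: le_trans (ler_normB _ _) _; apply: lerD.
    by apply: le_trans (ler_normB _ _) _; exact: lerD.
  by apply: le_trans (ler_normB _ _) _; exact: lerD.
apply/eqP; rewrite -subr_eq0 -normr_le0; apply/ler_addgt0Pl => eps eps0.
rewrite addr0; apply: le_trans (small (eps / (M + 1)) _) _.
  by rewrite divr_gt0// ltr_wpDl.
rewrite mulrAC ler_pdivrMr ?ltr_wpDl//; nra.
Qed.

End weak_time_derivative.

(** * Lebesgue spaces on a subset *)

Section Lp_restricted.
Context (R : realType) (d : measure_display) (T : measurableNormedModType R d).
Variables (mu : {measure set T -> \bar R}) (D : set T).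
Hypothesis mD : measurable D.
Implicit Types (f g : T -> R) (p q : R).

Lemma Lp_measurable p f : Lp mu D p f -> measurable_fun D f.
Proof.
move=> fp; apply/(measurable_restrictT _ mD).
by have /sub_Lfun_mfun := fp; rewrite inE.
Qed.

Lemma Lp_norm_lty p f : Lp mu D p f -> (Lp_norm mu D p f < +oo)%E.
Proof. by move=> fp; have /sub_Lfun_finLfun := fp; rewrite inE. Qed.

Lemma LpP p f : measurable_fun D f -> (Lp_norm mu D p f < +oo)%E -> Lp mu D p f.
Proof.
move=> mf fp; rewrite /Lp /= inE; apply/andP; split; rewrite inE//.
exact/(measurable_restrictT _ mD).
Qed.

Lemma ae_eq_Lp_norm p f g : p != 0 -> ae_eq mu D f g ->
  Lp_norm mu D p f = Lp_norm mu D p g.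
Proof.
move=> p0 fg.
have fgp : (\int[mu]_(x in D) (`|f x| `^ p)%:E = \int[mu]_(x in D) (`|g x| `^ p)%:E)%E.
  by apply: integral_ae_eq_nonmeasurable; apply: filterS fg => x h Dx; rewrite h.
by rewrite /Lp_norm (Lnorm_restrict mu D f p0) (Lnorm_restrict mu D g p0) fgp.
Qed.

Lemma Lp_norm_triangle p f g : 1 <= p -> measurable_fun D f -> measurable_fun D g ->
  (Lp_norm mu D p f <= Lp_norm mu D p g + Lp_norm mu D p (g \- f)%R)%E.
Proof.
move=> p1 mf mg.
have mfD := (measurable_restrictT f mD).1 mf.
have mgD := (measurable_restrictT g mD).1 mg.
pose h (x : T) : R := - ((g \- f) \_ D) x.
have mh : measurable_fun setT h.
  apply: measurableT_comp => //; apply/(measurable_restrictT _ mD).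
  exact: measurable_funB.
have := @minkowski_EFin _ _ _ mu _ _ p mgD mh p1.
rewrite (_ : (_ \+ _)%R = f \_ D); last first.
  apply/funext => x; rewrite /h /= !patchE; case: ifP => _.
    by rewrite /= opprB addrC subrK.
  by rewrite oppr0 addr0.
move/le_trans; apply; rewrite leeD2l//.
rewrite (_ : EFin \o h = (\- (EFin \o ((g \- f)%R \_ D)))%E) ?oppe_Lnorm//.
Qed.

Lemma hoelder_restricted p q f g : 0 < p -> 0 < q -> p^-1 + q^-1 = 1 ->
  measurable_fun D f -> measurable_fun D g ->
  (\int[mu]_(x in D) `|f x * g x|%:E <= Lp_norm mu D p f * Lp_norm mu D q g)%E.
Proof.
move=> p0 q0 pq mf mg.
have mfD := (measurable_restrictT f mD).1 mf.
have mgD := (measurable_restrictT g mD).1 mg.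
apply: le_trans (hoelder mu mfD mgD p0 q0 pq).
rewrite Lnorm1 [leLHS]integral_mkcond le_eqVlt; apply/orP; left; apply/eqP.
apply: eq_integral => x _; rewrite /= !patchE.
by case: ifP => //; rewrite mulr0 normr0.
Qed.

Lemma hoelder_integrable p q f g : 0 < p -> 0 < q -> p^-1 + q^-1 = 1 ->
  Lp mu D p f -> Lp mu D q g -> mu.-integrable D (fun x => (f x * g x)%:E).
Proof.
move=> p0 q0 pq fp gq; have mf := Lp_measurable fp; have mg := Lp_measurable gq.
apply/integrableP; split; first by apply/measurable_EFinP; exact: measurable_funM.
apply: le_lt_trans (hoelder_restricted p0 q0 pq mf mg) _.
have := Lp_norm_lty fp; have := Lp_norm_lty gq.
rewrite -!ge0_fin_numE ?Lnorm_ge0//; last by rewrite mule_ge0 ?Lnorm_ge0.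
by move=> h1 h2; rewrite fin_numM.
Qed.

Lemma hoelder_Rintegral p q f g : 0 < p -> 0 < q -> p^-1 + q^-1 = 1 ->
  Lp mu D p f -> Lp mu D q g ->
  (`|\int[mu]_(x in D) (f x * g x)|%:E <= Lp_norm mu D p f * Lp_norm mu D q g)%E.
Proof.
move=> p0 q0 pq fp gq; have mf := Lp_measurable fp; have mg := Lp_measurable gq.
have ifg := hoelder_integrable p0 q0 pq fp gq.
apply: le_trans (hoelder_restricted p0 q0 pq mf mg).
rewrite /Rintegral -abse_EFin fineK; last exact: integrable_fin_num.
apply: le_abse_integral => //; exact: measurable_int ifg.
Qed.

Lemma Lp_norm_le_subset (E : set T) p f : p != 0 -> measurable E -> E `<=` D ->
  measurable_fun D f -> 0 < p -> (Lp_norm mu E p f <= Lp_norm mu D p f)%E.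
Proof.
move=> p0 mE ED mf p_gt0; rewrite /Lp_norm !Lnorm_restrict//.
apply: le_poweR; first by rewrite invr_ge0 ltW.
  by apply: integral_ge0 => x _; rewrite lee_fin powR_ge0.
apply: ge0_subset_integral => //.
  apply/measurable_EFinP; apply: (measurableT_comp (measurable_powR p)).
  exact: measurableT_comp.
Qed.

(** Pointwise [|f| ^ p <= 1 + |f| ^ q]. *)
Lemma Lp_antitone p q f : (mu D < +oo)%E -> 0 < p -> p <= q -> Lp mu D q f -> Lp mu D p f.
Proof.
move=> Doo p0 pq fq; have mf := Lp_measurable fq; have q0 : 0 < q by exact: lt_le_trans pq.
have pow_lty e : 0 < e -> (Lp_norm mu D e f < +oo)%E <->
    (\int[mu]_(x in D) (`|f x| `^ e)%:E < +oo)%E.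
  move=> e0; rewrite /Lp_norm Lnorm_restrict ?gt_eqF//; split.
    by apply: lty_poweRy; rewrite invr_eq0 gt_eqF.
  exact: poweR_lty.
apply: LpP => //; apply/pow_lty => //.
have mpow e : measurable_fun D (fun x => (`|f x| `^ e)%:E).
  apply/measurable_EFinP; apply: (measurableT_comp (measurable_powR e)).
  exact: measurableT_comp.
apply: (@le_lt_trans _ _ (\int[mu]_(x in D) (1 + (`|f x| `^ q)%:E))%E).
  apply: ge0_le_integral => //; first exact: emeasurable_funD.
  move=> x _; rewrite -EFinD lee_fin.
  have [f1|f1] := leP `|f x| 1.
    rewrite (@le_trans _ _ 1) ?lerDl ?powR_ge0//.
    have -> : 1 = 1 `^ p :> R by rewrite powR1.
    by apply: ge0_ler_powR; rewrite ?nnegrE// ltW.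
  by rewrite (@le_trans _ _ (`|f x| `^ q)) ?lerDr// ler_powR// ltW.
rewrite ge0_integralD//.
have -> : (\int[mu]_(x in D) 1 = mu D)%E by rewrite integral_cst// mul1e.
apply: lte_add_pinfty => //; exact/(pow_lty _ q0)/Lp_norm_lty.
Qed.

End Lp_restricted.

Section Lp_integrability.
Context (R : realType) (d : measure_display) (T : measurableNormedModType R d).
Variables (mu : {measure set T -> \bar R}) (D : set T).
Hypothesis mD : measurable D.
Implicit Types (b f g : T -> R) (p : R).

Lemma Lp_powR_integrable p f : 0 < p ->
  Lp mu D p f <-> measurable_fun D f /\
    mu.-integrable D (fun x => (`|f x| `^ p)%:E).
Proof.
move=> p0; have mpow : measurable_fun D f ->
    measurable_fun D (fun x => (`|f x| `^ p)%:E).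
  move=> mf; apply/measurable_EFinP; apply: (measurableT_comp (measurable_powR p)).
  exact: measurableT_comp.
have abseE : (\int[mu]_(x in D) `|(`|f x| `^ p)%:E| = \int[mu]_(x in D) (`|f x| `^ p)%:E)%E.
  by apply: eq_integral => x _; rewrite gee0_abs// lee_fin powR_ge0.
split=> [fp|[mf /integrableP[_ h]]].
  have mf := Lp_measurable mD fp; split => //; apply/integrableP; split; first exact: mpow.
  rewrite abseE; have := Lp_norm_lty fp; rewrite /Lp_norm Lnorm_restrict ?gt_eqF//.
  by apply: lty_poweRy; rewrite invr_eq0 gt_eqF.
by apply: (LpP mD) => //; rewrite /Lp_norm Lnorm_restrict ?gt_eqF//; apply: poweR_lty; rewrite -abseE.
Qed.

Lemma Lp_integrable p f : (mu D < +oo)%E -> 1 <= p -> Lp mu D p f ->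
  mu.-integrable D (EFin \o f).
Proof.
move=> Doo p1 fp; have /(Lp_powR_integrable _ ltr01)[mf] := Lp_antitone mD Doo ltr01 p1 fp.
move=> /integrableP[_ h]; apply/integrableP; split; first exact/measurable_EFinP.
apply: le_lt_trans h; rewrite le_eqVlt; apply/orP; left; apply/eqP.
by apply: eq_integral => x _; rewrite /= powRr1// normr_id.
Qed.

(** The power [p / (p - 1)] of [|g| ^ (p - 1)] is [|g| ^ p]. *)
Lemma Lp_conjugate_flux p (Lam : R) b g : 1 < p -> 0 <= Lam ->
  measurable_fun D b -> (forall x, `|b x| <= Lam) -> Lp mu D p g ->
  Lp mu D (p / (p - 1)) (fun x => b x * (`|g x| `^ (p - 2) * g x)).
Proof.
move=> p1 Lam0 mb hb gp; have p0 : 0 < p by exact: lt_trans p1.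
have [mg ig] := (Lp_powR_integrable g p0).1 gp.
have q0 : 0 < p / (p - 1) by rewrite divr_gt0// subr_gt0.
apply/(Lp_powR_integrable _ q0).
have mB : measurable_fun D (fun x => b x * (`|g x| `^ (p - 2) * g x)).
  apply: measurable_funM => //; apply: measurable_funM => //.
  apply: (measurableT_comp (measurable_powR (p - 2))); exact: measurableT_comp.
split => //.
have ib := integrableZl mD (Lam `^ (p / (p - 1))) ig.
apply: (le_integrable mD _ _ ib).
  apply/measurable_EFinP; apply: (measurableT_comp (measurable_powR (p / (p - 1)))).
  exact: measurableT_comp.
have q_ge0 y : `|y `^ (p / (p - 1))| = y `^ (p / (p - 1)) by rewrite ger0_norm ?powR_ge0.
move=> x _ /=; rewrite lee_fin q_ge0.
have -> : `|g x| `^ p = (`|g x| `^ (p - 1)) `^ (p / (p - 1)).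
  by rewrite -powRrM mulrC divfK// gt_eqF// subr_gt0.
rewrite -powRM ?powR_ge0// q_ge0; apply: ge0_ler_powR.
- exact: ltW.
- by rewrite nnegrE.
- by rewrite nnegrE mulr_ge0 ?powR_ge0.
rewrite normrM ler_pM// normrM (ger0_norm (powR_ge0 _ _)).
have [->|gx0] := eqVneq (g x) 0; first by rewrite normr0 mulr0 powR_ge0.
rewrite -[X in _ * X]powRr1// -powRD; first by rewrite (_ : p - 2 + 1 = p - 1)//; ring.
by apply/implyP => _; rewrite normr_eq0.
Qed.

End Lp_integrability.

(** * Hoelder estimate of the increments *)

Section cylinder_hoelder.
Context (R : realType) (n : nat).
Local Notation X := 'rV[R]_n.+1.
Local Notation leb := (lebesgue_rV R n.+1).
Local Notation lebXT := (lebesgue_rVT R n.+1).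
Variables (Om : set X) (T : R).
Hypothesis openOm : open Om.
Hypothesis bOm : bounded_set Om.
Hypothesis T_gt0 : 0 < T.
Implicit Types (psi phi : X -> R) (g : X * R -> R).

Let mOm : measurable Om. Proof. exact: (open_measurable_crd (coordinates_rV R n)). Qed.

Lemma measurable_cylinder : measurable (cylinder Om T).
Proof. by apply: measurableX => //; exact: (@measurable_itv R). Qed.

Lemma cylinder_lty : (lebXT (cylinder Om T) < +oo)%E.
Proof.
have mI : measurable (`]0, T[%classic : set R) by exact: (@measurable_itv R).
have := product_measure1E leb (@lebesgue_R R) mOm mI.
move=> /= h; rewrite /lebesgue_rVT /cylinder; move: h => ->.
rewrite lte_mul_pinfty//; last exact: lebesgue_R_itvoo_lty.
by rewrite ge0_fin_numE//; exact: bounded_lebesgue_lty.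
Qed.

(** Tonelli's theorem, for a function that does not depend on time. *)
Lemma Lp_norm_space psi p (J : set R) L : 0 < p -> 0 <= L ->
  measurable_fun [set: X] psi -> measurable J -> lebesgue_R J = L%:E ->
  Lp_norm lebXT (Om `*` J) p (fun z => psi z.1) =
  ((L `^ p^-1)%:E * Lp_norm leb Om p psi)%E.
Proof.
move=> p0 L0 mpsi mJ JL.
rewrite /Lp_norm !Lnorm_restrict ?gt_eqF//.
have mpow : measurable_fun [set: X] (fun x => `|psi x| `^ p).
  apply: (measurableT_comp (measurable_powR p)).
  exact: measurableT_comp.
rewrite -poweR_EFin -poweRM//; last first.
  by apply: integral_ge0 => x _; rewrite lee_fin powR_ge0.
congr (_ `^ _)%E.
rewrite integral_mkcond.
pose h (z : X * R) : \bar R :=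
  (((fun x : X => (`|psi x| `^ p)%:E) \_ Om) z.1 * (\1_J z.2 : R)%:E)%E.
have psi_ge0 x : (0 <= ((fun x : X => (`|psi x| `^ p)%:E) \_ Om) x)%E.
  by apply: erestrict_ge0 => ? _; rewrite lee_fin powR_ge0.
have h_ge0 z : (0 <= h z)%E.
  by rewrite mule_ge0 ?lee_fin// psi_ge0.
have mh1 : measurable_fun [set: X] ((fun x : X => (`|psi x| `^ p)%:E) \_ Om).
  apply/(measurable_restrictT _ mOm); apply: measurable_funTS.
  exact/measurable_EFinP.
have mh : measurable_fun setT h.
  apply: emeasurable_funM; first exact: (measurableT_comp mh1 measurable_fst).
  apply/measurable_EFinP.
  exact: (measurableT_comp (measurable_indic mJ) measurable_snd).
rewrite (_ : patch _ _ _ = h); last first.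
  apply/funext => -[x t]; rewrite /h !patchE in_setX /= indicE.
  by case: (x \in Om) => /=; case: (t \in J); rewrite ?mule1 ?mule0 ?mul0e.
have := @fubini_tonelli1 _ _ _ _ _ leb (@lebesgue_R R) h mh h_ge0.
rewrite /lebesgue_rVT => ->.
rewrite /fubini_F /h /=.
have sect x : (\int[@lebesgue_R R]_y
    (((fun x : X => (`|psi x| `^ p)%:E) \_ Om) x * (\1_J y : R)%:E) =
    ((fun x : X => (`|psi x| `^ p)%:E) \_ Om) x * lebesgue_R J)%E.
  rewrite ge0_integralZl//; first by rewrite integral_indic// setIT.
  by apply/measurable_EFinP; exact: measurable_indic.
rewrite (eq_integral _ _ (fun x _ => sect x)).
rewrite /= -JL [RHS]muleC ge0_integralZr//.
by rewrite -integral_mkcond.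
Qed.

Lemma test_function_Lp phi p : 0 < p -> test_function Om phi -> Lp leb Om p phi.
Proof.
move=> p0 tphi; have [M M0 hM] := test_function_bounded tphi.
have mphi : measurable_fun setT phi.
  by apply: (continuous_measurable_crd (coordinates_rV R n)); apply: smooth_continuous; case: tphi.
apply: (LpP mOm); first exact: (measurable_funTS mphi).
rewrite /Lp_norm Lnorm_restrict ?gt_eqF//; apply: poweR_lty.
apply: (@le_lt_trans _ _ (\int[leb]_(x in Om) (M `^ p)%:E)%E).
  apply: ge0_le_integral => //.
  - apply/measurable_EFinP; apply: measurable_funTS.
    by apply: (measurableT_comp (measurable_powR p)); exact: measurableT_comp.
  - by move=> x _; rewrite lee_fin ge0_ler_powR ?nnegrE// ltW.
rewrite integral_cst//= lte_mul_pinfty ?lee_fin ?powR_ge0//.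
exact: bounded_lebesgue_lty.
Qed.

Lemma powR_le_scale tau b gam : 0 <= tau <= T -> 0 < gam -> gam <= b ->
  tau `^ b <= T `^ (b - gam) * tau `^ gam.
Proof.
move=> /andP[t0 tT] g0 gb.
have -> : tau `^ b = tau `^ (b - gam) * tau `^ gam.
  rewrite -powRD; first by rewrite subrK.
  by rewrite subrK; apply/implyP => /eqP b0; move: gb; rewrite b0 leNgt g0.
by rewrite ler_wpM2r ?powR_ge0// ge0_ler_powR ?subr_ge0 ?nnegrE// ltW.
Qed.

(** Hoelder in space-time: the length of the time interval enters with the
    power [1 / p] because the second factor does not depend on time; a smaller
    power is obtained at the cost of a power of [T]. *)
Lemma hoelder_cylinder p gam g : 1 < p -> 0 < gam -> gam <= p^-1 ->
  Lp lebXT (cylinder Om T) (p / (p - 1)) g ->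
  exists2 K : R, 0 <= K & forall t1 t2 psi,
    t1 \in `]0, T[ -> t2 \in `]0, T[ -> t1 <= t2 ->
    measurable_fun [set: X] psi -> Lp leb Om p psi ->
    (`|\int[lebXT]_(z in Om `*` [set` `]t1, t2]]) (g z * psi z.1)|%:E <=
     (K * `|t1 - t2| `^ gam)%:E * Lp_norm leb Om p psi)%E.
Proof.
move=> p1 g0 gp gq; have p0 : 0 < p by exact: lt_trans p1.
have q0 : 0 < p / (p - 1) by rewrite divr_gt0// subr_gt0.
have pq : (p / (p - 1))^-1 + p^-1 = 1.
  by rewrite invf_div mulrBl mul1r divff ?gt_eqF// subrK.
have Ngq := Lp_norm_lty gq.
have mg := Lp_measurable measurable_cylinder gq.
have Ng0 : (0 <= Lp_norm lebXT (cylinder Om T) (p / (p - 1)) g)%E by exact: Lnorm_ge0.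
exists (fine (Lp_norm lebXT (cylinder Om T) (p / (p - 1)) g) * T `^ (p^-1 - gam)).
  by rewrite mulr_ge0 ?fine_ge0 ?powR_ge0.
move=> t1 t2 psi t1I t2I t12 mpsi psiLp.
have mJ : measurable ([set` `]t1, t2]] : set R) by exact: (@measurable_itv R).
have JI : [set` `]t1, t2]] `<=` [set` `]0, T[].
  move=> s /=; rewrite !in_itv/= => /andP[h1 h2].
  move: t1I t2I; rewrite !in_itv/= => /andP[t10 _] /andP[_ t2T].
  by rewrite (lt_trans t10 h1) (le_lt_trans h2 t2T).
have mOJ : measurable (Om `*` [set` `]t1, t2]]) by exact: measurableX.
have sub : Om `*` [set` `]t1, t2]] `<=` cylinder Om T by move=> z [? /JI].
have JL : lebesgue_R [set` `]t1, t2]] = (t2 - t1)%:E.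
  rewrite /lebesgue_R lebesgue_measure_itv/= lte_fin.
  move: (t12); rewrite le_eqVlt => /orP[/eqP->|lt12]; first by rewrite ltxx subrr.
  by rewrite lt12 -EFinB.
have L0 : 0 <= t2 - t1 by rewrite subr_ge0.
have Npsi := Lp_norm_space p0 L0 mpsi mJ JL.
have mpsi2 : measurable_fun (Om `*` [set` `]t1, t2]]) (fun z : X * R => psi z.1).
  by apply: measurable_funTS; exact: (measurableT_comp mpsi measurable_fst).
have psi2 : Lp lebXT (Om `*` [set` `]t1, t2]]) p (fun z => psi z.1).
  apply: (LpP mOJ) => //; rewrite Npsi lte_mul_pinfty ?lee_fin ?powR_ge0//.
  exact: Lp_norm_lty.
have Ng : (Lp_norm lebXT (Om `*` [set` `]t1, t2]]) (p / (p - 1)) g <=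
    Lp_norm lebXT (cylinder Om T) (p / (p - 1)) g)%E.
  apply: (Lp_norm_le_subset lebXT measurable_cylinder) => //.
  by rewrite gt_eqF.
have g2 : Lp lebXT (Om `*` [set` `]t1, t2]]) (p / (p - 1)) g.
  apply: (LpP mOJ); last exact: (le_lt_trans Ng Ngq).
  exact: (measurable_funS measurable_cylinder sub mg).
apply: le_trans (hoelder_Rintegral mOJ q0 p0 pq g2 psi2) _.
rewrite Npsi muleA lee_wpmul2r ?Lnorm_ge0//.
rewrite (@le_trans _ _ (Lp_norm lebXT (cylinder Om T) (p / (p - 1)) g *
   ((t2 - t1) `^ p^-1)%:E)%E)//.
  by rewrite lee_wpmul2r// lee_fin powR_ge0.
rewrite -mulrA EFinM fineK; last by rewrite ge0_fin_numE.
rewrite lee_wpmul2l// lee_fin distrC ger0_norm//.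
apply: powR_le_scale => //; rewrite L0/=.
move: t1I t2I; rewrite !in_itv/= => /andP[t10 _] /andP[_ t2T].
lra.
Qed.

End cylinder_hoelder.

Section exponents.
Context (R : realType) (n : nat).
Implicit Types p m : 'I_n.+1 -> R.

Lemma le_max_index p j : p j <= max_index p.
Proof. by rewrite /max_index; exact: le_bigmax. Qed.

Lemma min_index_ge p a : (forall j, a <= p j) -> a <= min_index p.
Proof. by move=> h; rewrite /min_index; apply: le_bigmin. Qed.

Let mean_pos p : (forall j, 0 < p j) -> 0 < n.+1%:R^-1 * \sum_j (p j)^-1.
Proof.
move=> p0; rewrite mulr_gt0 ?invr_gt0// big_ord_recl ltr_pwDl ?invr_gt0//.
by apply: sumr_ge0 => j _; rewrite invr_ge0 ltW.
Qed.

Lemma hmean_exp_le p b : (forall j, 0 < p j) -> (forall j, p j <= b) ->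
  hmean_exp p <= b.
Proof.
move=> p0 pb; have b0 : 0 < b := lt_le_trans (p0 ord0) (pb ord0).
rewrite /hmean_exp -[leRHS]invrK lef_pV2 ?posrE ?invr_gt0 ?mean_pos//.
rewrite ler_pdivlMl// mulr_natl -[in leLHS](card_ord n.+1) -sumr_const.
by apply: ler_sum => j _; rewrite lef_pV2 ?posrE.
Qed.

Lemma hmean_exp_ge p a : 0 < a -> (forall j, a <= p j) -> a <= hmean_exp p.
Proof.
move=> a0 pa; have p0 j : 0 < p j := lt_le_trans a0 (pa j).
rewrite /hmean_exp -[leLHS]invrK lef_pV2 ?posrE ?invr_gt0 ?mean_pos//.
rewrite ler_pdivrMl// mulr_natl -[in leRHS](card_ord n.+1) -sumr_const.
by apply: ler_sum => j _; rewrite lef_pV2 ?posrE.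
Qed.

Lemma hmean_exp_gt1 p : (forall j, 1 < p j) -> 1 < hmean_exp p.
Proof.
move=> p1; have [i _ hi] := @arg_minP _ _ _ (ord0 : 'I_n.+1) xpredT p isT.
apply: lt_le_trans (p1 i) _; apply: hmean_exp_ge => [|j]; last exact: hi.
exact: lt_trans (p1 i).
Qed.

Lemma exists_ge_hmean_exp p : (forall j, 1 < p j) -> exists j, hmean_exp p <= p j.
Proof.
move=> p1; have [i _ hi] := @arg_maxP _ _ _ (ord0 : 'I_n.+1) xpredT p isT.
exists i; apply: hmean_exp_le => j; last exact: hi.
exact: lt_trans (p1 j).
Qed.

(** The map [q |-> q / (q - 1)] decreases. Thus the exponent assumed for the
    source is at least the conjugate of some [p j]. *)
Lemma conjugate_le (H q s : R) : 1 < H -> H <= q -> 1 <= s ->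
  q / (q - 1) <= s * (H / (H - 1)).
Proof.
move=> H1 Hq s1; have q1 : 1 < q by exact: lt_le_trans Hq.
rewrite (@le_trans _ _ (H / (H - 1)))//; last first.
  by rewrite ler_peMl// divr_ge0// ?subr_ge0 ltW// (lt_trans _ H1).
rewrite ler_pdivrMr ?subr_gt0// mulrAC ler_pdivlMr ?subr_gt0//.
by rewrite !mulrBr !mulr1 [H * q]mulrC lerB.
Qed.

Definition holder_exp p m : R := (Num.max (max_index p) (r_exp m))^-1.

Lemma holder_exp_gt0 p m : (forall j, 1 < p j) -> 0 < holder_exp p m.
Proof.
move=> p1; rewrite invr_gt0 lt_max (lt_le_trans _ (le_max_index p ord0))//.
exact: lt_trans (p1 _).
Qed.

Lemma holder_exp_le p m j : (forall j, 1 < p j) -> holder_exp p m <= (p j)^-1.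
Proof.
move=> p1; have pj0 : 0 < p j by exact: lt_trans (p1 j).
rewrite /holder_exp lef_pV2 ?posrE//; last first.
  by rewrite lt_max (lt_le_trans pj0) ?le_max_index.
by rewrite le_max le_max_index.
Qed.

End exponents.

Section increment_estimate.
Context (R : realType) (n : nat).
Local Notation X := 'rV[R]_n.+1.
Local Notation leb := (lebesgue_rV R n.+1).
Local Notation lebXT := (lebesgue_rVT R n.+1).
Variables (Om : set X) (T : R) (p m : 'I_n.+1 -> R).
Hypothesis openOm : open Om.
Hypothesis bOm : bounded_set Om.
Hypothesis T_gt0 : 0 < T.
Hypothesis p_gt1 : forall j, 1 < p j.
Local Notation gam := (holder_exp p m).

Lemma Lp_norm_wderive_le v j :
  (Lp_norm leb Om (p j) (wderive leb Om (dx R j) v) <= V_norm Om p m v)%E.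
Proof.
rewrite /V_norm (bigD1 j)//= addeCA leeDl// adde_ge0 ?Lnorm_ge0//.
by apply: sume_ge0 => i _; exact: Lnorm_ge0.
Qed.

(** [V_norm] is defined with a weak derivative chosen arbitrarily; by uniqueness
    it agrees almost everywhere with the classical one. *)
Lemma Lp_norm_derive_le phi j : test_function Om phi ->
  (Lp_norm leb Om (p j) ('D_(dx R j) phi) <= V_norm Om p m phi)%E.
Proof.
move=> tphi; apply: le_trans (Lp_norm_wderive_le phi j).
rewrite le_eqVlt; apply/orP; left; apply/eqP; apply: ae_eq_Lp_norm.
  by rewrite gt_eqF// (lt_trans _ (p_gt1 j)).
apply: ae_eq_sym; apply: (wderive_ae_eq (coordinates_rV R n) openOm).
exact: test_function_weak_derivative.
Qed.

Variables (B : 'I_n.+1 -> X * R -> R) (f u : X * R -> R) (sigma : R) (G : set R).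
Hypothesis BLp : forall j, Lp lebXT (cylinder Om T) (p j / (p j - 1)) (B j).
Hypothesis sigma_ge1 : 1 <= sigma.
Hypothesis fLp :
  Lp lebXT (cylinder Om T) (sigma * (hmean_exp p / (hmean_exp p - 1))) f.
Hypothesis GI : forall t, G t -> t \in `]0, T[.
Hypothesis incr : increment_identity Om B f u G.

Let measurable_tf phi : test_function Om phi -> measurable_fun [set: X] phi.
Proof.
move=> tphi; apply: (continuous_measurable_crd (coordinates_rV R n)).
by apply: smooth_continuous; case: tphi.
Qed.

(** The source is only paired with the test function itself; in a direction
    [j] with [p j] above the harmonic mean Poincare's inequality replaces it by
    the derivative. *)
Lemma increment_estimate : exists2 C : R, 0 <= C &
  forall t1 t2 phi, G t1 -> G t2 -> test_function Om phi ->
    (`|pairing Om u phi t1 - pairing Om u phi t2|%:E <=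
     (C * `|t1 - t2| `^ gam)%:E * V_norm Om p m phi)%E.
Proof.
have g0 : 0 < gam := holder_exp_gt0 m p_gt1.
have [j0 hj0] := exists_ge_hmean_exp p_gt1.
have fLp0 : Lp lebXT (cylinder Om T) (p j0 / (p j0 - 1)) f.
  apply: (Lp_antitone (measurable_cylinder T openOm)) fLp.
  - exact: cylinder_lty.
  - by rewrite divr_gt0 ?subr_gt0// (lt_trans _ (p_gt1 j0)).
  - by apply: conjugate_le => //; exact: hmean_exp_gt1.
have [P P0 hP] := bounded_poincare bOm.
have [Kf Kf0 hKf] := hoelder_cylinder openOm T_gt0 (p_gt1 j0) g0
  (holder_exp_le m j0 p_gt1) fLp0.
have /choice[K hK] : forall j, exists K : R, 0 <= K /\ forall t1 t2 psi,
    t1 \in `]0, T[ -> t2 \in `]0, T[ -> t1 <= t2 ->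
    measurable_fun [set: X] psi -> Lp leb Om (p j) psi ->
    (`|\int[lebXT]_(z in Om `*` [set` `]t1, t2]]) (B j z * psi z.1)|%:E <=
     (K * `|t1 - t2| `^ gam)%:E * Lp_norm leb Om (p j) psi)%E.
  move=> j; have [K K0 hK] := hoelder_cylinder openOm T_gt0 (p_gt1 j) g0
    (holder_exp_le m j p_gt1) (BLp j).
  by exists K.
have C0 : 0 <= Kf * P + \sum_j K j.
  by rewrite addr_ge0 ?mulr_ge0// sumr_ge0// => j _; have [] := hK j.
exists (Kf * P + \sum_j K j) => // t1 t2 phi.
wlog t12 : t1 t2 / t1 <= t2 => [wh|].
  have [/wh//|/ltW t21] := leP t1 t2.
  by move=> G1 G2 tphi; rewrite distrC [`|t1 - t2|]distrC; exact: wh.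
move=> G1 G2 tphi.
have t1I := GI G1; have t2I := GI G2.
rewrite distrC (incr G1 G2 t12 tphi).
have tD j := test_function_derive (dx R j) tphi.
have tau0 : 0 <= `|t1 - t2| `^ gam := powR_ge0 _ _.
apply: (@le_trans _ _
  ((Kf * P * `|t1 - t2| `^ gam)%:E * V_norm Om p m phi +
   \sum_j ((K j * `|t1 - t2| `^ gam)%:E * V_norm Om p m phi))%E); last first.
  have V0 : (0 <= V_norm Om p m phi)%E.
    by apply: le_trans (Lp_norm_wderive_le phi j0); exact: Lnorm_ge0.
  rewrite -ge0_sume_distrl; last first.
    by move=> j _; rewrite lee_fin mulr_ge0//; have [] := hK j.
  rewrite -ge0_muleDl ?lee_fin ?mulr_ge0//; last first.
    by apply: sume_ge0 => j _; rewrite lee_fin mulr_ge0//; have [] := hK j.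
  by rewrite sumEFin -EFinD -mulr_suml -mulrDl.
apply: (@le_trans _ _ (`|\int[lebXT]_(z in Om `*` [set` `]t1, t2]]) (f z * phi z.1)|%:E +
  `|\sum_j \int[lebXT]_(z in Om `*` [set` `]t1, t2]]) (B j z * 'D_(dx R j) phi z.1)|%:E)%E).
  by rewrite -EFinD lee_fin; exact: ler_normB.
apply: leeD.
  apply: le_trans (hKf _ _ _ t1I t2I t12 (measurable_tf tphi) _) _.
    by apply: test_function_Lp => //; exact: lt_trans (p_gt1 j0).
  rewrite mulrAC [in leRHS]EFinM -muleA lee_wpmul2l ?lee_fin ?mulr_ge0//.
  apply: le_trans (hP j0 _ _ (p_gt1 j0) tphi) _.
  by rewrite lee_wpmul2l ?lee_fin//; exact: Lp_norm_derive_le.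
apply: (@le_trans _ _ (\sum_j
  `|\int[lebXT]_(z in Om `*` [set` `]t1, t2]]) (B j z * 'D_(dx R j) phi z.1)|%:E)%E).
  by rewrite sumEFin lee_fin; exact: ler_norm_sum.
apply: lee_sum => j _; have [Kj0 hKj] := hK j.
apply: le_trans (hKj _ _ _ t1I t2I t12 (measurable_tf (tD j)) _) _.
  by apply: (test_function_Lp openOm bOm) (tD j); exact: lt_trans (p_gt1 j).
rewrite lee_wpmul2l ?lee_fin ?mulr_ge0//.
exact: Lp_norm_derive_le.
Qed.

End increment_estimate.

(** * Application to the doubly nonlinear equation *)

Section solution.
Context (R : realType) (n : nat).
Local Notation X := 'rV[R]_n.+1.
Local Notation leb := (lebesgue_rV R n.+1).
Local Notation lebXT := (lebesgue_rVT R n.+1).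
Variables (Om : set X) (T : R) (p m : 'I_n.+1 -> R).
Variables (a : 'I_n.+1 -> X * R -> R -> R) (Lam c sigma : R) (f u : X * R -> R).
Hypothesis openOm : open Om.
Hypothesis bOm : bounded_set Om.
Hypothesis T_gt0 : 0 < T.
Hypothesis p_gt1 : forall j, 1 < p j.
Hypothesis m_ge1 : forall j, 1 <= m j.
Hypothesis Lam_gt0 : 0 < Lam.
Hypothesis a_meas : forall j s,
  lebesgue_measurable lebXT (cylinder Om T) (fun z => a j z s).
Hypothesis a_bounds : forall j z s, cylinder Om T z -> Lam^-1 <= a j z s <= Lam.
Hypothesis a_lip : forall j z s1 s2, cylinder Om T z ->
  `|a j z s1 - a j z s2| <= c * `|s1 - s2|.
Hypothesis sigma_gt : 1 + n.+1%:R / hmean_exp p < sigma.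
Hypothesis f_Lp :
  Lp lebXT (cylinder Om T) (sigma * (hmean_exp p / (hmean_exp p - 1))) f.
Hypothesis u_sol : weak_solution Om T p m a f u.
Local Notation cyl := (cylinder Om T).

Let mOm : measurable Om. Proof. exact: (open_measurable_crd (coordinates_rV R n)). Qed.
Let mC : measurable cyl. Proof. exact: measurable_cylinder. Qed.
Let Coo : (lebXT cyl < +oo)%E. Proof. exact: cylinder_lty. Qed.
Let openC : open cyl.
Proof.
rewrite openE => -[x t] [/= Ox It]; exists (Om, `]0, T[%classic) => //=.
by split; apply: open_nbhs_nbhs; split => //; exact: interval_open.
Qed.

Let hmean_gt1 : 1 < hmean_exp p. Proof. exact: hmean_exp_gt1. Qed.

Lemma sigma_ge1 : 1 <= sigma.
Proof.
apply: le_trans (ltW sigma_gt); rewrite lerDl divr_ge0//.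
by rewrite ltW// (lt_trans _ hmean_gt1).
Qed.

Let q_ge1 (q : R) : 1 < q -> 1 <= q / (q - 1).
Proof.
by move=> q1; rewrite ler_pdivlMr ?subr_gt0// mul1r gerBl.
Qed.

(** The coefficient composed with [u] is measurable only up to a null set, so it
    is replaced by a Borel function. Truncating that function between 0 and
    [Lam] makes the bound on the coefficient hold everywhere. *)
Lemma flux_representative j : exists2 B : X * R -> R,
  Lp lebXT cyl (p j / (p j - 1)) B &
  ae_eq lebXT cyl
    (fun z => a j z (u z) * (`|dpow Om T m u j z| `^ (p j - 2) * dpow Om T m u j z)) B.
Proof.
have [[uLp ud] _] := u_sol; have [g gd gLp] := ud j.
have dg : ae_eq lebXT cyl (dpow Om T m u j) g.
  exact: (wderive_ae_eq (coordinates_rVR R n) openC gd).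
have mu_ : measurable_fun cyl u := Lp_measurable mC uLp.
have [b mb ab] := caratheodory_ae_measurable mC (a_meas j) (a_lip j) mu_.
pose b' z := Num.max 0 (Num.min Lam (b z)).
exists (fun z => b' z * (`|g z| `^ (p j - 2) * g z)).
  apply: (Lp_conjugate_flux mC (p_gt1 j) (ltW Lam_gt0)) => //.
  - apply: measurable_maxr => //; exact: measurable_minr.
  - move=> z; rewrite ger0_norm ?le_max ?lexx// ge_max (ltW Lam_gt0)/=.
    by rewrite ge_min lexx.
apply: filterS2 dg ab => z dz az Cz.
have /andP[a0 aL] := a_bounds j (u z) Cz.
have -> : b' z = a j z (u z).
  rewrite /b' -(az Cz) min_r// max_r// (le_trans _ a0)// invr_ge0.
  exact: ltW.
by rewrite (dz Cz).
Qed.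

Local Notation mm := (min_index m).

Lemma min_index_ge1 : 1 <= mm. Proof. exact: min_index_ge. Qed.

(** The set [G] collects the times at which the increment identity holds for all
    test functions and at which [u] lies in the space dual to the zero order
    part of the norm of [V]. *)
Lemma solution_increment : exists G : set R, exists C : R,
  [/\ 0 <= C, {ae @lebesgue_R R, forall t, t \in `]0, T[ -> G t},
    forall t, G t -> (t \in `]0, T[) /\ Lp leb Om (mm + 1) (fun x => u (x, t)) &
    forall t1 t2 phi, G t1 -> G t2 -> test_function Om phi ->
      (`|pairing Om u phi t1 - pairing Om u phi t2|%:E <=
       (C * `|t1 - t2| `^ holder_exp p m)%:E * V_norm Om p m phi)%E].
Proof.
have mm1 := min_index_ge1.
have mm0 : 0 < mm + 1 by rewrite ltr_wpDl// (le_trans _ mm1).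
have [[uLq _] weak] := u_sol.
have uLp : Lp lebXT cyl (mm + 1) u.
  by apply: (Lp_antitone mC Coo mm0 _ uLq); rewrite /q_star le_max lexx.
have /choice[B hB] : forall j, exists B : X * R -> R,
    Lp lebXT cyl (p j / (p j - 1)) B /\
    ae_eq lebXT cyl
    (fun z => a j z (u z) * (`|dpow Om T m u j z| `^ (p j - 2) * dpow Om T m u j z)) B.
  by move=> j; have [B ? ?] := flux_representative j; exists B.
have iB j : lebXT.-integrable cyl (EFin \o B j).
  exact: (Lp_integrable mC Coo (q_ge1 (p_gt1 j)) (hB j).1).
have if_ : lebXT.-integrable cyl (EFin \o f).
  apply: (Lp_integrable mC Coo _ f_Lp).
  by rewrite -[leLHS]mulr1 ler_pM ?sigma_ge1 ?q_ge1.
have iu : lebXT.-integrable cyl (EFin \o u).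
  by apply: (Lp_integrable mC Coo _ uLp); rewrite lerDr (le_trans _ mm1).
have weakB phi : test_function cyl phi ->
  (\int[lebXT]_(z in cyl)
     ((\sum_j B j z * 'D_(dx_T R j) phi z) - u z * 'D_(dt_T R n) phi z)%:E =
   \int[lebXT]_(z in cyl) (f z * phi z)%:E)%E.
  move=> tphi; rewrite -(weak phi tphi); apply: integral_ae_eq_nonmeasurable.
  have := ae_forall_countType (fun j => (hB j).2).
  apply: filterS => z hz Cz; congr (_ - _)%:E.
  by apply: eq_bigr => j _; rewrite (hz j Cz).
have [G [aeG GI incr]] := pairing_increment openOm bOm T_gt0 iB if_ iu weakB.
have [C C0 hC] := increment_estimate m openOm bOm T_gt0 p_gt1
  (fun j => (hB j).1) sigma_ge1 f_Lp (fun t Gt => (GI t Gt).1) incr.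
have mI : measurable [set` `]0, T[] by exact: (@measurable_itv R).
have iup := ((Lp_powR_integrable _ mC u mm0).1 uLp).2.
have aes := @ae_integrable_slice _ _ _ _ R leb (@lebesgue_R R) Om mOm _ _ mI iup.
exists (G `&` [set t : R | (leb.-integrable Om (fun x => (`|u (x, t)| `^ (mm + 1))%:E))]), C.
split => //.
- by apply: filterS2 aeG aes => t h1 h2 tI; split; [exact: h1|exact: h2].
- move=> t [Gt it]; have [tI iut] := GI t Gt; split => //.
  apply/(Lp_powR_integrable _ mOm _ mm0); split => //.
  by apply/measurable_EFinP; exact: (measurable_int _ iut).
- by move=> t1 t2 phi [G1 _] [G2 _]; exact: hC.
Qed.

End solution.

(** * Density of test functions in V *)

Section space_V_facts.
Context (R : realType) (n : nat).
Local Notation X := 'rV[R]_n.+1.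
Local Notation leb := (lebesgue_rV R n.+1).
Local Notation l := (coordinates_rV R n).
Variables (Om : set X) (p m : 'I_n.+1 -> R).
Hypothesis openOm : open Om.
Hypothesis bOm : bounded_set Om.
Hypothesis p_gt1 : forall j, 1 < p j.
Hypothesis m_ge1 : forall j, 1 <= m j.
Local Notation V_norm := (V_norm Om p m).
Local Notation V_space := (V_space Om p m).
Local Notation W_space := (W_space Om p m).
Local Notation mm := (min_index m).
Local Notation r := (r_exp m).
Implicit Types (v w phi : X -> R).

Let mOm : measurable Om. Proof. exact: (open_measurable_crd l). Qed.
Let mm1 : 1 <= mm. Proof. exact: min_index_ge. Qed.
Let mm0 : 0 < mm. Proof. exact: lt_le_trans mm1. Qed.
Let p_neq0 j : p j != 0. Proof. by rewrite gt_eqF// (lt_trans _ (p_gt1 j)). Qed.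

Lemma r_exp_gt1 : 1 < r.
Proof. by rewrite /r_exp ltr_pdivlMr// mul1r ltrDl. Qed.

Let r_gt0 : 0 < r. Proof. exact: lt_trans r_exp_gt1. Qed.

Let conj_r : (mm + 1)^-1 + r^-1 = 1.
Proof.
by rewrite /r_exp invf_div -[X in X + _]mul1r -mulrDl [1 + _]addrC divff// gt_eqF// ltr_wpDl// ltW.
Qed.

Lemma V_norm_ge0 v : (0 <= V_norm v)%E.
Proof. by rewrite adde_ge0 ?Lnorm_ge0//; apply: sume_ge0 => j _; exact: Lnorm_ge0. Qed.

Lemma Lp_norm_le_V_norm v : (Lp_norm leb Om r v <= V_norm v)%E.
Proof. by rewrite leeDl//; apply: sume_ge0 => j _; exact: Lnorm_ge0. Qed.

Lemma W_space_V_norm_fin v : W_space v -> V_norm v \is a fin_num.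
Proof.
move=> [vr vd]; rewrite ge0_fin_numE ?V_norm_ge0//.
apply: lte_add_pinfty; first exact: Lp_norm_lty vr.
apply: lte_sum_pinfty => j _; have [g gd gp] := vd j.
rewrite (ae_eq_Lp_norm (p_neq0 j) (wderive_ae_eq l openOm gd)).
exact: Lp_norm_lty gp.
Qed.

Lemma test_function_W_space phi : test_function Om phi -> W_space phi.
Proof.
move=> tphi; split; first exact: (test_function_Lp openOm bOm).
move=> j; exists ('D_(dx R j) phi); first exact: test_function_weak_derivative.
apply: (test_function_Lp openOm bOm); first exact: lt_trans (p_gt1 j).
exact: test_function_derive.
Qed.

Lemma V_norm_triangle v w : W_space v -> W_space w ->
  (V_norm w <= V_norm v + V_norm (v \- w)%R)%E.
Proof.
move=> [vr vd] [wr wd]; rewrite /Defs.V_norm addeACA; apply: leeD.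
  apply: Lp_norm_triangle => //; first exact: ltW r_exp_gt1.
    exact: Lp_measurable wr.
  exact: Lp_measurable vr.
rewrite -big_split/=; apply: lee_sum => j _.
have [g gd gp] := vd j; have [h hd hp] := wd j.
rewrite (ae_eq_Lp_norm (p_neq0 j) (wderive_ae_eq l openOm gd)).
rewrite (ae_eq_Lp_norm (p_neq0 j) (wderive_ae_eq l openOm hd)).
rewrite (ae_eq_Lp_norm (p_neq0 j)
  (wderive_ae_eq l openOm (weak_derivativeB l openOm gd hd))).
apply: Lp_norm_triangle => //; first exact: ltW.
  exact: Lp_measurable hp.
exact: Lp_measurable gp.
Qed.

Lemma V_norm0 : V_norm (cst 0) = 0%E.
Proof.
have N0 q : 0 < q -> Lp_norm leb Om q (cst 0) = 0%E.
  move=> q0; rewrite /Lp_norm Lnorm_restrict ?gt_eqF//.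
  under eq_integral do rewrite normr0 powR0 ?gt_eqF//.
  by rewrite integral0 poweR0r// invr_neq0// gt_eqF.
rewrite /Defs.V_norm N0// add0e big1// => j _.
have d0 : weak_derivative leb Om (dx R j) (cst 0) (cst 0).
  have := test_function_weak_derivative (dx R j) (test_function0 Om).
  by rewrite (_ : 'D_(dx R j) _ = cst 0)//; apply/funext => x; rewrite derive_cst.
rewrite (ae_eq_Lp_norm (p_neq0 j) (wderive_ae_eq l openOm d0)) N0//.
exact: lt_trans (p_gt1 j).
Qed.

Lemma V_space0 : V_space (cst 0).
Proof.
have t0 := test_function0 Om; split; first exact: test_function_W_space.
move=> e e0; exists (cst 0) => //.
rewrite (_ : (_ \- _) = cst 0) ?V_norm0 ?lte_fin//.
by apply/funext => x /=; rewrite subr0.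
Qed.

Lemma pairing_integrable w v : Lp leb Om (mm + 1) w -> Lp leb Om r v ->
  leb.-integrable Om (fun x => (w x * v x)%:E).
Proof.
move=> wp vr; apply: (hoelder_integrable mOm _ r_gt0 conj_r wp vr).
by rewrite ltr_wpDl// ltW.
Qed.

Lemma pairing_bound w v : Lp leb Om (mm + 1) w -> Lp leb Om r v ->
  (`|\int[leb]_(x in Om) (w x * v x)|%:E <=
    Lp_norm leb Om (mm + 1) w * V_norm v)%E.
Proof.
move=> wp vr; apply: (@le_trans _ _ (Lp_norm leb Om (mm + 1) w * Lp_norm leb Om r v)%E).
  by apply: (hoelder_Rintegral mOm _ r_gt0 conj_r wp vr); rewrite ltr_wpDl// ltW.
by rewrite lee_wpmul2l ?Lnorm_ge0// Lp_norm_le_V_norm.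
Qed.

(** Both sides of an estimate for test functions are continuous for the norm
    of [V], hence the estimate extends to the closure. *)
Lemma V_space_extend_estimate w1 w2 (K : R) : 0 <= K ->
  Lp leb Om (mm + 1) w1 -> Lp leb Om (mm + 1) w2 ->
  (forall phi, test_function Om phi ->
    (`|\int[leb]_(x in Om) (w1 x * phi x) - \int[leb]_(x in Om) (w2 x * phi x)|%:E
     <= K%:E * V_norm phi)%E) ->
  forall v, V_space v ->
    `|\int[leb]_(x in Om) (w1 x * v x) - \int[leb]_(x in Om) (w2 x * v x)|
     <= K * fine (V_norm v).
Proof.
move=> K0 w1p w2p hK v [vW vcl].
have Vv := W_space_V_norm_fin vW.
have N1 : Lp_norm leb Om (mm + 1) w1 \is a fin_num.
  by rewrite ge0_fin_numE ?Lnorm_ge0//; exact: Lp_norm_lty w1p.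
have N2 : Lp_norm leb Om (mm + 1) w2 \is a fin_num.
  by rewrite ge0_fin_numE ?Lnorm_ge0//; exact: Lp_norm_lty w2p.
set N1r := fine (Lp_norm leb Om (mm + 1) w1).
set N2r := fine (Lp_norm leb Om (mm + 1) w2).
have N1r0 : 0 <= N1r by rewrite fine_ge0// Lnorm_ge0.
have N2r0 : 0 <= N2r by rewrite fine_ge0// Lnorm_ge0.
have key e : 0 < e ->
    `|\int[leb]_(x in Om) (w1 x * v x) - \int[leb]_(x in Om) (w2 x * v x)|
     <= K * fine (V_norm v) + (N1r + N2r + K) * e.
  move=> e0; have [phi tphi vphi] := vcl e e0.
  have phiW := test_function_W_space tphi.
  have mvphi : measurable_fun Om (v \- phi).
    by apply: measurable_funB; [exact: Lp_measurable vW.1|exact: Lp_measurable phiW.1].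
  have vphir : Lp leb Om r (v \- phi).
    apply: (LpP mOm) => //; apply: le_lt_trans (Lp_norm_le_V_norm _) _.
    exact: lt_trans vphi (ltry _).
  have split_int w : Lp leb Om (mm + 1) w ->
      \int[leb]_(x in Om) (w x * v x) = \int[leb]_(x in Om) (w x * (v \- phi) x) +
        \int[leb]_(x in Om) (w x * phi x).
    move=> wp; rewrite -RintegralD//; first last.
    - exact: pairing_integrable phiW.1.
    - exact: pairing_integrable vphir.
    by apply: eq_Rintegral => x _; rewrite -mulrDr /= subrK.
  have Vphi : fine (V_norm phi) <= fine (V_norm v) + e.
    rewrite -lee_fin EFinD !fineK ?W_space_V_norm_fin//.
    apply: le_trans (V_norm_triangle vW phiW) _.
    by rewrite leeD2l// ltW.
  have small w (wp : Lp leb Om (mm + 1) w) :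
      `|\int[leb]_(x in Om) (w x * (v \- phi) x)| <=
      fine (Lp_norm leb Om (mm + 1) w) * e.
    have Nw : Lp_norm leb Om (mm + 1) w \is a fin_num.
      by rewrite ge0_fin_numE ?Lnorm_ge0//; exact: Lp_norm_lty wp.
    rewrite -lee_fin EFinM fineK//; apply: le_trans (pairing_bound wp vphir) _.
    by rewrite lee_wpmul2l ?Lnorm_ge0// ltW.
  have hphi : `|\int[leb]_(x in Om) (w1 x * phi x) - \int[leb]_(x in Om) (w2 x * phi x)|
      <= K * fine (V_norm phi).
    by rewrite -lee_fin EFinM fineK ?W_space_V_norm_fin//; exact: hK.
  rewrite (split_int _ w1p) (split_int _ w2p) opprD addrACA.
  apply: le_trans (ler_normD _ _) _.
  apply: (@le_trans _ _ ((N1r * e + N2r * e) + K * (fine (V_norm v) + e))).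
    apply: lerD.
      apply: le_trans (ler_normB _ _) _; apply: lerD; exact: small.
    by apply: le_trans hphi _; rewrite ler_wpM2l.
  by rewrite le_eqVlt; apply/orP; left; apply/eqP; ring.
apply/ler_addgt0Pr => e e0.
have D0 : 0 < N1r + N2r + K + 1 by rewrite ltr_wpDl// !addr_ge0.
apply: le_trans (key (e / (N1r + N2r + K + 1)) _) _; first exact: divr_gt0.
rewrite lerD2l mulrA ler_pdivrMr// mulrC ler_wpM2l ?ltW//.
by rewrite ltrDl.
Qed.

End space_V_facts.

(** * Hoelder functions on a dense set of times *)

Section hoelder_limits.
Context (R : realType).
Implicit Types (F : R -> R) (s : R^nat) (t : R).

Lemma continuous_norm_powR (gam : R) : 0 < gam ->
  continuous (fun x : R => `|x| `^ gam).
Proof.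
move=> gam0 x; have [->|x0] := eqVneq x 0; last first.
  have h : (fun y : R => expR (gam * ln `|y|)) y @[y --> x] --> expR (gam * ln `|x|).
    apply: (@continuous_cvg _ _ _ _ _ (fun y : R => gam * ln `|y|) (@expR R)); first exact: continuous_expR.
    apply: cvgMl_tmp; apply: (@cvg_comp _ _ _ (fun y : R => `|y|) (@ln R) _ (nbhs `|x|)).
      exact: norm_continuous.
    by apply: continuous_ln; rewrite normr_gt0.
  have px (y : R) : y != 0 -> `|y| `^ gam = expR (gam * ln `|y|).
    by rewrite -normr_gt0 => y0; rewrite /powR gt_eqF.
  rewrite /continuous_at px//; apply: cvg_trans h; apply: near_eq_cvg.
  have : nbhs x [set y : R | y != 0] by exact: (@open_nbhs_nbhs _ _ _ (conj (@open_neq R 0) x0)).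
  by apply: filterS => y y0; rewrite px.
rewrite /continuous_at normr0 powR0 ?gt_eqF//.
apply/cvgrPdist_lt => e e0.
have h : \forall y \near (0 : R), `|y| < e `^ gam^-1.
  by apply: nbhs0_lt; exact: powR_gt0.
near=> y.
rewrite sub0r normrN ger0_norm ?powR_ge0//.
have -> : e = (e `^ gam^-1) `^ gam by rewrite -powRrM mulVf ?gt_eqF// powRr1// ltW.
apply: gt0_ltr_powR; rewrite ?nnegrE ?powR_ge0//.
near: y; exact: h.
Unshelve. all: by end_near.
Qed.

Variables (G : set R) (F : R -> R) (K gam : R).
Hypothesis gam0 : 0 < gam.
Hypothesis K0 : 0 <= K.
Hypothesis hF : forall t1 t2, G t1 -> G t2 -> `|F t1 - F t2| <= K * `|t1 - t2| `^ gam.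

(** The limit [t] may lie outside of [G]: Hoelder continuity is uniform, so the
    images form a Cauchy sequence. *)
Lemma hoelder_cvg s t : (forall k, G (s k)) -> s @ \oo --> t ->
  cvg ((F \o s) @ \oo).
Proof.
move=> Gs st; apply: cauchy_cvg; apply: cauchy_exP => e e0.
have c0 : (fun x : R => K * `|x| `^ gam) x @[x --> (0 : R)] --> (K * 0 : R).
  apply: cvgMl_tmp.
  have := @continuous_norm_powR gam gam0 (0 : R).
  by rewrite /continuous_at normr0 powR0// gt_eqF.
move: c0; rewrite mulr0 => /cvgrPdist_lt/(_ _ e0).
move=> /nbhs_ballP[d /= d0 hd].
have /cvgrPdist_lt/(_ _ (divr_gt0 d0 (ltr0n R 2))) [N _ hN] := st.
exists (F (s N)); exists N => // k /= Nk.
rewrite /ball/=; apply: le_lt_trans (hF (Gs N) (Gs k)) _.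
have : ball (0 : R) d (s N - s k).
  rewrite /ball/= sub0r normrN.
  rewrite (_ : s N - s k = (t - s k) - (t - s N)); last by ring.
  apply: le_lt_trans (ler_normB _ _) _; rewrite [ltRHS]splitr.
  by apply: ltrD; apply: hN => //=.
move=> /hd /=; rewrite sub0r normrN ger0_norm// mulr_ge0// powR_ge0.
Qed.

Lemma hoelder_lim s1 s2 t1 t2 : (forall k, G (s1 k)) -> (forall k, G (s2 k)) ->
  s1 @ \oo --> t1 -> s2 @ \oo --> t2 ->
  `|lim ((F \o s1) @ \oo) - lim ((F \o s2) @ \oo)| <= K * `|t1 - t2| `^ gam.
Proof.
move=> G1 G2 st1 st2; have c1 := hoelder_cvg G1 st1; have c2 := hoelder_cvg G2 st2.
apply: (@ler_cvg_to nat \oo _ R (fun k => `|F (s1 k) - F (s2 k)|)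
  (fun k => K * `|s1 k - s2 k| `^ gam)).
- exact: (cvg_norm (cvgB c1 c2)).
- apply: cvgMl_tmp.
  apply: (@continuous_cvg _ _ _ _ _ (fun k => s1 k - s2 k) (fun x : R => `|x| `^ gam)).
    exact: continuous_norm_powR.
  exact: (cvgB st1 st2).
- by apply: nearW => k; exact: hF.
Qed.

Lemma hoelder_lim_eq s t : G t -> (forall k, G (s k)) -> s @ \oo --> t ->
  lim ((F \o s) @ \oo) = F t.
Proof.
move=> Gt Gs st; apply/eqP; rewrite -subr_eq0 -normr_eq0 eq_le normr_ge0 andbT.
have := hoelder_lim Gs (fun=> Gt) st (cvg_cst t).
rewrite (_ : F \o cst t = cst (F t))// lim_cst// subrr normr0 powR0 ?gt_eqF// mulr0.
by apply; exact: eventually_filter.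
Qed.

End hoelder_limits.

(** An interval that misses [G] would be a null set of positive length. *)
Lemma ae_itv_dense (R : realType) (T : R) (G : set R) : 0 < T ->
  {ae @lebesgue_R R, forall t, t \in `]0, T[ -> G t} ->
  forall t, t \in `[0, T] -> exists2 s : R^nat, (forall k, G (s k)) & s @ \oo --> t.
Proof.
move=> T0 aeG t; rewrite in_itv/= => /andP[t0 tT].
have near_t e : 0 < e -> exists s, G s /\ `|t - s| < e.
  move=> e0; apply: contrapT => noG.
  pose lo := Num.max 0 (t - e); pose hi := Num.min T (t + e).
  have lohi : lo < hi.
    by rewrite /lo /hi gt_max !lt_min; apply/andP; split; apply/andP; split; lra.
  have [N [mN N0 hN]] := aeG.
  have sub : [set` `]lo, hi[] `<=` N.
    move=> s; rewrite /= in_itv/= /lo /hi gt_max lt_min.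
    move=> /andP[/andP[s0 ts] /andP[sT st]].
    apply: hN => /= hs; apply: noG; exists s; split.
      by apply: hs; rewrite in_itv/= s0 sT.
    by rewrite distrC ltr_norml; apply/andP; split; lra.
  have : (lebesgue_R [set` `]lo, hi[] <= lebesgue_R N)%E.
    apply: (le_measure (@lebesgue_R R) _ _ sub); rewrite inE//; exact: measurable_itv.
  rewrite N0 /lebesgue_R lebesgue_measure_itv/= lte_fin lohi.
  by rewrite -EFinB lee_fin subr_le0 leNgt lohi.
have /choice[s hs] : forall k : nat, exists s, G s /\ `|t - s| < k.+1%:R^-1.
  by move=> k; exact: near_t.
exists s => [k|]; first by have [] := hs k.
apply/cvgrPdist_lt => e e0; near=> k.
have [_ h] := hs k; apply: lt_trans h _.
near: k; exact: near_infty_natSinv_lt (PosNum e0).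
Unshelve. all: by end_near.
Qed.

(** * The continuous representative *)

Theorem lemma4p1 (R : realType) (n : nat)
  (Om : set 'rV[R]_n.+1) (T : R) (p m : 'I_n.+1 -> R)
  (a : 'I_n.+1 -> 'rV[R]_n.+1 * R -> R -> R) (Lam c sigma : R)
  (f u : 'rV[R]_n.+1 * R -> R)
  (Om_open : open Om) (Om_bounded : bounded_set Om) (T_gt0 : 0 < T)
  (p_gt1 : forall j, 1 < p j) (m_ge1 : forall j, 1 <= m j)
  (Lam_gt0 : 0 < Lam) (c_gt0 : 0 < c)
  (a_meas : forall j s,
     lebesgue_measurable (lebesgue_rVT R n.+1) (cylinder Om T)
       (fun z => a j z s))
  (a_bounds : forall j z s, cylinder Om T z -> Lam^-1 <= a j z s <= Lam)
  (a_lip : forall j z s1 s2, cylinder Om T z ->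
     `|a j z s1 - a j z s2| <= c * `|s1 - s2|)
  (sigma_gt : 1 + n.+1%:R / hmean_exp p < sigma)
  (f_Lp : Lp (lebesgue_rVT R n.+1) (cylinder Om T)
     (sigma * (hmean_exp p / (hmean_exp p - 1))) f)
  (f_ge0 : forall z, cylinder Om T z -> 0 <= f z)
  (u_sol : weak_solution Om T p m a f u) :
  exists U : R -> ('rV[R]_n.+1 -> R) -> R,
    [/\ C0T_V_dual Om p m T U,
        {ae lebesgue_measure, forall t : R, t \in `]0, T[ ->
           V_embed Om p m (fun x => u (x, t)) (U t)} &
        exists C : R, forall t1 t2 : R, t1 \in `[0, T] -> t2 \in `[0, T] ->
          (V_dual_norm Om p m (U t1 \- U t2)%R <=
           (C * `|t1 - t2| `^ (Num.max (max_index p) (r_exp m))^-1)%:E)%E].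
Proof.
set gam := (Num.max (max_index p) (r_exp m))^-1.
have gam0 : 0 < gam := holder_exp_gt0 m p_gt1.
have mOm : measurable Om := open_measurable_crd (coordinates_rV R n) Om_open.
have [G [C [C0 aeG GI hC]]] := solution_increment Om_open Om_bounded T_gt0
  p_gt1 m_ge1 Lam_gt0 a_meas a_bounds a_lip sigma_gt f_Lp u_sol.
have dense := ae_itv_dense T_gt0 aeG.
pose F v t := pairing Om u v t.
have uLp t : G t -> Lp (lebesgue_rV R n.+1) Om (min_index m + 1) (fun x => u (x, t)).
  by move=> Gt; have [] := GI t Gt.
have Fhol v : V_space Om p m v -> forall t1 t2, G t1 -> G t2 ->
    `|F v t1 - F v t2| <= (C * fine (V_norm Om p m v)) * `|t1 - t2| `^ gam.
  move=> vV t1 t2 G1 G2.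
  have K0 : 0 <= C * `|t1 - t2| `^ gam by rewrite mulr_ge0 ?powR_ge0.
  have := V_space_extend_estimate Om_open Om_bounded p_gt1 m_ge1 K0
    (uLp t1 G1) (uLp t2 G2) (fun phi tphi => hC t1 t2 phi G1 G2 tphi) vV.
  by rewrite mulrAC.
have Vfin v : V_space Om p m v -> V_norm Om p m v \is a fin_num.
  by move=> [vW _]; exact: W_space_V_norm_fin vW.
have Vfine0 v : 0 <= fine (V_norm Om p m v) by rewrite fine_ge0// V_norm_ge0.
have CV0 v : 0 <= C * fine (V_norm Om p m v) by rewrite mulr_ge0.
have /choice[sq hsq] : forall t, exists s : R^nat, t \in `[0, T] ->
    (forall k, G (s k)) /\ s @ \oo --> t.
  move=> t; have [tI|ntI] := boolP (t \in `[0, T]); last by exists (fun=> 0).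
  by have [s Gs st] := dense t tI; exists s.
pose U (t : R) v := lim ((F v \o sq t) @ \oo).
have Uhol v : V_space Om p m v -> forall t1 t2, t1 \in `[0, T] -> t2 \in `[0, T] ->
    `|U t1 v - U t2 v| <= (C * fine (V_norm Om p m v)) * `|t1 - t2| `^ gam.
  move=> vV t1 t2 /hsq[G1 st1] /hsq[G2 st2].
  exact: (hoelder_lim gam0 (CV0 v) (Fhol v vV) G1 G2 st1 st2).
have UG v t : V_space Om p m v -> G t -> U t v = F v t.
  move=> vV Gt; have [tI _] := GI t Gt.
  have /hsq[Gs st] : t \in `[0, T] by apply: subset_itv_oo_cc tI.
  exact: (hoelder_lim_eq gam0 (CV0 v) (Fhol v vV) Gt Gs st).
have dual_bound t1 t2 : t1 \in `[0, T] -> t2 \in `[0, T] ->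
    (V_dual_norm Om p m (U t1 \- U t2)%R <= (C * `|t1 - t2| `^ gam)%:E)%E.
  move=> I1 I2; apply: ge_ereal_sup => _ [v [vV v1] <-].
  rewrite lee_fin; apply: le_trans (Uhol v vV t1 t2 I1 I2) _.
  rewrite mulrAC ler_piMr ?mulr_ge0 ?powR_ge0//.
  by rewrite -lee_fin fineK ?Vfin.
have pair_int w v : Lp (lebesgue_rV R n.+1) Om (min_index m + 1) w ->
    V_space Om p m v ->
    (lebesgue_rV R n.+1).-integrable Om (fun x => (w x * v x)%:E).
  by move=> wp [[vr _] _]; exact: pairing_integrable vr.
exists U; split.
- split => [t tI|t tI].
    have [Gs st] := hsq t tI; split.
      move=> k v w vV wV.
      have cv := hoelder_cvg gam0 (CV0 v) (Fhol v vV) Gs st.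
      have cw := hoelder_cvg gam0 (CV0 w) (Fhol w wV) Gs st.
      apply: cvg_lim => //.
      rewrite (_ : _ \o _ = (fun i => k * (F v \o sq t) i + (F w \o sq t) i)); last first.
        apply/funext => i /=; rewrite /F /pairing.
        rewrite -RintegralZl//; last exact: pair_int (uLp _ (Gs i)) vV.
        rewrite -RintegralD//; first last.
        - exact: pair_int (uLp _ (Gs i)) wV.
        - exact: (integrableZl mOm k (pair_int _ _ (uLp _ (Gs i)) vV)).
        by apply: eq_Rintegral => x _; ring.
      by apply: cvgD => //; apply: cvgMl_tmp.
    (* boundedness at [t] follows from boundedness at one time of [G] *)
    have G0 := Gs 0%N; have w0 := uLp _ G0; have I0 : sq t 0%N \in `[0, T].
      by apply: subset_itv_oo_cc; have [] := GI _ G0.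
    have N0 : Lp_norm (lebesgue_rV R n.+1) Om (min_index m + 1) (fun x => u (x, sq t 0%N)) \is a fin_num.
      by rewrite ge0_fin_numE ?Lnorm_ge0//; exact: Lp_norm_lty w0.
    exists (fine (Lp_norm (lebesgue_rV R n.+1) Om (min_index m + 1) (fun x => u (x, sq t 0%N))) +
      C * `|t - sq t 0%N| `^ gam) => v vV.
    rewrite -(fineK (Vfin v vV)) lee_fin mulrDl.
    rewrite -[U t v](subrK (U (sq t 0%N) v)) addrC.
    apply: le_trans (ler_normD _ _) _; apply: lerD; last first.
      by rewrite mulrAC; exact: Uhol.
    rewrite UG// -lee_fin EFinM !fineK ?Vfin//.
    by have [[vr _] _] := vV; exact: (pairing_bound p Om_open m_ge1 w0 vr).
  apply: (@squeeze_cvge R (within [set` `[0, T]] (nbhs t)) _ R (cst 0%E) _ (fun s => (C * `|s - t| `^ gam)%:E)).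
  + rewrite near_withinE; apply: nearW => s sI; apply/andP; split; last exact: dual_bound.
    apply: ereal_sup_ubound; exists (cst 0).
      split; first exact: V_space0.
      by rewrite V_norm0.
    (* the supremum is nonnegative because it is at least the value at 0 *)
    congr EFin; apply/eqP; rewrite eq_le normr_ge0 andbT.
    have := Uhol _ (V_space0 Om_open Om_bounded p_gt1 m_ge1) s t sI tI.
    by rewrite V_norm0//= mulr0 mul0r.
  + exact: cvg_cst.
  + apply: cvg_within_filter; apply: cvg_EFin; first exact: nearW.
    rewrite (_ : 0 = C * `|t - t| `^ gam); last first.
      by rewrite subrr normr0 powR0 ?mulr0// gt_eqF.
    apply: cvgMl_tmp.
    apply: (@continuous_cvg _ _ _ _ _ (fun s => s - t) (fun x : R => `|x| `^ gam)).
      exact: continuous_norm_powR.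
    by apply: cvgB; [exact: cvg_id|exact: cvg_cst].
- apply: filterS aeG => t Gt tI v vV.
  split; first exact: pair_int (uLp _ (Gt tI)) vV.
  exact: UG (Gt tI).
- by exists C.
Qed.
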